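(* For every $p\ge 1$, \[\sup\big\{\|V_2^I A f\|_{L^p(\mathbb{R}^2)} : f\in \mathcal{S}(\mathbb{R}^2),\ \|f\|_{L^p(\mathbb{R}^2)}\le 1\big\}=\infty .\]
   Context: For $f$ on $\mathbb{R}^2$ and $t>0$, the circular average is $A_t f(x)=\frac{1}{2\pi}\int_0^{2\pi} f(x_1-t\cos\alpha,\,x_2-t\sin\alpha)\,d\alpha$. Let $I=[1,2]$. The local $2$-variation operator is \[V_2^I A f(x)=\sup_{N\in\mathbb{N}}\ \sup_{t_1<\dots<t_N,\ t_j\in I}\Big(\sum_{j=1}^{N-1}|A_{t_{j+1}}f(x)-A_{t_j}f(x)|^2\Big)^{1/2}.\] $\mathcal{S}(\mathbb{R}^2)$ denotes the Schwartz class. *)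

(* Defs.v *)
From HB Require Import structures.
From mathcomp Require Import all_boot all_order all_algebra.
From mathcomp Require Import all_classical all_reals all_analysis.
Set Implicit Arguments. Unset Strict Implicit. Unset Printing Implicit Defensive.
Import Order.TTheory GRing.Theory Num.Theory.
Import numFieldNormedType.Exports.
Local Open Scope classical_set_scope.
Local Open Scope ring_scope.

Section defs.
Variable R : realType.

Definition leb2 := (@lebesgue_measure R \x @lebesgue_measure R)%E.

Definition pderiv (b : bool) (g : R * R -> R) : R * R -> R :=
  fun x => if b then derive1 (fun s => g (s, x.2)) x.1
           else derive1 (fun s => g (x.1, s)) x.2.

Definition pderivable (b : bool) (g : R * R -> R) (x : R * R) : Prop :=
  if b then derivable (fun s => g (s, x.2)) x.1 1
  else derivable (fun s => g (x.1, s)) x.2 1.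

Definition iter_pderiv (ds : seq bool) (g : R * R -> R) : R * R -> R :=
  foldr pderiv g ds.

Definition enorm2 (x : R * R) : R := Num.sqrt (x.1 ^+ 2 + x.2 ^+ 2).

Definition schwartz (f : R * R -> R) : Prop :=
  forall ds : seq bool,
    (forall (b : bool) (x : R * R), pderivable b (iter_pderiv ds f) x) /\
    (forall N : nat, exists C : R, forall x : R * R,
        (1 + enorm2 x) ^+ N * `|iter_pderiv ds f x| <= C).

Definition circ_avg (t : R) (f : R * R -> R) (x : R * R) : R :=
  (2 * pi)^-1 * Rintegral (@lebesgue_measure R) `[0, 2 * pi]%classic
    (fun a => f (x.1 - t * cos a, x.2 - t * sin a)).

Definition V2I (f : R * R -> R) (x : R * R) : \bar R :=
  ereal_sup [set y : \bar R | exists s : seq R,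
    [/\ sorted <%R s, all (fun t => (1 <= t <= 2)) s &
      y = (Num.sqrt (\sum_(j < (size s).-1)
             (circ_avg (nth 0 s j.+1) f x - circ_avg (nth 0 s j) f x) ^+ 2))%:E]].

End defs.

(* Main.v *)
(** For p <= 2 take f = N^(-1/2) sum_(k < N) 2^k chi(2^k x), a truncation of the
    function 1/|x|: its L^p norms are bounded, but the circle of radius |x| about
    x passes through the origin, so that A_|x| f(x) >= c sqrt N, whereas
    A_1 f(x) = 0.

    For p > 2 take f = sum_s +-phi_s(y) cos(lam w_s . y), where phi_s is a bump
    adapted to a thin tube of direction w_s. The tubes are pairwise disjoint for
    y_1 >= 1/2, so |f| <= 1, but their prolongations to 0 <= y_1 <= 1/4 form a
    Kakeya set of measure <= 1/n. By stationary phase, A_t f(x) for x in that set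
    is lam^(-1/2) times a function that oscillates in t with frequency lam, with
    complex amplitude sum_s +-c_s(t) psi_s(x) e^(i lam w_s . x), psi_s being the
    profile of the prolonged tube. Evaluating on two partitions of step pi/lam, a
    quarter of a period apart, bounds V_2 f(x)^2 below by the mean square of the
    amplitude. Averaging over the signs, the integral of V_2 f^2 over the Kakeya
    set is bounded below, whatever the measure of that set, and this forces its
    L^p norm to be large when p > 2. *)
Require Import Defs.
From HB Require Import structures.
From mathcomp Require Import all_boot all_order all_algebra.
From mathcomp Require Import all_classical all_reals all_analysis.
From mathcomp Require Import measurable_realfun ring lra.
Set Implicit Arguments. Unset Strict Implicit. Unset Printing Implicit Defensive.
Import Order.TTheory GRing.Theory Num.Theory.
Import numFieldNormedType.Exports.
Local Open Scope classical_set_scope.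
Local Open Scope ring_scope.

(** * Smooth bump functions *)

(** The exponent 2 separates the two examples because 1/|x| misses L^2 of the plane only
    logarithmically: its dyadic pieces have equal L^2 norms, which is the source of N^(-1/2). For p
    > 2 the small scales dominate, so f must be bounded and the gain must come from V_2 f
    concentrating on a small set.

    The slopes of the n^n tubes are written in base n, and each digit pivots the tube about its own
    abscissa in [0, 1/4]. Tubes sharing their leading digits are thereby bunched where the next
    digit pivots. The width is of order n^(-n), so the bumps have derivatives of order n^n and lam
    is chosen after n. The stationary phase errors are added over all tubes without any
    cancellation; this only asks for an error o(lam^(-1/2)), without a rate, but uniform in the
    tube, the point and the radius.

    From the mean square to L^p: points of the Kakeya set where V_2 f <= A account for O((1 +
    A^2)/n) of the integral of V_2 f^2, and elsewhere V_2 f^p >= A^(p-2) V_2 f^2. Hence A is chosen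
    from the desired size, then n from A. *)

Section derivative_rules.
Variable R : realType.
Implicit Types (f g : R -> R) (x a b : R).

Lemma is_derive_add f g x a b : is_derive x 1 f a -> is_derive x 1 g b ->
  is_derive x 1 (fun y => f y + g y) (a + b).
Proof. exact: is_deriveD. Qed.

Lemma is_derive_mul f g x a b : is_derive x 1 f a -> is_derive x 1 g b ->
  is_derive x 1 (fun y => f y * g y) (a * g x + f x * b).
Proof.
move=> fa gb; apply: (is_derive_eq (is_deriveM fa gb)).
by rewrite addrC /GRing.scale/= mulrC.
Qed.

Lemma is_derive_comp f g x a b : is_derive (g x) 1 f a -> is_derive x 1 g b ->
  is_derive x 1 (fun y => f (g y)) (a * b).
Proof. exact: is_derive1_comp. Qed.

Lemma is_derive_inv f x a : f x != 0 -> is_derive x 1 f a ->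
  is_derive x 1 (fun y => (f y)^-1) (- (f x) ^- 2 * a).
Proof.
move=> fx0 [df <-]; apply: DeriveDef; first exact: derivableV.
exact: deriveV.
Qed.

Lemma is_derive_affine (a b x : R) : is_derive x 1 (fun y => a * y + b) a.
Proof.
have := is_derive_add (is_derive_mul (is_derive_cst a x 1) (is_derive_id x 1))
  (is_derive_cst b x 1).
by move/is_derive_eq; apply; rewrite mul0r add0r mulr1 addr0.
Qed.

Lemma is_derive_continuous f x a : is_derive x 1 f a -> {for x, continuous f}.
Proof. by move=> [df _]; exact/differentiable_continuous/derivable1_diffP. Qed.

End derivative_rules.

Section flat_functions.
Variable R : realType.
Implicit Types (q : {poly R}) (x u : R).

Definition flat q x : R := if 0 < x then q.[x^-1] * expR (- x^-1) else 0.

(** Monomial by monomial: u^n <= n! e^u, since u^n / n! is one term of the exponential series. *)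
Lemma horner_expRN_bounded q : exists C : R, forall u, 0 <= u ->
  `|q.[u]| * expR (- u) <= C.
Proof.
elim/poly_ind: q => [|q a _].
  by exists 0 => u _; rewrite horner0 normr0 mul0r.
have mono n : forall u, 0 <= u -> u ^+ n * expR (- u) <= (n`!)%:R.
  move=> u u0; rewrite expRN ler_pdivrMr ?expR_gt0//.
  case: n => [|n].
    by rewrite expr0 fact0 mul1r -[leLHS]addr0 (le_trans _ (expR_ge1Dx u))// lerD2l.
  have h := expR_ge1Dxn n u0.
  have f0 : (0 : R) < (n.+1)`!%:R by rewrite ltr0n fact_gt0.
  by rewrite mulrC -ler_pdivrMr//; apply: le_trans h; rewrite lerDr.
pose p := q * 'X + a%:P.
exists (\sum_(i < size p) `|p`_i| * (i`!)%:R) => u u0.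
rewrite -/p horner_coef (le_trans (ler_wpM2r (expR_ge0 _) (ler_norm_sum _ _ _)))//.
rewrite mulr_suml ler_sum// => i _.
by rewrite normrM (ger0_norm (exprn_ge0 _ u0)) -mulrA ler_wpM2l// mono.
Qed.

(** Multiplying [q] by ['X^2] absorbs the factor x^(-2). A quadratic bound on both sides of 0 is
    what forces the derivative there to be 0. *)
Lemma flat_le_sqr q : exists C : R, forall x, `|flat q x| <= C * x ^+ 2.
Proof.
have [C HC] := horner_expRN_bounded ('X^2 * q).
exists C => x; rewrite /flat; case: ifPn => [x0|_].
  have xi : 0 <= x^-1 by rewrite invr_ge0 ltW.
  have := HC _ xi; rewrite hornerM hornerXn (normrM (_ ^+ 2)) (ger0_norm (exprn_ge0 _ xi)).
  rewrite [X in _ -> X <= _]normrM (ger0_norm (expR_ge0 _)) exprVn -mulrA mulrC.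
  by rewrite ler_pdivrMr// exprn_gt0.
rewrite normr0 mulr_ge0 ?sqr_ge0//.
by apply: le_trans (HC 0 (lexx _)); rewrite mulr_ge0 ?expR_ge0.
Qed.

Lemma is_derive_sqr_bound (g : R -> R) (C : R) :
  (forall x, `|g x| <= C * x ^+ 2) -> is_derive (0 : R) (1 : R) g 0.
Proof.
move=> gC.
have g0 : g 0 = 0 by apply/normr0_eq0/le_anti; rewrite normr_ge0 (le_trans (gC 0))// expr0n/= mulr0.
have C0 : 0 <= C by have := gC 1; rewrite expr1n mulr1; apply: le_trans.
have lim : h^-1 *: ((g \o shift 0) (h *: (1:R)) - g 0) @[h --> 0^'] --> (0 : R).
  apply/cvgrPdist_le => /= e e0; near=> h.
  have h0 : h != 0 by near: h; exact: nbhs_dnbhs_neq.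
  have hn0 : 0 < `|h| by rewrite normr_gt0.
  rewrite g0 subr0 sub0r normrN /= addr0 /GRing.scale /= mulr1 normrM normfV.
  rewrite mulrC ler_pdivrMr// (le_trans (gC h))//.
  rewrite -[h ^+ 2]real_normK ?num_real// expr2 mulrA ler_wpM2r//.
  have : `|h| <= e / (C + 1).
    near: h; apply: dnbhs0_le; rewrite divr_gt0 ?ltr_wpDl//.
  rewrite ler_pdivlMr ?ltr_wpDl// => H.
  apply: le_trans H; rewrite mulrC ler_wpM2l//; lra.
apply: DeriveDef; first by apply/cvg_ex; exists 0.
exact: cvg_lim.
Unshelve. all: by end_near. Qed.

Lemma is_derive_flat q x : is_derive x 1 (flat q) (flat ('X^2 * (q - q^`())) x).
Proof.
have [x0|x0|->] := ltgtP x 0.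
- rewrite {2}/flat ltNge (ltW x0)/=.
  apply: (@near_eq_is_derive _ _ _ (cst 0)).
    near=> y; rewrite /flat ltNge ifF//; apply/negbF/ltW.
    by near: y; exact: lt_nbhsl.
- rewrite {2}/flat x0.
  apply: (@near_eq_is_derive _ _ _ ((fun y => q.[y^-1] * expR (- y^-1)) : R -> R^o)).
    near=> y; rewrite /flat ifT//.
    by near: y; exact: lt_nbhsr.
  have xn0 : x != 0 by rewrite gt_eqF.
  have d1 := is_derive_inv xn0 (is_derive_id x 1).
  have d2 := is_derive_comp (is_derive_poly q x^-1) d1.
  have d3 := is_derive_comp (is_derive_expR _) (is_derive_comp (is_derive_affine (-1) 0 _) d1).
  have := is_derive_mul d2 d3.
  rewrite (_ : (fun y => _) = (fun y => q.[y^-1] * expR (- y^-1))); last first.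
    by apply/funext => y; rewrite addr0 mulN1r.
  move/is_derive_eq; apply.
  have -> : -1 / x + 0 = - x^-1 by rewrite addr0 mulN1r.
  by rewrite hornerM hornerXn hornerD hornerN -exprVn; ring.
- have [C HC] := flat_le_sqr q.
  by rewrite {2}/flat ltxx; apply: is_derive_sqr_bound HC.
Unshelve. all: by end_near. Qed.

Lemma flat_continuous q : continuous (flat q).
Proof. by move=> x; apply: is_derive_continuous (is_derive_flat q x). Qed.

End flat_functions.

Section bump.
Variable R : realType.
Implicit Types (u v x : R).

Local Notation flat1 := (@flat R 1).

Lemma flat1E x : 0 < x -> flat1 x = expR (- x^-1).
Proof. by move=> x0; rewrite /flat x0 hornerC mul1r. Qed.

Lemma flat1_ge0 x : 0 <= flat1 x.
Proof. by rewrite /flat; case: ifP => // _; rewrite hornerC mul1r expR_ge0. Qed.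

Lemma flat1_le1 x : flat1 x <= 1.
Proof.
rewrite /flat; case: ifP => // x0.
by rewrite hornerC mul1r expR_le1 oppr_le0 invr_ge0 ltW.
Qed.

Lemma flat1_ge x : 1 / 4 <= x -> expR (- 4) <= flat1 x.
Proof.
move=> x4; have x0 : 0 < x by apply: lt_le_trans x4; rewrite divr_gt0.
rewrite flat1E// ler_expR lerN2 -[4]invrK lef_pV2 ?posrE ?invr_gt0//.
by rewrite -[4^-1]mul1r.
Qed.

Definition bump u := flat1 (1 - u) * flat1 (1 + u).

(** For |u| <= 3/4 both 1 - u and 1 + u are at least 1/4, so each flat factor of [bump u] is at
    least e^(-4). *)
Definition bump_lb : R := expR (- 4) * expR (- 4).

Lemma bump_lb_gt0 : 0 < bump_lb.
Proof. by rewrite mulr_gt0 ?expR_gt0. Qed.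

Lemma bump_ge0 u : 0 <= bump u.
Proof. by rewrite mulr_ge0 ?flat1_ge0. Qed.

Lemma bump_le1 u : bump u <= 1.
Proof. by rewrite mulr_ile1 ?flat1_ge0 ?flat1_le1. Qed.

Lemma bump_eq0 u : 1 <= `|u| -> bump u = 0.
Proof.
rewrite ler_normr => /orP[u1|u1]; rewrite /bump /flat.
  by rewrite ifF ?mul0r//; apply/negbTE; rewrite -leNgt; lra.
by rewrite [X in _ * X]ifF ?mulr0//; apply/negbTE; rewrite -leNgt; lra.
Qed.

Lemma bump_ge u : `|u| <= 3 / 4 -> bump_lb <= bump u.
Proof.
by rewrite ler_norml => /andP[u1 u2]; rewrite ler_pM ?expR_ge0 ?flat1_ge//; lra.
Qed.

Definition dbump u :=
  - flat ('X^2 * (1 - 1^`())) (1 - u) * flat1 (1 + u)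
  + flat1 (1 - u) * flat ('X^2 * (1 - 1^`())) (1 + u).

Lemma is_derive_bump u : is_derive u 1 bump (dbump u).
Proof.
have E1 : (fun v => 1 - v) = (fun v : R => -1 * v + 1).
  by apply/funext => v; rewrite mulN1r addrC.
have E2 : (fun v => 1 + v) = (fun v : R => 1 * v + 1).
  by apply/funext => v; rewrite mul1r addrC.
have d1 : is_derive u 1 (fun v => flat1 (1 - v)) (flat ('X^2 * (1 - 1^`())) (1 - u) * -1).
  apply: is_derive_comp (is_derive_flat _ _) _.
  by move: (is_derive_affine (-1) 1 u); rewrite -E1.
have d2 : is_derive u 1 (fun v => flat1 (1 + v)) (flat ('X^2 * (1 - 1^`())) (1 + u) * 1).
  apply: is_derive_comp (is_derive_flat _ _) _.
  by move: (is_derive_affine 1 1 u); rewrite -E2.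
have := is_derive_mul d1 d2; move/is_derive_eq; apply.
by rewrite /dbump mulrN1 mulr1.
Qed.

Lemma bump_continuous : continuous bump.
Proof. by move=> x; apply: is_derive_continuous (is_derive_bump x). Qed.

Lemma dbump_continuous : continuous dbump.
Proof.
have c1 : continuous (fun v : R => 1 - v).
  by move=> v; apply: cvgB; [exact: cvg_cst|exact: cvg_id].
have c2 : continuous (fun v : R => 1 + v).
  by move=> v; apply: cvgD; [exact: cvg_cst|exact: cvg_id].
move=> u; apply: cvgD; apply: cvgM.
- apply: cvgN.
  exact: (@continuous_comp _ _ _ (fun v => 1 - v) (flat _) u (c1 u) (@flat_continuous _ _ _)).
- exact: (@continuous_comp _ _ _ (fun v => 1 + v) (flat _) u (c2 u) (@flat_continuous _ _ _)).
- exact: (@continuous_comp _ _ _ (fun v => 1 - v) (flat _) u (c1 u) (@flat_continuous _ _ _)).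
- exact: (@continuous_comp _ _ _ (fun v => 1 + v) (flat _) u (c2 u) (@flat_continuous _ _ _)).
Qed.

Lemma dbump_bounded : exists2 C : R, 0 <= C & forall u, `|dbump u| <= C.
Proof.
have out u : 1 <= `|u| -> dbump u = 0.
  rewrite ler_normr => /orP[u1|u1]; rewrite /dbump /flat.
    have -> : (0 < 1 - u) = false by apply/negbTE; rewrite -leNgt; lra.
    by rewrite oppr0 !mul0r addr0.
  have -> : (0 < 1 + u) = false by apply/negbTE; rewrite -leNgt; lra.
  by rewrite !mulr0 addr0.
have [c _ Hc] : exists2 c : R, c \in `[(-1 : R), 1]%R &
    forall t, t \in `[(-1 : R), 1]%R -> `|dbump t| <= `|dbump c|.
  apply: (@EVT_max _ (fun t => `|dbump t|)); first by lra.
  apply: continuous_subspaceT => t.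
  by apply: cvg_norm; exact: dbump_continuous.
exists `|dbump c| => // u; case: (leP 1 `|u|) => [/out->|]; first by rewrite normr0.
by rewrite ltr_norml => /andP[u1 u2]; apply: Hc; rewrite in_itv/= !ltW.
Qed.

End bump.

Section lipschitz.
Variable R : realType.

Lemma le_normr_derive (f df : R -> R) (C : R) (a b : R) : a <= b ->
  (forall x, x \in `[a, b]%R -> is_derive x 1 f (df x)) ->
  (forall x, x \in `[a, b]%R -> `|df x| <= C) ->
  `|f b - f a| <= C * (b - a).
Proof.
move=> ab fdf dfC.
have d x : x \in `]a, b[%R -> is_derive x 1 f (df x).
  by move=> xab; apply: fdf; apply: subset_itv_oo_cc xab.
have c : {within `[a, b], continuous f}.
  by apply: derivable_within_continuous => x xab; have [] := fdf x xab.
have [t tab E] := MVT_segment ab d c.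
by rewrite E normrM (@ger0_norm _ (b - a)) ?subr_ge0// ler_wpM2r ?subr_ge0// dfC.
Qed.

Lemma bump_lipschitz : exists2 C : R, 0 <= C & forall u v : R,
  `|bump u - bump v| <= C * `|u - v|.
Proof.
have [C C0 HC] := dbump_bounded R; exists C => // u v.
wlog uv : u v / v <= u.
  by move=> H; case: (leP v u) => [/H//|/ltW/H]; rewrite (distrC u) (distrC (bump u)).
rewrite (@ger0_norm _ (u - v)) ?subr_ge0//.
by apply: (@le_normr_derive _ (@dbump R)) => // x _; exact: is_derive_bump.
Qed.

End lipschitz.

(** * Smooth functions of two variables *)

Section smooth_functions.
Variable R : realType.

(* Smoothness without reference to the order of differentiation: [g] lies in a
   class of differentiable functions that is stable under differentiation. *)
Definition smooth1 (g : R -> R) := exists2 P : set (R -> R), P g &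
  forall h, P h -> (forall x, derivable h x 1) /\ P (derive1 h).

Lemma smooth1_derivable g : smooth1 g -> forall x, derivable g x 1.
Proof. by case=> P Pg HP; have [] := HP g Pg. Qed.

Lemma smooth1_is_derive g : smooth1 g -> forall x : R, is_derive x 1 g (derive1 g x).
Proof.
move=> sg x; apply: DeriveDef; first exact: smooth1_derivable.
by rewrite derive1E.
Qed.

Lemma smooth1_derive1 g : smooth1 g -> smooth1 (derive1 g).
Proof. by case=> P Pg HP; exists P => //; have [] := HP g Pg. Qed.

Lemma smooth1_continuous g : smooth1 g -> continuous g.
Proof.
move=> sg x; apply/differentiable_continuous/derivable1_diffP.
exact: smooth1_derivable.
Qed.

Lemma smooth1_flat q : smooth1 (@flat R q).
Proof.
exists [set h | exists q, h = @flat R q]; first by exists q.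
move=> _ [{}q ->]; split=> [x|]; first by have [] := is_derive_flat q x.
exists ('X^2 * (q - q^`())); apply/funext => x.
by rewrite derive1E; have [_ ->] := is_derive_flat q x.
Qed.

Lemma smooth1_cos : smooth1 (@cos R).
Proof.
exists [set h | exists a b, h = (fun x => a * cos x + b * sin x)].
  by exists 1, 0; apply/funext => x; rewrite mul1r mul0r addr0.
move=> _ [a [b ->]].
have D (x : R) : is_derive x 1 (fun x : R => a * cos x + b * sin x) (b * cos x + - a * sin x).
  have := is_derive_add
    (is_derive_mul (is_derive_cst a x 1) (is_derive_cos x))
    (is_derive_mul (is_derive_cst b x 1) (is_derive_sin x)).
  by move/is_derive_eq; apply; rewrite /cst; ring.
split=> [x|]; first by have [] := D x.
by exists b, (- a); apply/funext => x; rewrite derive1E; have [_ ->] := D x.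
Qed.

Lemma smooth1_cst (c : R) : smooth1 (fun=> c).
Proof.
exists [set h | exists c, h = fun=> c]; first by exists c.
move=> _ [{}c ->]; split=> [x|]; first exact: derivable_cst.
by exists 0; apply/funext => x; rewrite derive1_cst.
Qed.

(** A syntactic class: polynomial expressions in smooth functions of affine forms. It contains every
    function used below, and its closure under partial derivatives, its local bounds, its
    measurability and its continuity along curves are each one induction. *)
Inductive smooth2 : (R * R -> R) -> Prop :=
| smooth2_affine g a b c : smooth1 g ->
    smooth2 (fun x => g (a * x.1 + b * x.2 + c))
| smooth2_add f g : smooth2 f -> smooth2 g -> smooth2 (fun x => f x + g x)
| smooth2_mul f g : smooth2 f -> smooth2 g -> smooth2 (fun x => f x * g x).

Lemma smooth2_cst c : smooth2 (fun=> c).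
Proof. exact: (@smooth2_affine (fun=> c) 0 0 0 (smooth1_cst c)). Qed.

Lemma smooth2_sum (I : Type) (r : seq I) (f : I -> R * R -> R) :
  (forall i, smooth2 (f i)) -> smooth2 (fun x => \sum_(i <- r) f i x).
Proof.
move=> sf; elim: r => [|i r IH].
  by under eq_fun do rewrite big_nil; exact: smooth2_cst.
by under eq_fun do rewrite big_cons; exact: smooth2_add.
Qed.

Lemma smooth2_bump a b c : smooth2 (fun x => bump (a * x.1 + b * x.2 + c)).
Proof.
rewrite /bump.
have -> : (fun x : R * R => flat 1 (1 - (a * x.1 + b * x.2 + c)) *
    flat 1 (1 + (a * x.1 + b * x.2 + c))) =
  (fun x => flat 1 (- a * x.1 + - b * x.2 + (1 - c)) *
    flat 1 (a * x.1 + b * x.2 + (1 + c))).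
  by apply/funext => x; congr (flat _ _ * flat _ _); ring.
by apply: smooth2_mul; apply: smooth2_affine; exact: smooth1_flat.
Qed.

Lemma smooth2_pderivable f : smooth2 f -> forall b x, pderivable b f x.
Proof.
elim=> [g a b c sg|{}f g _ df _ dg|{}f g _ df _ dg] [] x; rewrite /pderivable.
- have D := is_derive_comp (smooth1_is_derive sg _)
    (is_derive_affine a (b * x.2 + c) x.1).
  by under eq_fun do rewrite -addrA; case: D.
- have D := is_derive_comp (smooth1_is_derive sg _)
    (is_derive_affine b (a * x.1 + c) x.2).
  by under eq_fun do rewrite (addrC (a * _)) -addrA; case: D.
- exact: derivableD (df true x) (dg true x).
- exact: derivableD (df false x) (dg false x).
- exact: derivableM (df true x) (dg true x).
- exact: derivableM (df false x) (dg false x).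
Qed.

Lemma smooth2_pderiv f : smooth2 f -> forall b, smooth2 (pderiv b f).
Proof.
elim=> [g a b c sg|{}f g sf df sg dg|{}f g sf df sg dg] i.
- have -> : pderiv i (fun x => g (a * x.1 + b * x.2 + c)) =
    (fun x => derive1 g (a * x.1 + b * x.2 + c) * (if i then a else b)).
    apply/funext => x; case: i; rewrite /pderiv !derive1E.
      have D := is_derive_comp (smooth1_is_derive sg _)
        (is_derive_affine a (b * x.2 + c) x.1).
      under eq_fun do rewrite -addrA.
      by rewrite -addrA -(derive1E g); have [_] := D.
    have D := is_derive_comp (smooth1_is_derive sg _)
      (is_derive_affine b (a * x.1 + c) x.2).
    under eq_fun do rewrite (addrC (a * _)) -addrA.
    by rewrite (addrC (a * _)) -addrA -(derive1E g); have [_] := D.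
  apply: smooth2_mul; last exact: smooth2_cst.
  by apply: smooth2_affine; exact: smooth1_derive1.
- have -> : pderiv i (fun x => f x + g x) = (fun x => pderiv i f x + pderiv i g x).
    apply/funext => x; have := smooth2_pderivable sf i x.
    have := smooth2_pderivable sg i x.
    by case: i; rewrite /pderivable /pderiv !derive1E => dg' df';
      exact: (deriveD df' dg').
  exact: smooth2_add.
- have -> : pderiv i (fun x => f x * g x) =
    (fun x => f x * pderiv i g x + g x * pderiv i f x).
    apply/funext => x; have := smooth2_pderivable sf i x.
    have := smooth2_pderivable sg i x.
    by case: i; case: x => x1 x2; rewrite /pderivable /pderiv !derive1E /= => dg' df';
      rewrite (deriveM df' dg').
  by apply: smooth2_add; apply: smooth2_mul.
Qed.

Lemma smooth2_iter_pderiv f ds : smooth2 f -> smooth2 (iter_pderiv ds f).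
Proof. by move=> sf; elim: ds => //= b ds; move/smooth2_pderiv; exact. Qed.

Lemma smooth2_locally_bounded f (M : R) : smooth2 f -> exists2 C : R, 0 <= C &
  forall x, `|x.1| <= M -> `|x.2| <= M -> `|f x| <= C.
Proof.
elim=> [g a b c sg|{}f g _ [C C0 HC] _ [D D0 HD]|{}f g _ [C C0 HC] _ [D D0 HD]].
- pose K := `|a| * `|M| + `|b| * `|M| + `|c|.
  have K0 : 0 <= K by rewrite !addr_ge0 ?mulr_ge0.
  have [t _ Ht] : exists2 t : R, t \in `[- K, K]%R &
      forall s, s \in `[- K, K]%R -> `|g s| <= `|g t|.
    apply: (@EVT_max _ (fun t => `|g t|)); first by lra.
    apply: continuous_subspaceT => t.
    by apply: cvg_norm; exact: smooth1_continuous.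
  exists `|g t| => // x x1 x2; apply: Ht.
  rewrite in_itv/= -ler_norml (le_trans (ler_normD _ _))// lerD2r.
  rewrite (le_trans (ler_normD _ _))// !normrM lerD// ler_wpM2l//.
    by rewrite (le_trans x1)// ler_norm.
  by rewrite (le_trans x2)// ler_norm.
- exists (C + D) => [|x x1 x2]; first exact: addr_ge0.
  by rewrite (le_trans (ler_normD _ _))// lerD ?HC ?HD.
- exists (C * D) => [|x x1 x2]; first exact: mulr_ge0.
  by rewrite normrM ler_pM ?HC ?HD.
Qed.

Lemma smooth2_continuous_comp f (u v : R -> R) : smooth2 f ->
  continuous u -> continuous v -> continuous (fun t => f (u t, v t)).
Proof.
move=> sf cu cv; elim: sf => [g a b c sg|{}f g _ cf _ cg|{}f g _ cf _ cg] t.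
- have cl : {for t, continuous (fun t => a * u t + b * v t + c)}.
    apply: cvgD; last exact: cvg_cst.
    by apply: cvgD; apply: cvgM; [exact: cvg_cst|exact: cu|exact: cvg_cst|exact: cv].
  apply: (@continuous_comp R R R (fun t => a * u t + b * v t + c) g t cl).
  exact: smooth1_continuous.
- by apply: cvgD; [exact: cf|exact: cg].
- by apply: cvgM; [exact: cf|exact: cg].
Qed.

Lemma smooth2_measurable f : smooth2 f -> measurable_fun setT f.
Proof.
elim=> [g a b c sg|{}f g _ cf _ cg|{}f g _ cf _ cg].
- apply: (@measurableT_comp _ _ _ _ _ _ g).
    by apply: measurable_realfun.continuous_measurable_fun; exact: smooth1_continuous.
  apply: measurable_funD => //; apply: measurable_funD; exact: measurable_funM.
- exact: measurable_funD.
- exact: measurable_funM.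
Qed.

(** The strict inequality defines an open set, so the function vanishes in a neighbourhood of each
    such point and its partial derivatives vanish there too. *)
Lemma pderiv_supp b f (M : R) : (forall x, M < `|x.1| \/ M < `|x.2| -> f x = 0) ->
  forall x, M < `|x.1| \/ M < `|x.2| -> pderiv b f x = 0.
Proof.
move=> f0 x Mx; rewrite /pderiv.
have near_gt (z : R) : M < `|z| -> \near z, M < `|z|.
  move=> Mz; have /(_ z) := @norm_continuous _ R.
  by move/cvgr_gt => /(_ M Mz).
have D0 (g : R -> R) (z : R) : (\near z, g z = 0) -> derive1 g z = 0.
  move=> gz; rewrite derive1E.
  suff : is_derive z 1 g 0 by case.
  apply: (@near_eq_is_derive _ _ _ (cst 0 : R -> R^o)).
  by near do apply/esym.
have near_or (z w : R) (g : R -> R) : M < `|z| \/ M < `|w| ->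
    (forall y, M < `|y| \/ M < `|w| -> g y = 0) -> derive1 g z = 0.
  move=> zw g0; apply: D0; case: zw => [Mz|Mw]; near=> y; apply: g0.
    by left; near: y; exact: near_gt.
  by right.
case: b; [apply: (near_or _ x.2)|apply: (near_or _ x.1)] => //.
- by move=> y Hy; apply: f0.
- by case: Mx; [right|left].
- by move=> y Hy; apply: f0 => /=; case: Hy; [right|left].
Unshelve. all: by end_near. Qed.

Lemma smooth2_schwartz f (M : R) : smooth2 f ->
  (forall x, M < `|x.1| \/ M < `|x.2| -> f x = 0) -> schwartz f.
Proof.
move=> sf f0 ds; split=> [b x|N].
  by apply: smooth2_pderivable; exact: smooth2_iter_pderiv.
have supp : forall x, M < `|x.1| \/ M < `|x.2| -> iter_pderiv ds f x = 0.
  by elim: ds => //= b ds IH; exact: pderiv_supp.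
have [C C0 HC] := smooth2_locally_bounded M (smooth2_iter_pderiv ds sf).
have B0 (z : R * R) : 0 <= 1 + enorm2 z by rewrite addr_ge0// sqrtr_ge0.
exists ((1 + Num.sqrt (M ^+ 2 + M ^+ 2)) ^+ N * C) => x.
have [x1|x1] := ltP M `|x.1|.
  by rewrite supp ?normr0 ?mulr0; [rewrite mulr_ge0// exprn_ge0// addr_ge0// sqrtr_ge0|left].
have [x2|x2] := ltP M `|x.2|.
  by rewrite supp ?normr0 ?mulr0; [rewrite mulr_ge0// exprn_ge0// addr_ge0// sqrtr_ge0|right].
have sqM (z : R) : `|z| <= M -> z ^+ 2 <= M ^+ 2.
  by move=> zM; rewrite -[z ^+ 2]real_normK ?num_real// lerXn2r ?nnegrE// (le_trans _ zM).
rewrite ler_pM ?HC ?exprn_ge0// lerXn2r ?nnegrE ?addr_ge0 ?sqrtr_ge0//.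
by rewrite lerD2l ler_wsqrtr// lerD// sqM.
Qed.

End smooth_functions.

(** * Reduction to lower bounds of the variation *)

Section planar_measure.
Variable R : realType.
Implicit Types a b s c r : R.
Local Notation leb := (@lebesgue_measure R).
Local Notation leb2 := (@leb2 R).

Definition strip (a b s c r : R) : set (R * R) :=
  [set z | a <= z.1 <= b /\ `|z.2 - (s * z.1 + c)| <= r].

Lemma measurable_strip a b s c r : measurable (strip a b s c r).
Proof.
have -> : strip a b s c r = (setT `&` fst @^-1` `[a, b]) `&`
    (setT `&` (fun z : R * R => z.2 - (s * z.1 + c)) @^-1` `[- r, r]).
  by rewrite !setTI; apply/seteqP; split=> z;
    rewrite /strip /= !in_itv/= ler_norml.
apply: measurableI; first by apply: measurable_fst => //; exact: measurable_itv.
suff m : measurable_fun setT (fun z : R * R => z.2 - (s * z.1 + c)).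
  by apply: m => //; exact: measurable_itv.
apply: measurable_funB => //; apply: measurable_funD => //.
exact: measurable_funM.
Qed.

(** A shear does not change areas: every vertical section is an interval of length 2 r, whatever the
    slope. *)
Lemma measure_strip a b s c r : a <= b -> 0 <= r ->
  leb2 (strip a b s c r) = ((b - a) * (2 * r))%:E.
Proof.
move=> ab r0; rewrite /Defs.leb2 /product_measure1/=.
have xs x : leb (xsection (strip a b s c r) x) =
    ((2 * r)%:E * (\1_(`[a, b]%classic : set R) x)%:E)%E.
  rewrite indicE; have [|] := boolP (x \in _); rewrite ?inE ?notin_setE /= in_itv/= => xab.
    have -> : xsection (strip a b s c r) x = `[s * x + c - r, s * x + c + r]%classic.
      apply/seteqP; split=> y; rewrite /xsection /= inE /strip/= in_itv/= ler_norml.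
        by move=> [_ /andP[h1 h2]]; apply/andP; split; lra.
      by move=> /andP[h1 h2]; split=> //; apply/andP; split; lra.
    rewrite lebesgue_measure_itv/= lte_fin mule1.
    case: ltP => h; first by rewrite -EFinB; congr (_%:E); ring.
    by congr (_%:E); lra.
  have -> : xsection (strip a b s c r) x = set0.
    by apply/seteqP; split=> y//; rewrite /xsection/= inE /strip/= => -[].
  by rewrite measure0 mule0.
under eq_integral do rewrite /= xs.
rewrite ge0_integralZl_EFin//; last 2 first.
- by apply/measurable_EFinP; exact: measurable_indic.
- by rewrite mulr_ge0.
rewrite integral_indic// setIT.
rewrite [X in (_ * X)%E](_ : _ = if a < b then (b - a)%:E else 0%E); last first.
  by apply: (etrans (lebesgue_measure_itv `[a, b])); rewrite /= lte_fin.
case: ltP => h; first by rewrite -EFinM; congr (_%:E); ring.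
have -> : b = a by apply/le_anti; rewrite h ab.
by rewrite mule0 subrr mul0r.
Qed.
End planar_measure.

Section criterion.
Variable R : realType.
Local Notation leb2 := (@leb2 R).

(* No measurability is needed: the integral of a nonnegative function is the
   supremum over the simple functions below it. *)
Lemma ge0_le_lower_integral d (T : measurableType d)
    (mu : {measure set T -> \bar R}) (f g : T -> \bar R) :
  (forall x, (0 <= f x)%E) -> (forall x, (f x <= g x)%E) ->
  (\int[mu]_x f x <= \int[mu]_x g x)%E.
Proof.
move=> f0 fg; rewrite !ge0_integralTE//; last first.
  by move=> x; apply: le_trans (fg x).
apply: ereal_sup_le => _ [h hf <-].
by exists h => // x; apply: le_trans (fg x); exact: hf.
Qed.

Lemma circ_avgZ (k t : R) (f : R * R -> R) x : smooth2 f ->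
  circ_avg t (fun z => k * f z) x = k * circ_avg t f x.
Proof.
move=> sf; rewrite /circ_avg mulrCA; congr (_ * _).
apply: RintegralZl => //; apply: continuous_compact_integrable.
  exact: segment_compact.
apply: continuous_subspaceT; apply: (smooth2_continuous_comp sf) => a.
  apply: cvgB; first exact: cvg_cst.
  by apply: cvgM; [exact: cvg_cst|exact: continuous_cos].
apply: cvgB; first exact: cvg_cst.
by apply: cvgM; [exact: cvg_cst|exact: continuous_sin].
Qed.

Lemma V2I_scale (k : R) (f : R * R -> R) x (h : R) : 0 < k -> smooth2 f ->
  (h%:E <= V2I f x)%E -> ((k * h)%:E <= V2I (fun z => (k * f z)%R) x)%E.
Proof.
move=> k0 sf hV; rewrite EFinM -lee_pdivlMl// (le_trans hV)//.
apply: ub_ereal_sup => _ [s [ss s12 ->]].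
rewrite lee_pdivlMl// -EFinM; apply: ereal_sup_ubound.
exists s; split=> //; congr (_%:E).
under [in RHS]eq_bigr do rewrite !circ_avgZ// -mulrBr exprMn.
by rewrite -mulr_sumr sqrtrM ?sqr_ge0// sqrtr_sqr gtr0_norm.
Qed.

(** Common criterion for both ranges of p: the variation enters only through a measurable minorant
    [H] whose p-th power has a large integral, so the supremum that defines [V2I] is never
    integrated itself. *)
Lemma Lnorm_V2I_unbounded (p C M : R) : 1 <= p -> 0 <= C ->
  (forall K : R, 0 < K -> exists f H : R * R -> R,
    [/\ smooth2 f, (forall x, M < `|x.1| \/ M < `|x.2| -> f x = 0),
      (\int[leb2]_x (`|f x| `^ p)%:E <= C%:E)%E &
      [/\ measurable_fun setT H, (forall x, 0 <= H x),
        (forall x, (H x)%:E <= V2I f x)%E &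
        (K%:E <= \int[leb2]_x (H x `^ p)%:E)%E]]) ->
  ereal_sup [set Lnorm leb2 p%:E (V2I f) | f in
     [set f : R * R -> R | schwartz f /\ (Lnorm leb2 p%:E (EFin \o f) <= 1)%E]]
  = +oo%E.
Proof.
move=> p1 C0 HK; apply/eqyP => A A0.
have p0 : 0 < p by lra.
(* This factor brings the norm below 1 for every p >= 1 at once, because k^p <= k and k C <= 1. *)
pose k := (1 + C)^-1.
have k0 : 0 < k by rewrite invr_gt0; lra.
have kC : k * C <= 1 by rewrite mulrC ler_pdivrMr; lra.
have k1 : k <= 1 by rewrite invf_le1; lra.
have kp0 : 0 < k `^ p by exact: powR_gt0.
(* The size asked for compensates the factor k, so that the rescaled function has variation of norm
   at least A. *)
have [f [H [sf f0 fC [mH H0 HV HK']]]] := HK ((A / k) `^ p) (powR_gt0 _ (divr_gt0 A0 k0)).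
pose g z := k * f z.
have sg : smooth2 g by apply: smooth2_mul => //; exact: smooth2_cst.
apply: (@le_trans _ _ (Lnorm leb2 p%:E (V2I g))); last first.
  apply: ereal_sup_ubound; exists g => //; split.
    by apply: (smooth2_schwartz (M := M)) => // x /f0; rewrite /g => ->; rewrite mulr0.
  rewrite unlock /=.
  have -> : (fun x => `|(EFin \o g) x| `^ p)%E =
      (fun x => (k `^ p)%:E * (`|f x| `^ p)%:E)%E.
    apply/funext => x; rewrite /= /g normrM (gtr0_norm k0).
    by rewrite powRM// ltW.
  rewrite ge0_integralZl_EFin//; last 2 first.
  - apply/measurable_EFinP; apply: (measurableT_comp (measurable_powR p)).
    by apply: measurableT_comp => //; exact: smooth2_measurable.
  - exact: ltW.
  rewrite -[leRHS](poweR1r p^-1); apply: gt0_ler_poweR.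
  - by rewrite invr_ge0 ltW.
  - rewrite in_itv/= leey andbT; apply: mule_ge0; first by rewrite lee_fin powR_ge0.
    by apply: integral_ge0 => x _; rewrite lee_fin powR_ge0.
  - by rewrite in_itv/= leey andbT.
  apply: (@le_trans _ _ ((k `^ p)%:E * C%:E)%E).
    by rewrite lee_pmul2l// lte_fin.
  rewrite -EFinM lee_fin (le_trans _ kC)// ler_wpM2r//.
  by apply: ge1r_powR => //; rewrite k0.
rewrite unlock /=.
have -> : A%:E = (((k `^ p)%:E * ((A / k) `^ p)%:E) `^ p^-1)%E.
  rewrite -EFinM -powRM ?(ltW k0) ?divr_ge0 ?(ltW A0) ?(ltW k0)//.
  rewrite poweR_EFin -powRrM divff ?gt_eqF// powRr1; last first.
    by rewrite mulr_ge0 ?divr_ge0 ?ltW.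
  by rewrite mulrC divfK// gt_eqF.
apply: gt0_ler_poweR.
- by rewrite invr_ge0 ltW.
- by rewrite in_itv/= leey andbT -EFinM lee_fin mulr_ge0 ?powR_ge0.
- rewrite in_itv/= leey andbT; apply: integral_ge0 => x _; exact: poweR_ge0.
apply: (@le_trans _ _ (\int[leb2]_x ((k `^ p)%:E * (H x `^ p)%:E))%E).
  rewrite ge0_integralZl_EFin//; last 3 first.
  - by move=> x _; rewrite lee_fin powR_ge0.
  - by apply/measurable_EFinP; exact: (measurableT_comp (measurable_powR p)).
  - exact: ltW.
  by rewrite lee_pmul2l// lte_fin.
apply: ge0_le_lower_integral => x.
  by rewrite -EFinM lee_fin mulr_ge0 ?powR_ge0.
rewrite -EFinM -powRM ?(ltW k0)// -poweR_EFin.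
have kHx := V2I_scale k0 sf (HV x).
have kH0 : (0 <= (k * H x)%:E)%E by rewrite lee_fin mulr_ge0// ltW.
have V0 : (0 <= V2I g x)%E by exact: le_trans kHx.
apply: gt0_ler_poweR; first exact: ltW.
- by rewrite in_itv/= leey andbT.
- by rewrite in_itv/= leey andbT abse_ge0.
- by rewrite gee0_abs.
Qed.
End criterion.

(** * Exponents at most 2 *)

Section circular_averages.
Variable R : realType.
Local Notation mu := (@lebesgue_measure R).

Lemma continuous_integrable_itv (g : R -> R) (a b : R) : continuous g ->
  mu.-integrable `[a, b] (EFin \o g).
Proof.
move=> cg; apply: continuous_compact_integrable; first exact: segment_compact.
exact: continuous_subspaceT.
Qed.

Lemma continuous_circle (f : R * R -> R) (t : R) (x : R * R) : smooth2 f ->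
  continuous (fun a => f (x.1 - t * cos a, x.2 - t * sin a)).
Proof.
move=> sf; apply: (smooth2_continuous_comp sf) => a.
  apply: cvgB; first exact: cvg_cst.
  by apply: cvgM; [exact: cvg_cst|exact: continuous_cos].
apply: cvgB; first exact: cvg_cst.
by apply: cvgM; [exact: cvg_cst|exact: continuous_sin].
Qed.

Lemma circ_avg_sum (I : Type) (r : seq I) (f : I -> R * R -> R) (t : R) x :
  (forall i, smooth2 (f i)) ->
  circ_avg t (fun z => \sum_(i <- r) f i z) x = \sum_(i <- r) circ_avg t (f i) x.
Proof.
move=> sf; elim: r => [|i r IH].
  rewrite big_nil /circ_avg (_ : Rintegral _ _ _ = 0) ?mulr0//.
  under eq_Rintegral do rewrite big_nil.
  by rewrite Rintegral_cst// mul0r.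
rewrite big_cons -IH /circ_avg -mulrDr; congr (_ * _).
under eq_Rintegral do rewrite big_cons.
apply: RintegralD => //; apply: continuous_integrable_itv.
  exact: continuous_circle.
by apply: (continuous_circle (f := fun z => \sum_(i <- r) f i z)); exact: smooth2_sum.
Qed.

Lemma Rintegral_ge_rect (g : R -> R) (a b c d m : R) : continuous g ->
  (forall t, 0 <= g t) -> a <= c -> c <= d -> d <= b ->
  (forall t, c <= t <= d -> m <= g t) ->
  m * (d - c) <= Rintegral mu `[a, b] g.
Proof.
move=> cg g0 ac cd db mg.
apply: (@le_trans _ _ (Rintegral mu `[c, d] g)).
  apply: (@le_trans _ _ (Rintegral mu `[c, d] (fun=> m))).
    rewrite Rintegral_cst//= lebesgue_measure_itv/= lte_fin.
    case: ltP => [h|h]; first by rewrite -EFinB.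
    have -> : d = c by apply/le_anti; rewrite h.
    by rewrite subrr.
  apply: le_Rintegral => //.
  - by apply: continuous_integrable_itv => t; exact: cvg_cst.
  - exact: continuous_integrable_itv.
have fin (u v : R) : (\int[mu]_(x in `[u, v]) (g x)%:E)%E \is a fin_num.
  by apply: integrable_fin_num => //; exact: continuous_integrable_itv.
rewrite /Rintegral fine_le ?fin//; apply: ge0_subset_integral => //.
- apply/measurable_EFinP.
  apply: (measurable_funS (E := setT)) => //.
  exact: measurable_realfun.continuous_measurable_fun.
- by move=> t _; rewrite lee_fin.
- move=> t /=; rewrite !in_itv/= => /andP[h1 h2]; apply/andP; split; lra.
Qed.

Lemma V2I_ge_diff (f : R * R -> R) (x : R * R) (s t : R) : 1 <= s -> s < t -> t <= 2 ->
  (`|circ_avg t f x - circ_avg s f x|%:E <= V2I f x)%E.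
Proof.
move=> s1 st t2; apply: ereal_sup_ubound; exists [:: s; t]; split.
- by rewrite /= st.
- by rewrite /= s1 t2 (le_trans (ltW st))// (le_trans s1)// ltW.
- by rewrite /= big_ord_recl big_ord0 addr0 /= sqrtr_sqr.
Qed.

Lemma lipschitz_cos (a b : R) : `|cos a - cos b| <= `|a - b|.
Proof.
wlog ab : a b / b <= a.
  by move=> H; case: (leP b a) => [/H//|/ltW/H]; rewrite (distrC a) (distrC (cos a)).
rewrite (@ger0_norm _ (a - b)) ?subr_ge0// -[leRHS]mul1r.
apply: (@le_normr_derive _ _ (fun x => - sin x)) => // x _.
by rewrite normrN sin_max.
Qed.

Lemma lipschitz_sin (a b : R) : `|sin a - sin b| <= `|a - b|.
Proof.
wlog ab : a b / b <= a.
  by move=> H; case: (leP b a) => [/H//|/ltW/H]; rewrite (distrC a) (distrC (sin a)).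
rewrite (@ger0_norm _ (a - b)) ?subr_ge0// -[leRHS]mul1r.
apply: (@le_normr_derive _ _ (@cos R)) => // x _; exact: cos_max.
Qed.

Lemma integral_sum_indic (I : Type) (r : seq I) (c m : I -> R) (A : I -> set (R * R)) :
  (forall i, 0 <= c i) -> (forall i, measurable (A i)) ->
  (forall i, leb2 (A i) = (m i)%:E) ->
  (\int[@leb2 R]_x (\sum_(i <- r) c i * \1_(A i) x)%:E =
   (\sum_(i <- r) c i * m i)%:E)%E.
Proof.
move=> c0 mA Am.
have mi j : measurable_fun setT (fun x => c j * \1_(A j) x : R).
  by apply: measurable_funM => //; exact: measurable_indic.
have ci j x : 0 <= c j * \1_(A j) x by rewrite mulr_ge0// indicE ler0n.
elim: r => [|i r IH].
  by under eq_integral do rewrite big_nil; rewrite integral0 big_nil.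
under eq_integral do rewrite big_cons EFinD.
rewrite ge0_integralD//; first last.
- by apply/measurable_EFinP; apply: measurable_sum => j; exact: mi.
- by move=> x _; rewrite lee_fin sumr_ge0.
- by apply/measurable_EFinP; exact: mi.
- by move=> x _; rewrite lee_fin.
rewrite IH big_cons EFinD; congr (_ + _)%E.
under eq_integral do rewrite EFinM.
rewrite ge0_integralZl_EFin//.
- rewrite integral_indic; [|exact: measurableT|exact: mA].
  by rewrite EFinM -Am setIT.
- by apply/measurable_EFinP; exact: (measurable_indic (mA i)).
Qed.

End circular_averages.

Section small_exponents.
Variable R : realType.
Implicit Types (x z : R * R).

(** The factor 4 keeps all supports in |z_i| < 1/4. The zero coefficients put the arguments in the
    affine shape of [smooth2_bump]. *)
Definition pole_sum (N : nat) : R * R -> R := fun z =>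
  \sum_(k <- iota 0 N) (2 ^+ k / Num.sqrt N%:R) *
    (bump (4 * 2 ^+ k * z.1 + 0 * z.2 + 0) * bump (0 * z.1 + 4 * 2 ^+ k * z.2 + 0)).

Lemma smooth2_pole_term (k : nat) :
  smooth2 (fun z => bump (4 * 2 ^+ k * z.1 + 0 * z.2 + 0) *
                    bump (0 * z.1 + 4 * 2 ^+ k * z.2 + 0 : R)).
Proof. by apply: smooth2_mul; exact: smooth2_bump. Qed.

Lemma smooth2_pole_sum N : smooth2 (pole_sum N).
Proof.
apply: smooth2_sum => k; apply: smooth2_mul; first exact: smooth2_cst.
exact: smooth2_pole_term.
Qed.

Lemma pole_sum_ge0 N z : 0 <= pole_sum N z.
Proof.
apply: sumr_ge0 => k _; apply: mulr_ge0; last by rewrite mulr_ge0 ?bump_ge0.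
by rewrite divr_ge0 ?sqrtr_ge0 ?exprn_ge0.
Qed.

Lemma pole_term_eq0 (k : nat) z : 1 / 4 <= `|z.1| \/ 1 / 4 <= `|z.2| ->
  bump (4 * 2 ^+ k * z.1 + 0 * z.2 + 0) * bump (0 * z.1 + 4 * 2 ^+ k * z.2 + 0) = 0 :> R.
Proof.
have h (u : R) : 1 / 4 <= `|u| -> 1 <= `|4 * 2 ^+ k * u|.
  move=> u4; have k1 : 1 <= (2 : R) ^+ k by rewrite exprn_ege1// ler1n.
  by rewrite normrM ger0_norm ?mulr_ge0 ?exprn_ge0//; nra.
by case=> /h u; rewrite !mul0r !addr0 ?add0r (bump_eq0 u) ?mul0r ?mulr0.
Qed.

(** The unit circle about such an x avoids the open square of half-side 1/4: cos a and sin a cannot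
    both be at least 3/4, since 2 (3/4)^2 > 1. *)
Lemma circ_avg1_pole_sum N x : 1 <= x.1 -> 1 <= x.2 -> circ_avg 1 (pole_sum N) x = 0.
Proof.
move=> x1 x2; rewrite /circ_avg (_ : Rintegral _ _ _ = 0) ?mulr0//.
rewrite -[RHS](_ : Rintegral (@lebesgue_measure R) `[0, 2 * pi] (fun=> 0) = 0); last first.
  by rewrite Rintegral_cst// mul0r.
apply: eq_Rintegral => a _; apply: big1 => k _; rewrite pole_term_eq0 ?mulr0//= !mul1r.
have := cos2Dsin2 a; case: (ltP (cos a) (3 / 4)) => [c _|c e].
  by left; rewrite ger0_norm; lra.
right; rewrite ger0_norm; have := sin_le1 a; first by nra.
lra.
Qed.

(** The circle meets the origin at the angle [a0]. Along the arc of length 2^(-k)/16 starting there,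
    each coordinate stays within r 2^(-k)/16 <= 2^(-k)/8 of 0, so the arguments of the bumps stay
    below 1/2. Since [a0 <= pi], this arc does not leave [0, 2 pi]. *)
Lemma circ_avg_pole_term (k : nat) x (r : R) :
  0 <= x.2 -> r ^+ 2 = x.1 ^+ 2 + x.2 ^+ 2 -> 0 < r -> r <= 2 ->
  (2 * pi)^-1 * (bump_lb R ^+ 2 / 16) / 2 ^+ k <=
  circ_avg r (fun z => bump (4 * 2 ^+ k * z.1 + 0 * z.2 + 0) *
                       bump (0 * z.1 + 4 * 2 ^+ k * z.2 + 0)) x.
Proof.
move=> x2 r2 r0 rle2.
have k1 : 1 <= (2 : R) ^+ k by rewrite exprn_ege1// ler1n.
have x1r : -1 <= x.1 / r <= 1.
  by rewrite ler_pdivlMr// ler_pdivrMr//; apply/andP; split; nra.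
pose a0 := acos (x.1 / r).
have ca0 : r * cos a0 = x.1 by rewrite acosK ?in_itv//= mulrC divfK// gt_eqF.
have sa0 : r * sin a0 = x.2.
  rewrite sin_acos// -[X in Num.sqrt X](_ : (x.2 / r) ^+ 2 = _); last first.
    rewrite !expr_div_n -[1](@divff _ (r ^+ 2)) ?expf_neq0 ?gt_eqF// -mulrBl; congr (_ / _).
    by rewrite r2; ring.
  by rewrite sqrtr_sqr ger0_norm ?divr_ge0 ?(ltW r0)// mulrC divfK// gt_eqF.
rewrite -mulrA /circ_avg ler_wpM2l ?invr_ge0 ?mulr_ge0 ?pi_ge0//.
have a00 : 0 <= a0 by exact: acos_ge0.
have a0pi : a0 <= pi by exact: acos_lepi.
have pi2 := pi_ge2 R.
have k1V : (2 ^+ k)^-1 <= 1 :> R by rewrite invf_le1// (lt_le_trans ltr01).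
have k0V : 0 < (2 ^+ k)^-1 :> R by rewrite invr_gt0 (lt_le_trans ltr01).
have -> : bump_lb R ^+ 2 / 16 / 2 ^+ k = bump_lb R ^+ 2 * (a0 + (2 ^+ k)^-1 / 16 - a0) by ring.
apply: Rintegral_ge_rect => //.
- exact: (@continuous_circle R _ r x (smooth2_pole_term k)).
- by move=> t; rewrite mulr_ge0 ?bump_ge0.
- by rewrite lerDl divr_ge0// ltW.
- by lra.
move=> t /andP[t0 t1]; rewrite !mul0r !addr0 add0r expr2 /=.
have E (u : R) : `|u| <= 2 * `|t - a0| -> `|4 * 2 ^+ k * u| <= 3 / 4.
  move=> uk; rewrite normrM ger0_norm; last by rewrite mulr_ge0// exprn_ge0.
  have ta : `|t - a0| <= (2 ^+ k)^-1 / 16 by rewrite ger0_norm; lra.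
  have : 4 * 2 ^+ k * `|u| <= 4 * 2 ^+ k * (2 * ((2 ^+ k)^-1 / 16)).
    by rewrite ler_wpM2l ?mulr_ge0 ?exprn_ge0//; lra.
  move/le_trans; apply.
  have -> : 4 * 2 ^+ k * (2 * ((2 ^+ k)^-1 / 16)) = (2 ^+ k / 2 ^+ k) / 2 :> R by field.
  by rewrite divff ?gt_eqF ?exprn_gt0//; lra.
rewrite ler_pM ?bump_lb_gt0 ?(ltW (bump_lb_gt0 R))// bump_ge// E//.
  rewrite -ca0 -mulrBr normrM (gtr0_norm r0) ler_pM// ?(ltW r0)//.
  by rewrite (distrC t) lipschitz_cos// .
rewrite -sa0 -mulrBr normrM (gtr0_norm r0) ler_pM// ?(ltW r0)//.
by rewrite distrC lipschitz_sin.
Qed.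
End small_exponents.

Section small_exponents_bounds.
Variable R : realType.
Implicit Types (x z : R * R).

Lemma exp4E (k : nat) : 4 ^+ k = (2 ^+ k) ^+ 2 :> R.
Proof.
have -> : 4 = 2 ^+ 2 :> R by rewrite -natrX.
by rewrite -!exprM mulnC.
Qed.

Definition square (k : nat) : set (R * R) :=
  strip (- ((2 ^+ k)^-1 / 4)) ((2 ^+ k)^-1 / 4) 0 0 ((2 ^+ k)^-1 / 4).

Lemma measure_square k : leb2 (square k) = ((4 ^+ k)^-1 / 4)%:E.
Proof.
have k0 : 0 < (2 ^+ k)^-1 :> R by rewrite invr_gt0 exprn_gt0.
rewrite measure_strip; [|lra..]; congr (_%:E).
by rewrite exp4E; field; rewrite expf_neq0.
Qed.

Lemma pole_term_le_indic (k : nat) z :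
  bump (4 * 2 ^+ k * z.1 + 0 * z.2 + 0) * bump (0 * z.1 + 4 * 2 ^+ k * z.2 + 0)
  <= \1_(square k) z.
Proof.
have k0 : 0 < (2 : R) ^+ k by rewrite exprn_gt0.
rewrite indicE; have [_|/negP] := boolP (_ \in _).
  by rewrite mulr_ile1 ?bump_ge0 ?bump_le1.
rewrite inE /square /strip /= !mul0r !addr0 add0r subr0 -ler_norml => zk.
have big (u : R) : ~~ (`|u| <= (2 ^+ k)^-1 / 4) -> 1 <= `|4 * 2 ^+ k * u|.
  rewrite -ltNge => h; rewrite normrM ger0_norm ?mulr_ge0 ?(ltW k0)//.
  have E : 4 * 2 ^+ k * ((2 ^+ k)^-1 / 4) = 1 :> R by field; rewrite gt_eqF.
  rewrite -[leLHS]E.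
  by rewrite ler_wpM2l ?mulr_ge0 ?(ltW k0)// ltW.
have [z1|/big z1] := boolP (`|z.1| <= (2 ^+ k)^-1 / 4); last by rewrite bump_eq0// mul0r.
have [z2|/big z2] := boolP (`|z.2| <= (2 ^+ k)^-1 / 4); last by rewrite (@bump_eq0 _ (_ * z.2))// mulr0.
by case: zk.
Qed.

(** A sum of distinct powers of two is at most twice the largest one, so its square is at most four
    times the square of that term. This disposes of the cross terms between scales in the L^2
    bound. *)
Lemma sqr_geometric_sum_le (N : nat) (b : nat -> bool) :
  (\sum_(k <- iota 0 N) 2 ^+ k * (b k)%:R) ^+ 2 <=
  4 * \sum_(k <- iota 0 N) 4 ^+ k * (b k)%:R :> R.
Proof.
have geo n : \sum_(k <- iota 0 n) 2 ^+ k * (b k)%:R <= 2 ^+ n :> R.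
  elim: n => [|n IH]; first by rewrite big_nil.
  rewrite -addn1 iotaD big_cat big_seq1 /= addn1 exprS mulr2n mulrDl mul1r lerD//.
  by rewrite ler_piMr ?exprn_ge0//; case: (b _).
elim: N => [|n IH]; first by rewrite !big_nil expr0n mulr0.
rewrite -addn1 iotaD !big_cat !big_seq1 /= add0n.
case: (b n) => /=; last by rewrite !mulr0 !addr0.
rewrite !mulr1; set s := \sum_(k <- _) 2 ^+ k * _ in IH *.
have s0 : 0 <= s by rewrite sumr_ge0// => k _; rewrite mulr_ge0 ?exprn_ge0.
apply: (@le_trans _ _ (4 * 4 ^+ n)).
  have -> : 4 * 4 ^+ n = (2 * 2 ^+ n) ^+ 2 :> R.
    by rewrite exprMn exp4E; congr (_ * _); rewrite -natrX.
  have := geo n; rewrite -/s => sn.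
  by rewrite lerXn2r ?nnegrE ?mulr_ge0 ?addr_ge0 ?exprn_ge0//; lra.
by rewrite mulrDr lerDr mulr_ge0// sumr_ge0// => k _; rewrite mulr_ge0 ?exprn_ge0.
Qed.

(** Reduces every exponent in [1, 2] to the exponent 2; the constant 1 is harmless because it is
    only integrated over a bounded support. *)
Lemma powR_le_1Dsqr (a p : R) : 0 <= a -> 1 <= p <= 2 -> a `^ p <= 1 + a ^+ 2.
Proof.
move=> a0 /andP[p1 p2]; have [a1|a1] := leP a 1.
  apply: (@le_trans _ _ 1); last by rewrite lerDl sqr_ge0.
  have [->|an0] := eqVneq a 0; first by rewrite powR0 ?gt_eqF//; lra.
  rewrite (le_trans (ge1r_powR _ p1))// a1 andbT lt_neqAle eq_sym an0//.
apply: (@le_trans _ _ (a ^+ 2)); last by rewrite lerDr.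
by rewrite -powR_mulrn// ler_powR// ltW.
Qed.

Lemma integral_pole_sum (N : nat) (p : R) : (0 < N)%N -> 1 <= p <= 2 ->
  (\int[@leb2 R]_z (`|pole_sum N z| `^ p)%:E <= 2%:E)%E.
Proof.
move=> N0 p12; have N0R : 0 < N%:R :> R by rewrite ltr0n.
(* The index [None] carries the constant 1 of [powR_le_1Dsqr], restricted to [square 0]; the index
   [Some k] carries the scale k, whose contribution is 1/N. The total is 1/4 + 1. *)
pose c (i : option nat) : R := if i is Some k then 4 / N%:R * 4 ^+ k else 1.
pose A (i : option nat) := if i is Some k then square k else square 0.
pose m (i : option nat) : R := if i is Some k then (4 ^+ k)^-1 / 4 else 1 / 4.
pose r := None :: map Some (iota 0 N).
have := @integral_sum_indic R _ r c m A.
have c0 i : 0 <= c i by case: i => //= k; rewrite mulr_ge0 ?divr_ge0 ?exprn_ge0.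
have mA i : measurable (A i) by case: i => [k|]; exact: measurable_strip.
have Am i : leb2 (A i) = (m i)%:E.
  by case: i => [k|]; rewrite measure_square//= expr0 invr1.
move=> /(_ c0 mA Am) E.
apply: (@le_trans _ _ (\int[@leb2 R]_x (\sum_(i <- r) c i * \1_(A i) x)%:E)%E).
  apply: ge0_le_lower_integral => z; first by rewrite lee_fin powR_ge0.
  rewrite lee_fin ger0_norm ?pole_sum_ge0// big_cons big_map /= mul1r.
  have S0 : 0 <= \sum_(j <- iota 0 N) 4 / N%:R * 4 ^+ j * \1_(square j) z :> R.
    by rewrite sumr_ge0// => k _; rewrite !mulr_ge0 ?divr_ge0 ?exprn_ge0// indicE.
  have [zQ|zQ] := boolP (z \in square 0); last first.
    have -> : pole_sum N z = 0.
      apply: big1 => k _; rewrite pole_term_eq0 ?mulr0//.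
      move: zQ; rewrite notin_setE /square /strip /= expr0 invr1 -ler_norml.
      rewrite mul0r addr0 subr0; have [|/ltW] := leP `|z.1| (1 / 4); last by left.
      have [|/ltW] := leP `|z.2| (1 / 4); last by right.
      by move=> h1 h2 [].
    rewrite powR0; last by rewrite gt_eqF//; lra.
    by rewrite addr_ge0// indicE.
  rewrite [X in _ <= X + _]indicE zQ.
  apply: (le_trans (powR_le_1Dsqr (pole_sum_ge0 _ _) p12)); rewrite lerD2l.
  apply: (@le_trans _ _ ((\sum_(k <- iota 0 N) 2 ^+ k * (z \in square k)%:R) ^+ 2 / N%:R)).
    rewrite -[N%:R]sqr_sqrtr ?ler0n// -expr_div_n lerXn2r ?nnegrE ?pole_sum_ge0//.
      by rewrite divr_ge0 ?sqrtr_ge0// sumr_ge0// => k _; rewrite mulr_ge0 ?exprn_ge0.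
    rewrite mulr_suml ler_sum// => k _; rewrite [leRHS]mulrAC ler_wpM2l//.
    by rewrite -indicE pole_term_le_indic.
  rewrite ler_pdivrMr// (le_trans (sqr_geometric_sum_le _ _))// mulr_sumr mulr_suml.
  rewrite ler_sum// => k _; rewrite indicE.
  by have -> : 4 / N%:R * 4 ^+ k * (z \in square k)%:R * N%:R =
    4 * (4 ^+ k * (z \in square k)%:R) :> R by field; rewrite gt_eqF.
rewrite E lee_fin big_cons big_map /= mul1r.
rewrite (eq_bigr (fun=> N%:R^-1)); last first.
  by move=> k _; field; rewrite gt_eqF//= expf_neq0.
rewrite big_const_seq count_predT size_iota iter_addr addr0 -(mulr_natr N%:R^-1) mulVf ?gt_eqF//.
lra.
Qed.

Lemma V2I_pole_sum (N : nat) z : (0 < N)%N -> 1 <= z.1 <= 11 / 10 -> 1 <= z.2 <= 11 / 10 ->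
  (((2 * pi)^-1 * (bump_lb R ^+ 2 / 16) * Num.sqrt N%:R)%:E <= V2I (pole_sum N) z)%E.
Proof.
move=> N0 /andP[z11 z12] /andP[z21 z22].
pose r := Num.sqrt (z.1 ^+ 2 + z.2 ^+ 2).
have r2 : r ^+ 2 = z.1 ^+ 2 + z.2 ^+ 2 by rewrite sqr_sqrtr// addr_ge0 ?sqr_ge0.
have r0 : 0 <= r by rewrite sqrtr_ge0.
have r1 : 1 < r by rewrite ltNge; apply/negP => h; nra.
have rle2 : r <= 2 by rewrite leNgt; apply/negP => h; nra.
apply: le_trans (V2I_ge_diff _ _ (lexx 1) r1 rle2).
rewrite lee_fin circ_avg1_pole_sum// subr0 (le_trans _ (ler_norm _))//.
rewrite /pole_sum circ_avg_sum; last first.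
  move=> k; apply: smooth2_mul; first exact: smooth2_cst.
  exact: smooth2_pole_term.
have N0R : 0 < N%:R :> R by rewrite ltr0n.
have sN : 0 < Num.sqrt N%:R :> R by rewrite sqrtr_gt0.
apply: (@le_trans _ _ (\sum_(k <- iota 0 N) (2 * pi)^-1 * (bump_lb R ^+ 2 / 16) / Num.sqrt N%:R)).
  rewrite big_const_seq count_predT size_iota iter_addr addr0 -[leRHS]mulr_natr.
  rewrite -[X in _ * X <= _](_ : (Num.sqrt N%:R)^-1 * N%:R = _) ?mulrA//.
  by rewrite -{2}[N%:R]sqr_sqrtr ?ler0n// expr2 mulKf ?gt_eqF.
apply: ler_sum => k _; rewrite circ_avgZ; last exact: smooth2_pole_term.
apply: (@le_trans _ _ (2 ^+ k / Num.sqrt N%:R *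
    ((2 * pi)^-1 * (bump_lb R ^+ 2 / 16) / 2 ^+ k))).
  have kn0 : 2 ^+ k != 0 :> R by rewrite expf_neq0.
  by rewrite [leRHS]mulrC [leRHS]mulrA divfK.
rewrite ler_wpM2l ?divr_ge0 ?exprn_ge0 ?sqrtr_ge0//.
by apply: circ_avg_pole_term => //; lra.
Qed.

Theorem Lnorm_V2I_unbounded_small (p : R) : 1 <= p <= 2 ->
  ereal_sup [set Lnorm (@leb2 R) p%:E (V2I f) | f in
     [set f : R * R -> R | schwartz f /\ (Lnorm (@leb2 R) p%:E (EFin \o f) <= 1)%E]]
  = +oo%E.
Proof.
move=> p12; have /andP[p1 p2] := p12.
apply: (@Lnorm_V2I_unbounded R p 2 (1 / 4)) => // K K0.
pose c : R := (2 * pi)^-1 * (bump_lb R ^+ 2 / 16).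
have c0 : 0 < c.
  by rewrite mulr_gt0 ?invr_gt0 ?mulr_gt0 ?pi_gt0 ?divr_gt0 ?exprn_gt0 ?bump_lb_gt0.
(* 100 is the inverse of the area of [Q] below. The summand 1 makes [H] at least 1 on [Q], where
   raising to the power p then only increases it. *)
pose B : R := (1 + 100 * K) / c.
have B0 : 0 < B by rewrite divr_gt0//; lra.
have [N N0 BN] : exists2 N : nat, (0 < N)%N & B <= Num.sqrt N%:R.
  exists (Num.truncn (B ^+ 2)).+1 => //.
  rewrite -[leLHS](ger0_norm (ltW B0)) -sqrtr_sqr ler_wsqrtr// ltW//.
  exact: truncnS_gt.
pose Q := strip (1 : R) (11 / 10) 0 (21 / 20) (1 / 20).
pose H z := c * Num.sqrt N%:R * \1_Q z.
have cN : 1 + 100 * K <= c * Num.sqrt N%:R.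
  by rewrite [leRHS]mulrC -ler_pdivrMr.
have mQ : measurable Q by exact: measurable_strip.
have mH : measurable_fun setT H.
  by apply: measurable_funM => //; exact: measurable_indic.
have H0 z : 0 <= H z.
  apply: mulr_ge0; last by rewrite indicE ler0n.
  by rewrite mulr_ge0 ?sqrtr_ge0// ltW.
exists (pole_sum N), H; split.
- exact: smooth2_pole_sum.
- move=> z z4; apply: big1 => k _; rewrite pole_term_eq0 ?mulr0//.
  by case: z4 => /ltW ?; [left|right].
- exact: integral_pole_sum.
split=> // [z|].
  rewrite /H indicE; have [|_] := boolP (z \in Q).
    rewrite inE /Q /strip /= mul0r add0r ler_norml => -[z1 /andP[z2 z3]].
    by rewrite mulr1 V2I_pole_sum//; apply/andP; split; lra.
  rewrite mulr0; apply: le_trans (V2I_ge_diff _ _ (lexx 1) (_ : 1 < 2) (lexx 2)).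
    by rewrite lee_fin.
  by rewrite ltr1n.
have E := @integral_sum_indic R nat [:: 0%N] (fun=> 100 * K) (fun=> 1 / 100) (fun=> Q).
have <- : (\int[@leb2 R]_x (\sum_(i <- [:: 0%N]) 100 * K * \1_Q x)%:E = K%:E)%E.
  rewrite E// => [|_|_]; first by rewrite big_seq1; congr (_%:E); field.
    by clear E; lra.
  by clear E; rewrite measure_strip; [congr (_%:E)|..]; lra.
apply: ge0_le_lower_integral => z.
  by clear E; rewrite lee_fin big_seq1 mulr_ge0 ?indicE ?ler0n//; lra.
rewrite lee_fin big_seq1 /H indicE; case: (z \in Q); rewrite ?mulr1 ?mulr0 ?powR_ge0//.
apply: (@le_trans _ _ (c * Num.sqrt N%:R)); clear E; first lra.
by apply: le1r_powR => //; lra.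
Qed.

End small_exponents_bounds.

(** * Stationary phase *)

Section integral_tools.
Variable R : realType.
Local Notation mu := (@lebesgue_measure R).

Lemma within_continuousP (g : R -> R) (a b : R) :
  (forall x, x \in `[a, b]%R -> {for x, continuous g}) ->
  {within `[a, b], continuous g}.
Proof. by move=> cg; apply: continuous_in_subspaceT => x; rewrite inE/=; exact: cg. Qed.

Lemma is_derive_LRcontinuous (F dF : R -> R) (a b : R) : a <= b ->
  (forall x : R, x \in `[a, b]%R -> is_derive x 1 F (dF x)) ->
  derivable_oo_LRcontinuous F a b.
Proof.
move=> ab FdF.
have c x : x \in `[a, b]%R -> F y @[y --> x] --> F x.
  by move=> /FdF /is_derive_continuous.
split.
- by move=> x xab; have [] := FdF x (subset_itv_oo_cc xab).
- by apply: cvg_at_right_filter; apply: c; rewrite in_itv/= lexx.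
- by apply: cvg_at_left_filter; apply: c; rewrite in_itv/= lexx ab.
Qed.

Lemma le_normr_Rintegral_peak (g : R -> R) (a b c A B e : R) : a <= b ->
  0 <= A -> 0 <= B -> 0 <= e -> {within `[a, b], continuous g} ->
  (forall x, a <= x <= b -> `|g x| <= B + A * \1_(`[c - e, c + e]%classic) x) ->
  `|Rintegral mu `[a, b] g| <= B * (b - a) + 2 * A * e.
Proof.
move=> ab A0 B0 e0 cg gB.
have ig : mu.-integrable `[a, b] (EFin \o g).
  by apply: continuous_compact_integrable cg; exact: segment_compact.
have muab : mu `[a, b]%classic = (b - a)%:E.
  rewrite lebesgue_measure_itv/= lte_fin; case: ltP => h; first by rewrite EFinB.
  by have -> : b = a; [apply/le_anti; rewrite h|rewrite subrr].
have muy : (mu `[a, b]%classic < +oo)%E by rewrite muab ltry.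
have ic (m : R) : mu.-integrable `[a, b] (EFin \o (fun=> m)).
  by apply: continuous_integrable_itv => t; exact: cvg_cst.
have i1 : mu.-integrable `[a, b] (EFin \o (\1_(`[c - e, c + e]%classic) : R -> R)).
  apply: measurable_bounded_integrable => //.
  exists 1; split=> // M M1 x _ /=; rewrite indicE.
  by case: (_ \in _); rewrite ?normr1 ?normr0 ltW// (lt_trans ltr01).
pose J : R -> R := \1_(`[c - e, c + e]%classic).
pose AJ x := A * J x.
pose BAJ x := B + AJ x.
have iA : mu.-integrable `[a, b] (EFin \o AJ).
  have -> : EFin \o AJ = (fun x => A%:E * (EFin \o J) x)%E.
    by apply/funext => x; rewrite /= EFinM.
  exact: integrableZl.
apply: (le_trans (le_normr_Rintegral _ ig)) => //.
apply: (@le_trans _ _ (Rintegral mu `[a, b] BAJ)).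
  apply: le_Rintegral => //.
  - exact: (integrable_norm ig).
  - have -> : EFin \o BAJ = ((EFin \o (fun=> B)) \+ (EFin \o AJ))%E.
      by apply/funext => x; rewrite /= EFinD.
    exact: integrableD.
rewrite /BAJ /AJ /J.
rewrite RintegralD//.
have -> : Rintegral mu `[a, b] (fun=> B) = B * (b - a).
  rewrite Rintegral_cst//; congr (_ * _); exact: (congr1 fine muab).
rewrite RintegralZl// lerD2l (mulrC 2) -mulrA ler_wpM2l//.
have mue : mu `[c - e, c + e]%classic = (2 * e)%:E.
  rewrite lebesgue_measure_itv/= lte_fin; case: ltP => h; last by congr (_%:E); lra.
  by rewrite -EFinB; congr (_%:E); ring.
rewrite /Rintegral integral_indic//.
apply: (@le_trans _ _ (fine (mu `[c - e, c + e]%classic))); last by rewrite mue.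
apply: fine_le.
- rewrite ge0_fin_numE//; apply: le_lt_trans muy; apply: le_measure.
  + by apply/mem_set; apply: measurableI; exact: measurable_itv.
  + by apply/mem_set; exact: measurable_itv.
  + exact: subIsetr.
- by rewrite mue.
- apply: le_measure.
  + by apply/mem_set; apply: measurableI; exact: measurable_itv.
  + by apply/mem_set; exact: measurable_itv.
  + exact: subIsetl.
Qed.

(** The primitive is normalised by a constant [e0], to be taken as its value far from the stationary
    point [c]. Then [E - e0] is small except within [e] of [c], where a crude bound over an interval
    of length 2 e suffices, and only boundary terms survive. *)
Lemma by_parts_peak (k dk E dE : R -> R) (a b c e0 A B e : R) : a < b ->
  0 <= A -> 0 <= B -> 0 <= e ->
  (forall x : R, x \in `[a, b]%R -> is_derive x 1 k (dk x)) ->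
  (forall x : R, x \in `[a, b]%R -> is_derive x 1 E (dE x)) ->
  (forall x, x \in `[a, b]%R -> {for x, continuous dk}) ->
  (forall x, x \in `[a, b]%R -> {for x, continuous dE}) ->
  (forall x, a <= x <= b ->
     `|dk x * (E x - e0)| <= B + A * \1_(`[c - e, c + e]%classic) x) ->
  `|Rintegral mu `[a, b] (fun x => k x * dE x) -
    (k b * (E b - e0) - k a * (E a - e0))| <= B * (b - a) + 2 * A * e.
Proof.
move=> ab A0 B0 e_ge0 kdk EdE cdk cdE bd.
have EdE' (x : R) : x \in `[a, b]%R -> is_derive x 1 (fun y => E y - e0) (dE x).
  move=> /EdE D; have := is_derive_add D (is_derive_cst (- e0) x 1).
  by rewrite addr0.
rewrite (@Rintegration_by_parts _ k (fun y => E y - e0) dk dE)//.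
- rewrite addrAC subrr sub0r normrN.
  apply: (@le_normr_Rintegral_peak _ a b c) => //; first exact: ltW.
  apply: within_continuousP => x xab; apply: continuousM; first exact: cdk.
  exact: is_derive_continuous (EdE' _ xab).
- exact: within_continuousP.
- exact: (is_derive_LRcontinuous (ltW ab) kdk).
- move=> x /subset_itv_oo_cc /kdk [_]; rewrite derive1E; exact.
- exact: within_continuousP.
- exact: (is_derive_LRcontinuous (ltW ab) EdE').
- move=> x /subset_itv_oo_cc /EdE' [_]; rewrite derive1E; exact.
Qed.

Lemma exists_primitive (g : R -> R) (W : R) : continuous g ->
  exists F : R -> R, forall w : R, `|w| <= W -> is_derive w 1 F (g w).
Proof.
(* Starting at -W - 1 makes every point of [-W, W] interior, so that the derivative is two-sided
   there. *)
move=> cg; exists (fun w => Rintegral mu `[- W - 1, w] g) => w wW.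
have /andP[w1 w2] : - W <= w <= W by rewrite -ler_norml.
have [] := @continuous_FTC1_closed _ g (- W - 1) w (W + 1) _ _ _ (cg w).
- lra.
- exact: continuous_integrable_itv.
- lra.
by move=> d E; apply: (DeriveDef d); rewrite -derive1E; exact: E.
Qed.

Lemma derive_ge0_le (f df : R -> R) (a b : R) : a <= b ->
  (forall x : R, x \in `[a, b]%R -> is_derive x 1 f (df x)) ->
  (forall x, x \in `[a, b]%R -> 0 <= df x) -> f a <= f b.
Proof.
move=> ab fdf df0.
have d x : x \in `]a, b[%R -> is_derive x 1 f (df x).
  by move=> xab; apply: fdf; apply: subset_itv_oo_cc xab.
have c : {within `[a, b], continuous f}.
  by apply: derivable_within_continuous => x xab; have [] := fdf x xab.
have [t tab E] := MVT_segment ab d c.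
by rewrite -subr_ge0 E mulr_ge0 ?subr_ge0// df0.
Qed.

End integral_tools.

(** * Fresnel integrals *)

Section fresnel.
Variable R : realType.
Implicit Types (F : R -> R) (w W th : R).

(** Integration by parts in disguise: F(z) - sin(z^2 + th)/(2z) has derivative sin(z^2 + th)/(2z^2),
    which is dominated by the derivative of -1/(2z). Thus [H 1] and [H (-1)] are both nondecreasing,
    and comparing their values at the ends gives the bound. *)
Lemma fresnel_tail F th (w w' : R) : 0 < w -> w <= w' ->
  (forall z : R, z \in `[w, w']%R -> is_derive z 1 F (cos (z ^+ 2 + th))) ->
  `|F w' - F w| <= w^-1.
Proof.
move=> w0 ww' dF.
pose H (sg z : R) := - (2 * z)^-1 + sg * (F z - sin (z ^+ 2 + th) * (2 * z)^-1).
have dH (sg z : R) : z \in `[w, w']%R ->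
    is_derive z 1 (H sg) ((1 + sg * sin (z ^+ 2 + th)) / (2 * z ^+ 2)).
  move=> zI; have z0 : z != 0.
    by move: zI; rewrite in_itv/= => /andP[h _]; rewrite gt_eqF// (lt_le_trans w0).
  have d2 : is_derive z 1 (fun y => 2 * y) (2 : R).
    by have := is_derive_affine 2 0 z; under eq_fun do rewrite addr0.
  have z20 : 2 * z != 0 by rewrite mulf_neq0.
  have dV := is_derive_inv z20 d2.
  have dq : is_derive z 1 (fun y : R => y ^+ 2 + th) (2 * z).
    have := is_derive_add (is_derive_mul (is_derive_id z 1) (is_derive_id z 1))
      (is_derive_cst th z 1).
    by move/is_derive_eq; apply; rewrite /=; ring.
  have ds := is_derive_comp (is_derive_sin _) dq.
  have D := is_derive_add (is_derive_mul (is_derive_cst (-1 : R) z 1) dV)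
    (is_derive_mul (is_derive_cst sg z 1) (is_derive_add (dF z zI)
      (is_derive_mul (is_derive_cst (-1 : R) z 1) (is_derive_mul ds dV)))).
  have -> : H sg = (fun y => cst (-1) y * (2 * y)^-1 +
      cst sg y * (F y + cst (-1) y * (sin (y ^+ 2 + th) * (2 * y)^-1))).
    by apply/funext => y; rewrite /H /=; ring.
  by apply: (is_derive_eq D); rewrite /cst; field; rewrite ?z0.
have mono (tau : R) : `|tau| = 1 -> H tau w <= H tau w'.
  move=> tau1; apply: (derive_ge0_le ww' (dH tau)) => z zI.
  apply: divr_ge0; last by rewrite mulr_ge0 ?sqr_ge0.
  have : `|tau * sin (z ^+ 2 + th)| <= 1 by rewrite normrM tau1 mul1r sin_max.
  by rewrite ler_norml => /andP[h _]; lra.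
have w'0 : 0 < w' by exact: lt_le_trans ww'.
have h1 := mono 1 (normr1 _); have h2 := mono (-1) (normrN1 _).
rewrite /H in h1 h2.
have bd z : 0 < z -> `|sin (z ^+ 2 + th) * (2 * z)^-1| <= (2 * z)^-1.
  move=> z0; have V0 : 0 <= (2 * z)^-1 by rewrite invr_ge0 mulr_ge0// ltW.
  by rewrite normrM (ger0_norm V0) ler_piMl// sin_max.
move: (bd w w0) (bd w' w'0); rewrite !ler_norml.
move=> /andP[p1 p2] /andP[p3 p4].
have E : w^-1 = (2 * w)^-1 + (2 * w)^-1 by field; rewrite gt_eqF.
rewrite E; apply/andP; split; lra.
Qed.

Lemma fresnel_lipschitz F th (w w' : R) : w <= w' ->
  (forall z : R, z \in `[w, w']%R -> is_derive z 1 F (cos (z ^+ 2 + th))) ->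
  `|F w' - F w| <= w' - w.
Proof.
move=> ww' dF; rewrite -[leRHS]mul1r; apply: (le_normr_derive ww' dF) => z _.
exact: cos_max.
Qed.

Lemma fresnel_bounded F th (w w' : R) : 0 <= w -> w <= w' ->
  (forall z : R, z \in `[w, w']%R -> is_derive z 1 F (cos (z ^+ 2 + th))) ->
  `|F w' - F w| <= 2.
Proof.
move=> w0 ww' dF; have sub (a b : R) : w <= a -> b <= w' -> forall z, z \in `[a, b]%R ->
    is_derive z 1 F (cos (z ^+ 2 + th)).
  move=> wa bw z; rewrite in_itv/= => /andP[h1 h2].
  by apply: dF; rewrite in_itv/=; apply/andP; split; lra.
have [w1|w1] := leP 1 w.
  apply: (le_trans (fresnel_tail _ ww' dF)); first lra.
  by rewrite (@le_trans _ _ 1)// ?invf_le1//; lra.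
have [w'1|w'1] := leP w' 1.
  by apply: (le_trans (fresnel_lipschitz ww' dF)); lra.
have h1 := fresnel_lipschitz (ltW w1) (sub w 1 (lexx _) (ltW w'1)).
have h2 := fresnel_tail ltr01 (ltW w'1) (sub 1 w' (ltW w1) (lexx _)).
rewrite invr1 in h2.
have -> : F w' - F w = (F w' - F 1) + (F 1 - F w) by ring.
by apply: (le_trans (ler_normD _ _)); lra.
Qed.

Lemma is_derive_reflect F th (w : R) : is_derive (- w) 1 F (cos ((- w) ^+ 2 + th)) ->
  is_derive w 1 (fun z => - F (- z)) (cos (w ^+ 2 + th)).
Proof.
move=> dF.
have dN : is_derive w 1 (fun z => - z) (-1 : R).
  by have := is_derive_affine (-1) 0 w; under eq_fun do rewrite addr0 mulN1r.
have := is_derive_mul (is_derive_cst (-1 : R) w 1) (is_derive_comp dF dN).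
rewrite (_ : (fun y => _) = (fun z => - F (- z))); last first.
  by apply/funext => z; rewrite /cst mulN1r.
by move/is_derive_eq; apply; rewrite /cst sqrrN; ring.
Qed.

(** Since cos(z^2) >= 1 - z^4/2, the integral up to a = 5/4 is at least a - a^5/10 > 0.94, while the
    tail beyond a is at most 1/a = 0.8. This numerical gap is the reason for the value 5/4. *)
Lemma fresnel_lower F (W : R) : 5 / 4 <= W ->
  (forall z : R, z \in `[0, W]%R -> is_derive z 1 F (cos (z ^+ 2 + 0))) ->
  1 / 8 <= F W - F 0.
Proof.
move=> W54 dF.
have sub (a b : R) : 0 <= a -> b <= W -> forall z, z \in `[a, b]%R ->
    is_derive z 1 F (cos (z ^+ 2 + 0)).
  move=> wa bw z; rewrite in_itv/= => /andP[h1 h2].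
  by apply: dF; rewrite in_itv/=; apply/andP; split; lra.
have p54 : 0 < 5 / 4 :> R by lra.
have t : `|F W - F (5 / 4)| <= (5 / 4)^-1.
  exact: (@fresnel_tail F 0 (5 / 4) W p54 W54 (sub _ _ (ltW p54) (lexx _))).
have V : (5 / 4)^-1 = 4 / 5 :> R by field.
rewrite V ler_norml in t; have /andP[t1 t2] := t.
have [a aE] : exists a : R, a = 5 / 4 by exists (5 / 4).
rewrite -aE in t1 t2 p54 W54.
pose G (z : R) := F z - (z - (1 / 10) * z ^+ 5).
have : G 0 <= G a.
  have dG z : z \in `[0, a]%R -> is_derive z 1 G (cos (z ^+ 2 + 0) - (1 - (1 / 2) * z ^+ 4)).
    move=> zI; have dFz := sub 0 a (lexx _) W54 z zI.
    pose q : {poly R} := 'X - (1 / 10)%:P * 'X^5.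
    have -> : G = (fun z => F z + cst (-1 : R) z * q.[z]).
      by apply/funext => y; rewrite /G /q hornerD hornerN hornerM hornerC hornerX hornerXn /=; ring.
    have := is_derive_add dFz (is_derive_mul (is_derive_cst (-1 : R) z 1) (is_derive_poly q z)).
    move/is_derive_eq; apply; rewrite /cst mul0r add0r.
    have -> : (q^`()).[z] = 1 - (1 / 2) * z ^+ 4.
      rewrite /q derivB derivX derivM derivC mul0r add0r derivXn.
      rewrite hornerD hornerN hornerM !hornerC hornerMn hornerXn -mulr_natr /=.
      by field.
    by ring.
  have dG0 z : z \in `[0, a]%R -> 0 <= cos (z ^+ 2 + 0) - (1 - (1 / 2) * z ^+ 4).
    move=> _; rewrite addr0.
    have c2 : cos (z ^+ 2) = 1 - 2 * sin (z ^+ 2 / 2) ^+ 2.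
      have -> : z ^+ 2 = (z ^+ 2 / 2) *+ 2 by rewrite mulr2n; field.
      by rewrite cos_mulr2n cos2sin2 (_ : _ *+ 2 / 2 = z ^+ 2 / 2) ?mulr2n; [ring|field].
    have s2 : sin (z ^+ 2 / 2) ^+ 2 <= (z ^+ 2 / 2) ^+ 2.
      have := lipschitz_sin (z ^+ 2 / 2) 0; rewrite sin0 !subr0 => h.
      by rewrite -[leLHS]real_normK ?num_real// -[leRHS]real_normK ?num_real// lerXn2r ?nnegrE.
    have E : (z ^+ 2 / 2) ^+ 2 = (1 / 4) * z ^+ 4 by field.
    rewrite c2; lra.
  exact: (derive_ge0_le (ltW p54) dG dG0).
have a5 : a ^+ 5 = 3125 / 1024 by rewrite aE; field.
rewrite /G a5 expr0n /=; lra.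
Qed.

End fresnel.

Section stationary_phase.
Variable R : realType.
Local Notation mu := (@lebesgue_measure R).

Lemma sin_incr (a b : R) : - (pi / 2) <= a -> a <= b -> b <= pi / 2 -> sin a <= sin b.
Proof.
move=> a1 ab b1; apply: (@derive_ge0_le _ (@sin R) (@cos R) a b ab) => x.
rewrite in_itv/= => /andP[x1 x2]; apply: cos_ge0_pihalf.
by rewrite (le_trans a1 x1) (le_trans x2 b1).
Qed.

Lemma cos_ge (v c : R) : `|v| <= c -> c <= pi -> cos c <= cos v.
Proof.
move=> vc cpi; rewrite -(cos_norm v) -lerN2.
apply: (@derive_ge0_le _ (fun x => - cos x) (@sin R) `|v| c vc) => x.
  move=> _; have := is_derive_mul (is_derive_cst (-1 : R) x 1) (is_derive_cos x).
  rewrite (_ : (fun y => _) = (fun x => - cos x)).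
    by move/is_derive_eq; apply; rewrite /cst; ring.
  by apply/funext => y; rewrite /cst mulN1r.
rewrite in_itv/= => /andP[x1 x2]; apply: sin_ge0_pi.
by rewrite (le_trans (normr_ge0 _) x1) (le_trans x2 cpi).
Qed.

Section fixed_frequency.
Variables (W : R) (F : R -> R) (th : R).
Hypothesis dF : forall z : R, `|z| <= W -> is_derive z 1 F (cos (z ^+ 2 + th)).

Lemma fresnel_itv (a b : R) : - W <= a -> b <= W ->
  forall z : R, z \in `[a, b]%R -> is_derive z 1 F (cos (z ^+ 2 + th)).
Proof.
move=> Wa bW z; rewrite in_itv/= => /andP[az zb]; apply: dF.
by rewrite ler_norml (le_trans Wa az) (le_trans zb bW).
Qed.

Lemma fresnel_itvN (a b : R) : - W <= a -> b <= W ->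
  forall z : R, z \in `[a, b]%R ->
    is_derive z 1 (fun z => - F (- z)) (cos (z ^+ 2 + th)).
Proof.
move=> Wa bW z; rewrite in_itv/= => /andP[az zb]; apply: is_derive_reflect; apply: dF.
by rewrite normrN ler_norml (le_trans Wa az) (le_trans zb bW).
Qed.

(** [F W] plays the role of the limit at infinity: the distance to it is always bounded, and decays
    once z is away from 0. These two cases give the two heights in [by_parts_peak]. *)
Lemma fresnel_right (z s : R) : 0 <= z -> z <= W ->
  `|F z - F W| <= 2 /\ (0 < s -> s <= z -> `|F z - F W| <= s^-1).
Proof.
move=> z0 zW; have Wz : - W <= z by lra.
rewrite distrC; split; first exact: fresnel_bounded z0 zW (fresnel_itv Wz (lexx W)).
move=> s0 sz; have z1 := lt_le_trans s0 sz.
by rewrite (le_trans (fresnel_tail z1 zW (fresnel_itv Wz (lexx W))))// lef_pV2.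
Qed.

Lemma fresnel_left (z s : R) : z <= 0 -> - W <= z ->
  `|F z - F (- W)| <= 2 /\ (0 < s -> s <= - z -> `|F z - F (- W)| <= s^-1).
Proof.
move=> z0 zW; have z0' : 0 <= - z by lra. have zW' : - z <= W by lra.
have Wz : - W <= - z by lra.
have E : F z - F (- W) = - F (- W) - - F (- - z) by rewrite (opprK z) opprK addrC.
rewrite E; split; first exact: (fresnel_bounded z0' zW' (fresnel_itvN Wz (lexx W))).
move=> s0 sz; have z1 := lt_le_trans s0 sz.
by rewrite (le_trans (fresnel_tail z1 zW' (fresnel_itvN Wz (lexx W))))// lef_pV2.
Qed.

End fixed_frequency.

Lemma continuous_cos_sqr (th : R) : continuous (fun z : R => cos (z ^+ 2 + th)).
Proof.
move=> z; have dq := is_derive_add (is_derive_mul (is_derive_id z 1) (is_derive_id z 1))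
  (is_derive_cst th z 1).
exact: is_derive_continuous (is_derive_comp (is_derive_cos _) dq).
Qed.

(** The lower bound on the cosine integral keeps the leading term of the asymptotics away from zero.
    The sine integral is the case th = -pi/2 of the same estimates. *)
Lemma fresnel_primitives (W : R) : 5 / 4 <= W ->
  exists FC FS : R -> R,
    [/\ forall z : R, `|z| <= W -> is_derive z 1 FC (cos (z ^+ 2)),
        forall z : R, `|z| <= W -> is_derive z 1 FS (sin (z ^+ 2)),
        1 / 4 <= FC W - FC (- W), `|FC W - FC (- W)| <= 4 &
        `|FS W - FS (- W)| <= 4].
Proof.
move=> W54; have W0 : 0 <= W by lra. have NW : - W <= 0 by lra.
have [FC dC] := exists_primitive W (@continuous_cos_sqr 0).
have [FS dS] := exists_primitive W (@continuous_cos_sqr (- (pi / 2))).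
have bound F th : (forall z : R, `|z| <= W -> is_derive z 1 F (cos (z ^+ 2 + th))) ->
    `|F W - F (- W)| <= 4.
  move=> dF; have -> : F W - F (- W) = - (F 0 - F W) + (F 0 - F (- W)) by ring.
  rewrite (le_trans (ler_normD _ _))// normrN.
  have [h1 _] := fresnel_right dF 1 (lexx 0) W0.
  have [h2 _] := fresnel_left dF 1 (lexx 0) NW.
  lra.
exists FC, FS; split.
- by move=> z /dC; rewrite addr0.
- by move=> z /dS; rewrite cosBpihalf.
- have h1 := fresnel_lower W54 (fresnel_itv dC NW (lexx W)).
  have h2 := fresnel_lower W54 (fresnel_itvN dC NW (lexx W)).
  rewrite oppr0 in h2; lra.
- exact: bound dC.
- exact: bound dS.
Qed.

Section single_integral.
Variables (W m bt dl L e : R) (FC FS h dh : R -> R).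
Hypotheses (m0 : 0 < m) (mW : Num.sqrt (2 * m) <= W) (bt0 : 0 <= bt) (bt4 : bt <= pi / 4).
Hypothesis dFC : forall z : R, `|z| <= W -> is_derive z 1 FC (cos (z ^+ 2)).
Hypothesis dFS : forall z : R, `|z| <= W -> is_derive z 1 FS (sin (z ^+ 2)).
Hypotheses (L0 : 0 <= L) (e0 : 0 < e) (e1 : e <= 1 / 2).
Hypothesis dh_h : forall x : R, is_derive x 1 h (dh x).
Hypothesis cdh : continuous dh.
Hypotheses (hL : forall x, `|h x| <= L) (dhL : forall x, `|dh x| <= L).
Hypotheses (h1 : h (pi / 2) = 0) (h2 : h (3 * (pi / 2)) = 0).

Local Notation p := (Num.sqrt (2 * m)).
Local Notation q := (Num.sqrt (2 / m)).
Local Notation c0 := (cos (3 * (pi / 8)) : R).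
Local Notation L' := (L / c0 + L / (c0 ^+ 2)).

(** An exact change of variables takes the place of a Taylor expansion: x - bt - pi = 2 v and
    cos(2v) = 1 - 2 sin(v)^2, so the phase is dl + m - w^2 with w = sqrt(2m) sin v. Hence [E] is a
    rescaled Fresnel integral, with derivative [dE]. The Jacobian is divided out in [k], which is
    legitimate because |v| <= 3 pi/8 on the interval. *)
Let v (x : R) := 1 / 2 * x + - ((bt + pi) / 2).
Let w (x : R) := p * sin (v x).
Let F (z : R) := cos (dl + m) * FC z + sin (dl + m) * FS z.
Let E (x : R) := q * F (w x).
Let dE (x : R) := cos (v x) * cos (dl + m * cos (x - bt - pi)).
Let k (x : R) := h x * (cos (v x))^-1.
Let dk (x : R) := dh x * (cos (v x))^-1 + h x * (sin (v x) * (1 / 2) * (cos (v x)) ^- 2).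

Let pq : q * p = 2.
Proof.
rewrite -sqrtrM ?divr_ge0 ?(ltW m0)//.
have -> : 2 / m * (2 * m) = 2 ^+ 2 by field; rewrite gt_eqF.
by rewrite sqrtr_sqr ger0_norm.
Qed.

Let dF (z : R) : `|z| <= W -> is_derive z 1 F (cos (z ^+ 2 + - (dl + m))).
Proof.
move=> zW; have := is_derive_add
  (is_derive_mul (is_derive_cst (cos (dl + m)) z 1) (dFC zW))
  (is_derive_mul (is_derive_cst (sin (dl + m)) z 1) (dFS zW)).
by move/is_derive_eq; apply; rewrite /cst cosB; ring.
Qed.

Let dv (x : R) : is_derive x 1 v (1 / 2).
Proof. exact: is_derive_affine. Qed.

Let wW x : `|w x| <= W.
Proof.
apply: le_trans mW; rewrite normrM (ger0_norm (sqrtr_ge0 _)).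
by rewrite ler_piMr ?sqrtr_ge0// sin_max.
Qed.

Let dE_E (x : R) : is_derive x 1 E (dE x).
Proof.
have dw := is_derive_mul (is_derive_cst p x 1) (is_derive_comp (is_derive_sin _) (dv x)).
have := is_derive_mul (is_derive_cst q x 1) (is_derive_comp (dF (wW x)) dw).
move/is_derive_eq; apply; rewrite /cst /dE.
have -> : w x ^+ 2 + - (dl + m) = - (dl + m * cos (x - bt - pi)).
  have -> : x - bt - pi = v x *+ 2 by rewrite mulr2n /v; field.
  rewrite cos_mulr2n cos2sin2 /w exprMn sqr_sqrtr ?mulr_ge0 ?(ltW m0)//.
  by rewrite -mulr_natr; ring.
rewrite cosN; set X := cos (_ + _); set Y := cos (v x).
transitivity (q * p / 2 * (Y * X)); first by field.
by rewrite pq divff// mul1r.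
Qed.

Let pi8 : 0 < pi / 8 :> R.
Proof. by rewrite divr_gt0 ?pi_gt0. Qed.

Let c0_gt0 : 0 < c0.
Proof. by apply: cos_gt0_pihalf; apply/andP; split; move: pi8; lra. Qed.

Let cv x : pi / 2 <= x <= 3 * (pi / 2) -> c0 <= cos (v x).
Proof.
move=> /andP[x1 x2]; apply: cos_ge; last by move: pi8; lra.
by rewrite ler_norml /v; apply/andP; split; move: pi8 bt0 bt4; lra.
Qed.

Let dk_k (x : R) : pi / 2 <= x <= 3 * (pi / 2) -> is_derive x 1 k (dk x).
Proof.
move=> /cv cx; have cn0 : cos (v x) != 0 by rewrite gt_eqF// (lt_le_trans c0_gt0).
have dc := is_derive_comp (is_derive_cos _) (dv x).
have := is_derive_mul (dh_h x) (is_derive_inv cn0 dc).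
by move/is_derive_eq; apply; rewrite /dk; congr (_ + _ * _); ring.
Qed.

Let cdk x : pi / 2 <= x <= 3 * (pi / 2) -> {for x, continuous dk}.
Proof.
move=> /cv cx; have cn0 : cos (v x) != 0 by rewrite gt_eqF// (lt_le_trans c0_gt0).
have cn2 : cos (v x) * cos (v x) != 0 by rewrite mulf_neq0.
have dc := is_derive_comp (is_derive_cos _) (dv x).
have ds := is_derive_mul (is_derive_comp (is_derive_sin _) (dv x)) (is_derive_cst (1 / 2 : R) x 1).
have dc2 := @is_derive_inv R (fun y => cos (v y) * cos (v y)) x _ cn2 (is_derive_mul dc dc).
apply: cvgD; apply: cvgM.
- exact: cdh.
- exact: is_derive_continuous (is_derive_inv cn0 dc).
- exact: is_derive_continuous (dh_h x).
- exact: is_derive_continuous (is_derive_mul ds dc2).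
Qed.

Let cdE (x : R) : {for x, continuous dE}.
Proof.
have dl1 : is_derive x 1 (fun y : R => 1 * y + - (bt + pi)) (1 : R) by exact: is_derive_affine.
have dmc := is_derive_add (is_derive_cst dl x 1)
  (is_derive_mul (is_derive_cst m x 1) (is_derive_comp (is_derive_cos _) dl1)).
have D := is_derive_mul (is_derive_comp (is_derive_cos _) (dv x))
  (is_derive_comp (is_derive_cos _) dmc).
have := is_derive_continuous D.
suff -> : (fun y : R => cos (v y) * cos (cst dl y + cst m y * cos (1 * y + - (bt + pi)))) = dE by [].
by apply/funext => y; rewrite /dE /cst mul1r opprD addrA.
Qed.

Let L'0 : 0 <= L'.
Proof. by rewrite addr_ge0// divr_ge0// ?exprn_ge0// ltW. Qed.

Let dkL x : pi / 2 <= x <= 3 * (pi / 2) -> `|dk x| <= L'.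
Proof.
move=> /cv cx; have cp := lt_le_trans c0_gt0 cx.
have V1 : `|(cos (v x))^-1| <= c0^-1.
  by rewrite gtr0_norm ?invr_gt0// lef_pV2.
rewrite (le_trans (ler_normD _ _))// lerD//; rewrite normrM ler_pM//.
rewrite normrM -[leRHS]mul1r ler_pM//.
  rewrite normrM (@ger0_norm _ (1 / 2)) //.
  have := sin_max (v x); have := normr_ge0 (sin (v x)); lra.
rewrite gtr0_norm ?invr_gt0 ?exprn_gt0// lef_pV2 ?posrE ?exprn_gt0//.
by rewrite lerXn2r ?nnegrE// ltW.
Qed.

(** Outside the e-neighbourhood of the stationary point, |v| >= e/2 and therefore |w| >= p s. *)
Let s := sin (e / 2).

Let s0 : 0 < s.
Proof. by apply: sin_gt0_pi; apply/andP; split; move: e0 e1 (pi_ge2 R); lra. Qed.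

Let p0 : 0 < p.
Proof. by rewrite sqrtr_gt0 mulr_gt0. Qed.

Local Notation A := (L' * (q * 2)).
Local Notation B := (L' * (q * (p * s)^-1)).

Let A0 : 0 <= A.
Proof. by rewrite mulr_ge0 ?mulr_ge0 ?sqrtr_ge0. Qed.

Let B0 : 0 <= B.
Proof. by rewrite mulr_ge0// mulr_ge0 ?sqrtr_ge0 ?invr_ge0 ?mulr_ge0 ?sqrtr_ge0// ltW. Qed.

Let peak x f0 : pi / 2 <= x <= 3 * (pi / 2) -> `|F (w x) - f0| <= 2 ->
  (e < `|x - (bt + pi)| -> `|F (w x) - f0| <= (p * s)^-1) ->
  `|dk x * (E x - q * f0)| <=
    B + A * \1_(`[bt + pi - e, bt + pi + e]%classic) x.
Proof.
move=> xI f2 fs; rewrite /E -mulrBr normrM normrM (ger0_norm (sqrtr_ge0 _)) indicE.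
have [_|] := boolP (x \in _).
  rewrite mulr1 -[leLHS]add0r lerD// ler_pM ?dkL ?mulr_ge0 ?sqrtr_ge0//.
  by rewrite ler_wpM2l ?sqrtr_ge0.
rewrite notin_setE /= in_itv/= => /negP xe.
rewrite mulr0 addr0 ler_pM ?dkL ?mulr_ge0 ?sqrtr_ge0//.
rewrite ler_wpM2l ?sqrtr_ge0// fs// ltNge; apply: contra xe.
by rewrite ler_norml => /andP[a1 a2]; apply/andP; split; lra.
Qed.

Let sv x : pi / 2 <= x <= 3 * (pi / 2) -> - (pi / 2) <= v x <= pi / 2.
Proof. by move=> /andP[x1 x2]; rewrite /v; apply/andP; split; move: pi8 bt0 bt4; lra. Qed.

Lemma half_right : `|Rintegral mu `[bt + pi, 3 * (pi / 2)] (fun x => k x * dE x) -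
  (k (3 * (pi / 2)) * (E (3 * (pi / 2)) - q * F W) - k (bt + pi) * (E (bt + pi) - q * F W))|
  <= B * (3 * (pi / 2) - (bt + pi)) + 2 * A * e.
Proof.
have sub x : bt + pi <= x <= 3 * (pi / 2) -> pi / 2 <= x <= 3 * (pi / 2).
  by move=> /andP[x1 x2]; apply/andP; split; move: pi8 bt0; lra.
apply: (@by_parts_peak _ k dk E dE _ _ (bt + pi)) => //.
- by move: pi8 bt4; lra.
- exact: ltW.
- by move=> x; rewrite in_itv/= => /sub; exact: dk_k.
- by move=> x; rewrite in_itv/= => /sub; exact: cdk.
move=> x xI; have xI' := sub x xI.
have [x1 x2] := andP xI; have [v1 v2] := andP (sv xI').
have vx0 : 0 <= v x by rewrite /v; lra.
have wx0 : 0 <= w x.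
  by rewrite mulr_ge0 ?sqrtr_ge0// sin_ge0_pi// vx0 (le_trans v2)//; move: pi8; lra.
have wxW := le_trans (ler_norm _) (wW x).
have [f2 fs] := fresnel_right dF (p * s) wx0 wxW.
apply: peak => // ex; apply: fs; first exact: mulr_gt0.
rewrite ler_wpM2l ?sqrtr_ge0// sin_incr//; first by move: e0 pi8; lra.
by move: ex; rewrite ger0_norm /v; lra.
Qed.

Lemma half_left : `|Rintegral mu `[pi / 2, bt + pi] (fun x => k x * dE x) -
  (k (bt + pi) * (E (bt + pi) - q * F (- W)) - k (pi / 2) * (E (pi / 2) - q * F (- W)))|
  <= B * (bt + pi - pi / 2) + 2 * A * e.
Proof.
have sub x : pi / 2 <= x <= bt + pi -> pi / 2 <= x <= 3 * (pi / 2).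
  by move=> /andP[x1 x2]; apply/andP; split; move: pi8 bt4; lra.
apply: (@by_parts_peak _ k dk E dE _ _ (bt + pi)) => //.
- by move: pi8 bt0; lra.
- exact: ltW.
- by move=> x; rewrite in_itv/= => /sub; exact: dk_k.
- by move=> x; rewrite in_itv/= => /sub; exact: cdk.
move=> x xI; have xI' := sub x xI.
have [x1 x2] := andP xI; have [v1 v2] := andP (sv xI').
have vx0 : 0 <= - v x by rewrite /v; lra.
have wN : - w x = p * sin (- v x) by rewrite sinN mulrN.
have wx0 : w x <= 0.
  rewrite -oppr_ge0 wN mulr_ge0 ?sqrtr_ge0// sin_ge0_pi// vx0.
  by move: pi8 v1; lra.
have wxW : - W <= w x by have := wW x; rewrite ler_norml => /andP[].
have [f2 fs] := fresnel_left dF (p * s) wx0 wxW.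
apply: peak => // ex; apply: fs; first exact: mulr_gt0.
rewrite wN ler_wpM2l ?sqrtr_ge0// sin_incr//; [by move: e0 pi8; lra| |lra].
by move: ex; rewrite ler0_norm /v; lra.
Qed.

(** The left half is normalised by [F (- W)] and the right half by [F W]. In the sum the common
    value of [E] at the stationary point cancels, leaving the jump q (F W - F (-W)), the full
    Fresnel integral; the outer boundary terms vanish with [h]. *)
Lemma single_integral_estimate :
  `|Rintegral mu `[pi / 2, 3 * (pi / 2)] (fun x => h x * cos (dl + m * cos (x - bt - pi)))
    - q * (h (bt + pi) * (cos (dl + m) * (FC W - FC (- W)) + sin (dl + m) * (FS W - FS (- W))))|
  <= 4 * B + 4 * A * e.
Proof.
have -> : Rintegral mu `[pi / 2, 3 * (pi / 2)] (fun x => h x * cos (dl + m * cos (x - bt - pi)))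
    = Rintegral mu `[pi / 2, 3 * (pi / 2)] (fun x => k x * dE x).
  apply: eq_Rintegral => x; rewrite inE/= in_itv/= => /cv cx.
  by rewrite /k /dE mulrA mulfVK// gt_eqF// (lt_le_trans c0_gt0).
have ik : mu.-integrable `[pi / 2, 3 * (pi / 2)] (EFin \o (fun x => k x * dE x)).
  apply: continuous_compact_integrable; first exact: segment_compact.
  apply: within_continuousP => x; rewrite in_itv/= => xI.
  by apply: continuousM => //; exact: is_derive_continuous (dk_k xI).
have split_int : Rintegral mu `[pi / 2, 3 * (pi / 2)] (fun x => k x * dE x) =
    Rintegral mu `[pi / 2, bt + pi] (fun x => k x * dE x) +
    Rintegral mu `[bt + pi, 3 * (pi / 2)] (fun x => k x * dE x).
  have := Rintegral_itvB (x := bt + pi) ik; rewrite !bnd_simp => H.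
  rewrite -(@Rintegral_itv_obnd_cbnd _ (bt + pi)).
    by rewrite -H; [ring|move: pi8 bt0; lra|move: pi8 bt4; lra].
  apply: (integrableS _ _ _ ik) => //.
  move=> x /=; rewrite !in_itv/= => /andP[x1 x2].
  by apply/andP; split; move: pi8 bt0 x1; lra.
have hr := half_right; have hl := half_left.
have k1 : k (pi / 2) = 0 by rewrite /k h1 mul0r.
have k2 : k (3 * (pi / 2)) = 0 by rewrite /k h2 mul0r.
rewrite k2 mul0r sub0r in hr; rewrite k1 mul0r subr0 in hl.
have kc : k (bt + pi) = h (bt + pi).
  rewrite /k; have -> : v (bt + pi) = 0 by rewrite /v; field.
  by rewrite cos0 invr1 mulr1.
rewrite split_int.
set I1 := Rintegral mu `[pi / 2, bt + pi] _ in hl *.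
set I2 := Rintegral mu `[bt + pi, 3 * (pi / 2)] _ in hr *.
have -> : I1 + I2 - q * (h (bt + pi) * (cos (dl + m) * (FC W - FC (- W)) +
      sin (dl + m) * (FS W - FS (- W)))) =
    (I1 - k (bt + pi) * (E (bt + pi) - q * F (- W))) +
    (I2 - - (k (bt + pi) * (E (bt + pi) - q * F W))).
  by rewrite kc /F; ring.
apply: (le_trans (ler_normD _ _)); apply: (le_trans (lerD hl hr)).
have sum_bound (x y P Q : R) : x * (Q - P / 2) + 2 * y * e + (x * (3 * (P / 2) - Q) + 2 * y * e)
  = x * P + 4 * y * e by field.
rewrite sum_bound lerD2r mulrC ler_wpM2r//.
by have := pihalf_lt2 R; lra.
Qed.

End single_integral.

(** What matters is the uniformity: [C] and [S] depend on lam alone, not on the direction, the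
    radius, the phase or the profile, so the contributions of all tubes at all times share them. *)
Theorem stationary_phase (L eps : R) : 0 <= L -> 0 < eps ->
  exists2 Lam : R, 1 <= Lam & forall lam : R, Lam <= lam ->
  exists C S : R, [/\ 1 / 4 <= C, `|C| <= 4, `|S| <= 4 &
  forall (bt t dl : R) (h dh : R -> R), 0 <= bt -> bt <= pi / 4 -> 1 <= t -> t <= 2 ->
    (forall x : R, is_derive x 1 h (dh x)) -> continuous dh ->
    (forall x, `|h x| <= L) -> (forall x, `|dh x| <= L) ->
    h (pi / 2) = 0 -> h (3 * (pi / 2)) = 0 ->
  `|Rintegral mu `[pi / 2, 3 * (pi / 2)]
      (fun x => h x * cos (dl + lam * t * cos (x - bt - pi)))
    - Num.sqrt (2 / (lam * t)) *
      (h (bt + pi) * (cos (dl + lam * t) * C + sin (dl + lam * t) * S))|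
  <= eps / Num.sqrt lam].
Proof.
move=> L0 eps0.
pose c0 : R := cos (3 * (pi / 8)).
have c0_gt0 : 0 < c0.
  have := pi_gt0 R => pi0.
  by apply: cos_gt0_pihalf; apply/andP; split; lra.
pose L' := L / c0 + L / c0 ^+ 2.
have L'0 : 0 <= L' by rewrite addr_ge0// divr_ge0// ?exprn_ge0// ltW.
(* Makes the contribution of the neighbourhood of the stationary point at most half of the allowed
   error. *)
pose e := Num.min (1 / 2) (eps / (32 * (L' + 1))).
have e0 : 0 < e by rewrite lt_min divr_gt0//= divr_gt0// mulr_gt0//; lra.
have e1 : e <= 1 / 2 by rewrite ge_min lexx.
have e2 : 16 * L' * e <= eps / 2.
  have : e <= eps / (32 * (L' + 1)) by rewrite ge_min lexx orbT.
  rewrite ler_pdivlMr; last by rewrite mulr_gt0//; lra.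
  move: e0; nra.
pose s := sin (e / 2) : R.
have s0 : 0 < s by apply: sin_gt0_pi; apply/andP; split; move: e0 e1 (pi_ge2 R); lra.
(* Once sqrt lam >= K, the contribution away from the stationary point, at most 8 L' / (s lam), is
   within the other half of the error. *)
pose K := 16 * L' / (s * eps).
have K0 : 0 <= K by rewrite divr_ge0 ?mulr_ge0// ltW.
exists (1 + K ^+ 2) => [|lam Klam]; first by rewrite lerDl sqr_ge0.
have lam1 : 1 <= lam by apply: le_trans Klam; rewrite lerDl sqr_ge0.
have lam0 : 0 < lam by lra.
pose l := Num.sqrt lam.
have l0 : 0 < l by rewrite sqrtr_gt0.
have ll : l * l = lam by rewrite -expr2 sqr_sqrtr// ltW.
have Kl : K <= l.
  by rewrite -[K]ger0_norm// -sqrtr_sqr ler_wsqrtr//; lra.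
(* Large enough for every radius t <= 2, because sqrt(2 lam t) <= 2 sqrt lam; a cut-off independent
   of t is what makes [C] and [S] independent of t. *)
pose W := 2 * l.
have W54 : 5 / 4 <= W by rewrite /W; nra.
have [FC [FS [dC dS C4 Cn Sn]]] := fresnel_primitives W54.
exists (FC W - FC (- W)), (FS W - FS (- W)); split=> //.
move=> bt t dl h dh bt0 bt4 t1 t2 dhh cdh hL dhL h1 h2.
have m0 : 0 < lam * t by rewrite mulr_gt0//; lra.
have mW : Num.sqrt (2 * (lam * t)) <= W.
  rewrite -[W]ger0_norm; last by rewrite mulr_ge0// ltW.
  by rewrite -sqrtr_sqr ler_wsqrtr// exprMn [l ^+ 2]expr2 ll; nra.
have := single_integral_estimate dl m0 mW bt0 bt4 dC dS L0 e0 e1 dhh cdh hL dhL h1 h2.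
move/le_trans; apply; rewrite -/c0 -/L' -/s -/l.
set p := Num.sqrt (2 * (lam * t)); set q := Num.sqrt (2 / (lam * t)).
have lp : l <= p by rewrite ler_wsqrtr//; nra.
have ql : q <= 2 / l.
  have l2 : 0 <= 2 / l by rewrite divr_ge0// ltW.
  rewrite -[leRHS](ger0_norm l2) -sqrtr_sqr ler_wsqrtr//.
  rewrite expr_div_n [l ^+ 2]expr2 ll ler_pM ?invr_ge0 ?(ltW m0)//.
    by rewrite expr2; lra.
  by rewrite lef_pV2 ?posrE//; nra.
have q0 : 0 <= q by exact: sqrtr_ge0.
have ps : (p * s)^-1 <= (l * s)^-1.
  by rewrite lef_pV2 ?posrE ?mulr_gt0 ?ler_wpM2r ?(ltW s0)// (lt_le_trans l0).
have ls0 : 0 < (l * s)^-1 by rewrite invr_gt0 mulr_gt0.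
have T1 : 4 * (L' * (q * (p * s)^-1)) <= (eps / 2) / l.
  apply: (@le_trans _ _ (4 * (L' * (2 / l * (l * s)^-1)))).
    rewrite ler_wpM2l// ler_wpM2l// ler_pM// invr_ge0 mulr_ge0 ?sqrtr_ge0//.
    exact: ltW.
  have -> : 4 * (L' * (2 / l * (l * s)^-1)) = (8 * L' / (l * s)) / l.
    by field; rewrite !gt_eqF.
  rewrite ler_pM2r ?invr_gt0// ler_pdivrMr ?mulr_gt0//.
  move: Kl; rewrite /K ler_pdivrMr ?mulr_gt0//; nra.
have T2 : 4 * (L' * (q * 2)) * e <= (eps / 2) / l.
  apply: (@le_trans _ _ (4 * (L' * (2 / l * 2)) * e)).
    rewrite ler_wpM2r ?(ltW e0)// ler_wpM2l// ler_wpM2l// ler_wpM2r//.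
  have -> : 4 * (L' * (2 / l * 2)) * e = (16 * L' * e) / l by field; rewrite gt_eqF.
  by rewrite ler_pM2r ?invr_gt0.
have -> : eps / l = (eps / 2) / l + (eps / 2) / l by field; rewrite gt_eqF.
exact: lerD.
Qed.

End stationary_phase.

(** * A Kakeya family of tubes *)

Section signs.
Variable R : realType.

Fixpoint signs (m : nat) : seq (seq bool) :=
  if m is m'.+1 then map (cons false) (signs m') ++ map (cons true) (signs m')
  else [:: [::]].

Lemma size_signs m : size (signs m) = (2 ^ m)%N.
Proof. by elim: m => //= m IH; rewrite size_cat !size_map IH expnS mul2n addnn. Qed.

Definition signed_sum (T : Type) (b : seq bool) (r : seq T) (F : T -> R) : R :=
  \sum_(z <- zip b r) (-1) ^+ z.1 * F z.2.

(** Orthogonality of independent signs, one sign at a time: (S + F)^2 + (S - F)^2 = 2 S^2 + 2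
    F^2. *)
Lemma sum_signed_sum_sqr (T : Type) (r : seq T) (F : T -> R) :
  \sum_(b <- signs (size r)) signed_sum b r F ^+ 2 = 2 ^+ size r * \sum_(s <- r) F s ^+ 2.
Proof.
elim: r => [|s r IH] /=.
  by rewrite big_seq1 /signed_sum !big_nil expr0n mulr0.
rewrite big_cat !big_map /= -big_split /= big_cons.
under eq_bigr => b _.
  rewrite (_ : _ + _ = 2 * F s ^+ 2 + 2 * signed_sum b r F ^+ 2); last first.
    by rewrite /signed_sum /= !big_cons /=; ring.
  over.
rewrite big_split /= -!mulr_sumr IH big_const_seq count_predT size_signs iter_addr addr0.
by rewrite -(mulr_natr (F s)) natrX exprS; ring.
Qed.

Lemma ler_norm_signed_sum (T : Type) (b : seq bool) (r : seq T) (F : T -> R) :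
  `|signed_sum b r F| <= \sum_(s <- r) `|F s|.
Proof.
rewrite /signed_sum; elim: r b => [|s r IH] [|c b] /=; rewrite ?big_nil ?normr0//.
  by rewrite sumr_ge0.
rewrite !big_cons (le_trans (ler_normD _ _))// lerD ?IH//=.
by rewrite normrMsign.
Qed.

Lemma signed_sumB (T : Type) (b : seq bool) (r : seq T) (F G : T -> R) :
  signed_sum b r F - signed_sum b r G = signed_sum b r (fun s => F s - G s).
Proof.
by rewrite /signed_sum -sumrB; apply: eq_bigr => z _; rewrite mulrBr.
Qed.

Lemma signed_sumZ (T : Type) (b : seq bool) (r : seq T) (F : T -> R) (c : R) :
  c * signed_sum b r F = signed_sum b r (fun s => c * F s).
Proof.
by rewrite /signed_sum mulr_sumr; apply: eq_bigr => z _; rewrite mulrCA.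
Qed.

End signs.

Section words.
Variable n : nat.

Fixpoint words (k : nat) : seq (seq nat) :=
  if k is k'.+1 then [seq a :: s | a <- iota 0 n, s <- words k'] else [:: [::]].

Lemma size_words k : size (words k) = (n ^ k)%N.
Proof. by elim: k => //= k IH; rewrite size_allpairs size_iota IH expnS. Qed.

Lemma mem_words k s : (s \in words k) = (size s == k) && all (ltn^~ n) s.
Proof.
elim: k s => [|k IH] [|a s] //=.
  by apply/allpairsP => -[[b t] /= [_ _]].
rewrite eqSS; apply/allpairsP/idP => [[[b t] /= [bn tk [-> ->]]]|/and3P[sk an alls]].
  by move: bn tk; rewrite mem_iota IH => /= -> /andP[-> ->].
by exists (a, s); split; rewrite //= ?mem_iota ?IH ?sk.
Qed.

Lemma uniq_words k : uniq (words k).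
Proof.
elim: k => //= k IH; apply: allpairs_uniq => //; first exact: iota_uniq.
by move=> [a s] [b t] _ _ /= [-> ->].
Qed.

End words.

(** * Tubes indexed by words in base [n] *)

Section kakeya.
Variables (R : realType) (n : nat).
Hypothesis n0 : (0 < n)%N.
Implicit Types (s : seq nat) (x y X : R) (i k : nat).

Local Notation q := (n%:R : R).

(** The word s is the base-n expansion of the slope. The intercept is chosen so that the centre line
    is the sum over i of d_i n^(-i-1) (x - node i): the i-th digit has no effect at x = node i and
    little effect up to node (i + 1), which compresses the tubes, while for x >= 1/2 every digit is
    felt and the tubes separate. *)
Definition weight i : R := (q ^+ i.+1)^-1.
Definition node i : R := i%:R / (4 * q).
Definition digit s i : R := (nth 0%N s i)%:R.
Definition tube_slope k s : R := \sum_(0 <= i < k) digit s i * weight i.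
Definition tube_icpt k s : R := - \sum_(0 <= i < k) digit s i * weight i * node i.
Definition tube_center k s x := tube_slope k s * x + tube_icpt k s.

Let q0 : 0 < q. Proof. by rewrite ltr0n. Qed.
Let q1 : 1 <= q. Proof. by rewrite ler1n. Qed.

Lemma weight_gt0 i : 0 < weight i.
Proof. by rewrite invr_gt0 exprn_gt0. Qed.

Lemma tube_centerE k s x :
  tube_center k s x = \sum_(0 <= i < k) digit s i * weight i * (x - node i).
Proof.
rewrite /tube_center /tube_slope /tube_icpt mulr_suml -sumrB.
by apply: eq_bigr => i _; rewrite mulrBr.
Qed.

Lemma sum_weights (j k : nat) : (j <= k)%N ->
  \sum_(j <= i < k) (q - 1) * weight i = (q ^+ j)^-1 - (q ^+ k)^-1.
Proof.
elim: k => [|k IH]; first by rewrite leqn0 => /eqP ->; rewrite big_geq// subrr.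
rewrite leq_eqVlt => /predU1P[->|jk]; first by rewrite big_geq// subrr.
rewrite big_nat_recr//= IH// /weight exprS.
by field; rewrite !lt0r_neq0 ?exprn_gt0.
Qed.

Lemma digit_bounds s i : all (ltn^~ n) s -> 0 <= digit s i <= q - 1.
Proof.
move=> alls; rewrite ler0n /= lerBrDr natr1 ler_nat.
have [is_|si] := ltnP i (size s); last by rewrite nth_default.
by have /allP := alls; apply; exact: mem_nth.
Qed.

Lemma tube_slope_bounds k s : all (ltn^~ n) s -> 0 <= tube_slope k s <= 1.
Proof.
move=> alls; apply/andP; split.
  apply: sumr_ge0 => i _; have /andP[d0 _] := digit_bounds i alls.
  by rewrite mulr_ge0// ltW// weight_gt0.
apply: (@le_trans _ _ (\sum_(0 <= i < k) (q - 1) * weight i)).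
  apply: ler_sum => i _; have /andP[_ d1] := digit_bounds i alls.
  by rewrite ler_wpM2r// ltW// weight_gt0.
by rewrite sum_weights// expr0 invr1 lerBlDr lerDl invr_ge0 exprn_ge0// ltW.
Qed.

Lemma node_bounds i : (i <= n)%N -> 0 <= node i <= 1 / 4.
Proof.
move=> ik; rewrite /node divr_ge0 ?mulr_ge0 ?ler0n//=.
rewrite ler_pdivrMr ?mulr_gt0//.
have : i%:R <= q :> R by rewrite ler_nat.
lra.
Qed.

Lemma node_mono i j : (i <= j)%N -> node i <= node j.
Proof.
by move=> ij; rewrite ler_wpM2r ?invr_ge0 ?mulr_ge0 ?ler_nat// ltW.
Qed.

(* At the first digit [k] where the words differ, the leading term beats all the
   later ones because [X - node i] decreases in [i]. *)
Lemma tube_separation_lt s s' k X : all (ltn^~ n) s -> all (ltn^~ n) s' ->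
  (k < n)%N -> (forall i, (i < k)%N -> nth 0%N s i = nth 0%N s' i) ->
  (nth 0%N s' k < nth 0%N s k)%N -> 1 / 2 <= X ->
  (q ^+ n)^-1 / 4 <= tube_center n s X - tube_center n s' X.
Proof.
move=> alls alls' kn eqk ltk X2.
rewrite !tube_centerE -sumrB (big_cat_nat _ (n := k)) ?(ltnW kn)//=.
rewrite big1_seq ?add0r; last first.
  move=> i /andP[_]; rewrite mem_index_iota => /andP[_ ik].
  by rewrite /digit eqk// subrr.
rewrite big_ltn//.
have Xn i : (i <= n)%N -> 1 / 4 <= X - node i.
  by move=> /node_bounds /andP[_ h]; lra.
have tail : - ((X - node k) * \sum_(k.+1 <= i < n) (q - 1) * weight i) <=
    \sum_(k.+1 <= i < n) (digit s i * weight i * (X - node i) -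
      digit s' i * weight i * (X - node i)).
  rewrite mulr_sumr -sumrN big_nat [leRHS]big_nat; apply: ler_sum => i /andP[ki iN].
  rewrite -mulrBl -mulrBl.
  have /andP[a0 _] := digit_bounds i alls; have /andP[_ b1] := digit_bounds i alls'.
  have h1 := Xn i (ltnW iN); have h2 : node k <= node i by apply: node_mono; exact: ltnW.
  have w0 := weight_gt0 i.
  have d1 : - (q - 1) <= digit s i - digit s' i by lra.
  have : (q - 1) * weight i * (X - node i) <= (q - 1) * weight i * (X - node k).
    by rewrite ler_wpM2l ?mulr_ge0 ?subr_ge0 ?(ltW w0)//; lra.
  have : - (q - 1) * (weight i * (X - node i)) <=
      (digit s i - digit s' i) * (weight i * (X - node i)).
    by rewrite ler_wpM2r// mulr_ge0 ?(ltW w0)//; lra.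
  by rewrite !mulrA !mulNr (mulrC (X - node k)) mulrAC; lra.
rewrite sum_weights// in tail.
have d1 : 1 <= digit s k - digit s' k.
  by rewrite /digit lerBrDr addrC natr1 ler_nat.
have Xk := Xn k (ltnW kn).
have w0 := weight_gt0 k.
have head : weight k * (X - node k) <=
    digit s k * weight k * (X - node k) - digit s' k * weight k * (X - node k).
  rewrite -!mulrBl ler_wpM2r ?ler_peMl//; [lra|exact: ltW].
have V0 : 0 < (q ^+ n)^-1 by rewrite invr_gt0 exprn_gt0.
have : (q ^+ n)^-1 / 4 <= (X - node k) * (q ^+ n)^-1.
  by rewrite mulrC ler_wpM2r ?(ltW V0)//; lra.
rewrite -/(weight k) in tail.
by move: head tail; lra.
Qed.

Lemma tube_separation s s' X : s \in words n n -> s' \in words n n -> s != s' ->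
  1 / 2 <= X -> (q ^+ n)^-1 / 4 <= `|tube_center n s X - tube_center n s' X|.
Proof.
rewrite !mem_words => /andP[/eqP zs alls] /andP[/eqP zs' alls'] ss' X2.
have ex : exists k, nth 0%N s k != nth 0%N s' k.
  apply: contrapT => H; move/negP: ss'; apply; apply/eqP.
  apply: (@eq_from_nth _ 0%N); first by rewrite zs.
  by move=> i _; apply/eqP/negPn/negP => h; apply: H; exists i.
have [k kne kmin] := ex_minnP ex.
have kn : (k < n)%N.
  rewrite ltnNge; apply/negP => nk; move: kne.
  by rewrite !nth_default ?zs ?zs'// eqxx.
have eqk i : (i < k)%N -> nth 0%N s i = nth 0%N s' i.
  move=> ik; apply/eqP/negPn/negP => /kmin; by rewrite leqNgt ik.
have [lt|] := ltnP (nth 0%N s' k) (nth 0%N s k).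
  by rewrite (le_trans (tube_separation_lt alls alls' kn eqk lt X2))// ler_norm.
rewrite leq_eqVlt (negbTE kne)/= => lt; rewrite distrC.
rewrite (le_trans (@tube_separation_lt s' s k X alls' alls kn _ lt X2))// ?ler_norm//.
by move=> i /eqk.
Qed.

Lemma tube_center_bounds s X : all (ltn^~ n) s -> 1 / 2 <= X -> 0 <= tube_center n s X <= X.
Proof.
move=> alls X2; have /andP[sl0 sl1] := tube_slope_bounds n alls.
rewrite tube_centerE; apply/andP; split.
  rewrite big_nat; apply: sumr_ge0 => i /andP[_ iN].
  have /andP[d0 _] := digit_bounds i alls; have /andP[_ nb] := node_bounds (ltnW iN).
  by rewrite mulr_ge0 ?mulr_ge0 ?(ltW (weight_gt0 i))//; lra.
apply: (@le_trans _ _ (tube_slope n s * X)); last by rewrite ler_piMl//; lra.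
rewrite mulr_suml big_nat [leRHS]big_nat; apply: ler_sum => i /andP[_ iN].
have /andP[d0 _] := digit_bounds i alls; have /andP[nb _] := node_bounds (ltnW iN).
by rewrite ler_wpM2l ?mulr_ge0 ?(ltW (weight_gt0 i))//; lra.
Qed.

(** Between two consecutive nodes one strip serves all the tubes whose words begin with the same k
    digits. Of the 5/8, 1/2 allows for the remaining digits and 1/8 for the tube itself. At each
    level the n^k strips have total area 5/(16 n^2), and there are n levels. *)
Definition cover_strip (ks : nat * seq nat) : set (R * R) :=
  strip (node ks.1) (node ks.1.+1) (tube_slope ks.1 ks.2) (tube_icpt ks.1 ks.2)
    (5 / 8 * weight ks.1).

Definition cover : seq (nat * seq nat) := [seq (k, s) | k <- iota 0 n, s <- words n k].

(** The k-th digit contributes at most n [weight k] / (4n), because x is within 1/(4n) of its pivot.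
    The later digits together contribute at most a quarter of a geometric tail, which is less than
    [weight k]. *)
Lemma tube_center_take s k x : (k < n)%N -> all (ltn^~ n) s -> 0 <= x <= 1 / 4 ->
  node k <= x <= node k.+1 ->
  `|tube_center n s x - tube_center k (take k s) x| <= weight k / 2.
Proof.
move=> kn alls /andP[x0 x4] /andP[xk1 xk2].
rewrite !tube_centerE (big_cat_nat _ (n := k)) ?(ltnW kn)//= (big_ltn kn).
rewrite (_ : \sum_(0 <= i < k) _ = \sum_(0 <= i < k) digit (take k s) i * weight i * (x - node i)); last first.
  rewrite big_nat [RHS]big_nat; apply: eq_bigr => i /andP[_ ik].
  by rewrite /digit nth_take.
rewrite addrAC subrr add0r (le_trans (ler_normD _ _))//.
have w0 := weight_gt0 k.
have -> : weight k / 2 = weight k / 4 + weight k / 4 by field.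
apply: lerD.
  have /andP[d0 d1] := digit_bounds k alls.
  rewrite !normrM !ger0_norm ?(ltW w0) ?subr_ge0//.
  have : x - node k <= 1 / (4 * q).
    have -> : 1 / (4 * q) = node k.+1 - node k.
      by rewrite /node -mulrBl -(natr1 k) addrC addKr.
    by rewrite lerB.
  rewrite ler_pdivlMr ?mulr_gt0// => h.
  have : digit s k * (x - node k) <= 1 / 4.
    have : digit s k * (x - node k) <= q * (x - node k) by rewrite ler_wpM2r ?subr_ge0//; lra.
    lra.
  by rewrite mulrAC => h'; rewrite mulrC ler_wpM2l ?(ltW w0)//; lra.
apply: (le_trans (ler_norm_sum _ _ _)).
apply: (@le_trans _ _ ((1 / 4) * \sum_(k.+1 <= i < n) (q - 1) * weight i)).
  rewrite mulr_sumr big_nat [leRHS]big_nat; apply: ler_sum => i /andP[ki iN].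
  have /andP[d0 d1] := digit_bounds i alls.
  have /andP[nb0 nb1] := node_bounds (ltnW iN).
  have wi := weight_gt0 i.
  rewrite !normrM (ger0_norm d0) (ger0_norm (ltW wi)) mulrC.
  apply: ler_pM => //; first by rewrite mulr_ge0// ltW.
    by rewrite ler_norml; apply/andP; split; lra.
  by rewrite ler_wpM2r// ltW.
rewrite sum_weights// /weight.
have : 0 < (q ^+ n)^-1 by rewrite invr_gt0 exprn_gt0.
lra.
Qed.

Lemma cover_tube s x y : s \in words n n -> 0 <= x <= 1 / 4 ->
  `|y - tube_center n s x| <= (q ^+ n)^-1 / 8 ->
  exists2 ks, ks \in cover & cover_strip ks (x, y).
Proof.
rewrite mem_words => /andP[/eqP zs alls] x14 ys; have /andP[x0 x4] := x14.
(* The least k with x <= node (k + 1); it exists because node n = 1/4, and its minimality gives the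
   lower bound, except for k = 0 where node 0 = 0. *)
have [k kn xk] : exists2 k, (k < n)%N & node k <= x <= node k.+1.
  have ex : exists k, x <= node k.+1.
    exists n.-1; rewrite prednK// (le_trans x4)// /node.
    by rewrite invfM mulrCA divff ?gt_eqF// mulr1 mul1r.
  have [k kx kmin] := ex_minnP ex.
  have kn : (k < n)%N.
    rewrite -(prednK n0) ltnS; apply: kmin.
    rewrite prednK// (le_trans x4)// /node.
    by rewrite invfM mulrCA divff ?gt_eqF// mulr1 mul1r.
  exists k => //; rewrite kx andbT; case: k kx kmin kn => [|k] kx kmin kn.
    by rewrite /node mul0r.
  by rewrite leNgt; apply/negP => /ltW /kmin; rewrite ltnn.
exists (k, take k s).
  apply/allpairsPdep; exists k, (take k s); split=> //; first by rewrite mem_iota.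
  rewrite mem_words size_takel ?zs 1?ltnW// eqxx /=.
  by apply/allP => a /mem_take; move/allP: alls; apply.
rewrite /cover_strip /strip /=; split=> //.
have := tube_center_take kn alls x14 xk; rewrite {2}/tube_center => h.
have wn : (q ^+ n)^-1 <= weight k.
  by rewrite lef_pV2 ?posrE ?exprn_gt0// ler_weXn2l.
move: h ys; rewrite !ler_norml => /andP[h1 h2] /andP[h3 h4].
by apply/andP; split; lra.
Qed.

Lemma measurable_cover_strip ks : measurable (cover_strip ks).
Proof. exact: measurable_strip. Qed.

Definition cover_measure (ks : nat * seq nat) : R :=
  (4 * q)^-1 * (2 * (5 / 8 * weight ks.1)).

Lemma measure_cover_strip ks : leb2 (cover_strip ks) = (cover_measure ks)%:E.
Proof.
have w0 := weight_gt0 ks.1.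
rewrite measure_strip ?node_mono//; last by lra.
congr (_%:E); rewrite /cover_measure; congr (_ * _).
by rewrite /node -mulrBl -(natr1 ks.1) addrC addKr mul1r.
Qed.

Lemma sum_cover_measure : \sum_(ks <- cover) cover_measure ks <= q^-1.
Proof.
rewrite big_allpairs_dep /=.
have -> : \sum_(i <- iota 0 n) \sum_(j <- words n i) cover_measure (i, j) =
    \sum_(i <- iota 0 n) (5 / 16 * (q * q)^-1).
  apply: eq_bigr => i _; rewrite /cover_measure /= big_const_seq count_predT size_words.
  rewrite iter_addr addr0 -[LHS]mulr_natr natrX /weight exprS.
  by field; rewrite !lt0r_neq0 ?exprn_gt0.
rewrite big_const_seq count_predT size_iota iter_addr addr0 -[leLHS]mulr_natr.
have -> : 5 / 16 * (q * q)^-1 * q = 5 / 16 * q^-1 by field; rewrite gt_eqF.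
by rewrite ler_piMl ?invr_ge0 ?(ltW q0)//; lra.
Qed.

End kakeya.

(** * Waves along the tubes *)

Section tube_waves.
Variables (R : realType) (n : nat).
Hypothesis n0 : (0 < n)%N.
Implicit Types (s : seq nat) (x z : R * R) (t lam : R).

Local Notation mu := (@lebesgue_measure R).
Local Notation width := ((n%:R : R) ^+ n)^-1.
Local Notation tubes := (words n n).
Local Notation slope := (tube_slope R n n).
Local Notation center := (tube_center n n).

Definition tube_scale : R := 8 * n%:R ^+ n.
Local Notation m := tube_scale.

Definition tube_angle s : R := atan (slope s).

(** The first factor confines z.1 to [1/2, 7/2], where the tubes are disjoint; the second is the
    transversal profile, of half-width 1/m. Both are expanded into affine forms for [smooth2_bump];
    [tube_bump_centerE] gives the geometric form. *)
Definition tube_bump s z : R :=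
  bump (2 / 3 * z.1 + 0 * z.2 + - (4 / 3)) *
  bump (- (m * slope s) * z.1 + m * z.2 + - (m * tube_icpt R n n s)).

Definition tube_wave lam s z : R := tube_bump s z *
  cos (lam * cos (tube_angle s) * z.1 + lam * sin (tube_angle s) * z.2 + 0).

Definition wave lam (b : seq bool) z : R := signed_sum b tubes (fun s => tube_wave lam s z).

Let qn0 : 0 < (n%:R : R) ^+ n. Proof. by rewrite exprn_gt0// ltr0n. Qed.
Let m0 : 0 < m. Proof. by rewrite mulr_gt0. Qed.

Lemma tube_wordP s : s \in tubes -> all (ltn^~ n) s.
Proof. by rewrite mem_words => /andP[]. Qed.

Lemma tube_bump_centerE s z : tube_bump s z =
  bump (2 / 3 * (z.1 - 2)) * bump (m * (z.2 - center s z.1)).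
Proof.
by rewrite /tube_bump /tube_center; congr (bump _ * bump _); [field|ring].
Qed.

Lemma smooth2_tube_bump s : smooth2 (tube_bump s).
Proof. by apply: smooth2_mul; exact: smooth2_bump. Qed.

Lemma smooth2_tube_wave lam s : smooth2 (tube_wave lam s).
Proof.
apply: smooth2_mul; first exact: smooth2_tube_bump.
by apply: smooth2_affine; exact: smooth1_cos.
Qed.

Lemma smooth2_wave lam b : smooth2 (wave lam b).
Proof.
rewrite /wave /signed_sum; apply: smooth2_sum => i.
by apply: smooth2_mul; [exact: smooth2_cst|exact: smooth2_tube_wave].
Qed.

Lemma tube_bump_ge0 s z : 0 <= tube_bump s z.
Proof. by apply: mulr_ge0; exact: bump_ge0. Qed.

Lemma tube_bump_le1 s z : tube_bump s z <= 1.
Proof. by apply: mulr_ile1; rewrite ?bump_ge0 ?bump_le1. Qed.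

Lemma tube_bump_supp s z : tube_bump s z != 0 ->
  1 / 2 <= z.1 <= 7 / 2 /\ `|z.2 - center s z.1| <= width / 8.
Proof.
rewrite tube_bump_centerE mulf_eq0 negb_or => /andP[z1 z2]; split.
  have : `|2 / 3 * (z.1 - 2)| < 1 by rewrite ltNge; apply: contra z1 => /bump_eq0 ->.
  by rewrite ltr_norml => /andP[h1 h2]; apply/andP; split; lra.
have : `|m * (z.2 - center s z.1)| < 1 by rewrite ltNge; apply: contra z2 => /bump_eq0 ->.
rewrite normrM (gtr0_norm m0) -ltr_pdivlMl// mulr1 => /ltW /le_trans; apply.
by rewrite /tube_scale invfM mulrC.
Qed.

(* The tubes are separated only by the gap [width / 4], so the supports, of
   half-width [width / 8], are taken open. *)
Lemma tube_bump_supp_lt s z : tube_bump s z != 0 -> `|z.2 - center s z.1| < width / 8.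
Proof.
rewrite tube_bump_centerE mulf_eq0 negb_or => /andP[z1 z2].
have : `|m * (z.2 - center s z.1)| < 1 by rewrite ltNge; apply: contra z2 => /bump_eq0 ->.
rewrite normrM (gtr0_norm m0) -ltr_pdivlMl// mulr1 => /lt_le_trans; apply.
by rewrite /tube_scale invfM mulrC.
Qed.

Lemma tube_bump_disjoint s s' z : s \in tubes -> s' \in tubes -> s != s' ->
  tube_bump s z != 0 -> tube_bump s' z = 0.
Proof.
move=> st st' ss' sz; apply: contrapT => /eqP s'z.
have [/andP[z1 _] _] := tube_bump_supp sz.
have := tube_separation n0 st st' ss' z1.
move: (tube_bump_supp_lt sz) (tube_bump_supp_lt s'z).
rewrite ler_normr !ltr_norml => /andP[a1 a2] /andP[b1 b2].
have V0 : 0 < width by rewrite invr_gt0.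
by move=> /orP[h|h]; lra.
Qed.

Lemma sum_tube_bump_le1 z : \sum_(s <- tubes) tube_bump s z <= 1.
Proof.
have [[s0 s0t s0z]|none] := pselect (exists2 s, s \in tubes & tube_bump s z != 0).
  rewrite (bigD1_seq s0)//=; last exact: uniq_words.
  rewrite big_seq_cond big1 ?addr0 ?tube_bump_le1// => s /andP[st ss0].
  by apply: (tube_bump_disjoint s0t st _ s0z); rewrite eq_sym.
rewrite big1_seq// => s /andP[_ st]; apply: contrapT => /eqP h.
by apply: none; exists s.
Qed.

Lemma wave_le1 lam b z : `|wave lam b z| <= 1.
Proof.
apply: le_trans (sum_tube_bump_le1 z); apply: (le_trans (ler_norm_signed_sum _ _ _)).
apply: ler_sum => s _; rewrite normrM (ger0_norm (tube_bump_ge0 _ _)).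
by rewrite ler_piMr ?tube_bump_ge0// cos_max.
Qed.

Lemma wave_supp lam b z : 5 < `|z.1| \/ 5 < `|z.2| -> wave lam b z = 0.
Proof.
move=> z5; apply/normr0_eq0/le_anti; rewrite normr_ge0 andbT.
apply: (le_trans (ler_norm_signed_sum _ _ _)).
rewrite big1_seq// => s /andP[_ st]; rewrite /tube_wave.
have [->|sz] := eqVneq (tube_bump s z) 0; first by rewrite mul0r normr0.
have [/andP[z1 z2] _] := tube_bump_supp sz.
have /andP[c1 c2] := tube_center_bounds n0 (tube_wordP st) z1.
have := tube_bump_supp_lt sz; rewrite ltr_norml => /andP[a1 a2].
have V1 : width <= 1.
  by rewrite invf_le1// exprn_ege1// ler1n.
have V0 : 0 < width by rewrite invr_gt0.
exfalso; case: z5; rewrite ltNge ler_norml => /negP; apply; apply/andP; split; lra.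
Qed.

Definition tube_phase lam s x : R :=
  lam * (cos (tube_angle s) * x.1 + sin (tube_angle s) * x.2).

Definition circle_bump t s x (a : R) : R := tube_bump s (x.1 - t * cos a, x.2 - t * sin a).

Lemma circle_bump_eq0 t s x a : 0 <= t -> x.1 <= 1 / 4 -> 0 <= cos a ->
  circle_bump t s x a = 0.
Proof.
move=> t0 x1 ca; rewrite /circle_bump tube_bump_centerE bump_eq0 ?mul0r//=.
have := mulr_ge0 t0 ca => tc.
by rewrite ler_normr; apply/orP; right; lra.
Qed.

(** The half of the circle with cos a >= 0 lies in the region z.1 <= 1/4, off the support. Only the
    stationary point a = angle + pi remains, the opposite one a = angle being in the discarded
    half. *)
Lemma circ_avg_tube_wave lam t s x : 0 <= t -> x.1 <= 1 / 4 ->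
  circ_avg t (tube_wave lam s) x = (2 * pi)^-1 *
    Rintegral mu `[pi / 2, 3 * (pi / 2)] (fun a => circle_bump t s x a *
      cos (tube_phase lam s x + lam * t * cos (a - tube_angle s - pi))).
Proof.
move=> t0 x1; rewrite /circ_avg; congr (_ * _).
rewrite [LHS]Rintegral_mkcond [RHS]Rintegral_mkcond; apply: eq_Rintegral => a _.
rewrite /patch.
have pi0 := pi_gt0 R.
have E : cos (lam * cos (tube_angle s) * (x.1 - t * cos a) +
      lam * sin (tube_angle s) * (x.2 - t * sin a) + 0) =
    cos (tube_phase lam s x + lam * t * cos (a - tube_angle s - pi)).
  have -> : cos (a - tube_angle s - pi) = - cos (a - tube_angle s).
    by rewrite -[in RHS](subrK pi (a - tube_angle s)) cosDpi opprK.
  by rewrite cosB /tube_phase; congr (cos _); ring.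
case: ifPn; rewrite ?inE ?notin_setE /= in_itv/= => aI.
  case: ifPn; rewrite ?inE ?notin_setE /= in_itv/= => aJ.
    by rewrite /tube_wave /circle_bump /= E.
  rewrite /tube_wave -[tube_bump _ _]/(circle_bump t s x a) circle_bump_eq0 ?mul0r//.
  have /andP[a0 a2] := aI.
  have [api|api] := leP a (pi / 2); first by apply: cos_ge0_pihalf; apply/andP; split; lra.
  have {}api : 3 * (pi / 2) < a.
    by rewrite ltNge; apply/negP => h; apply: aJ; rewrite (ltW api) h.
  have -> : cos a = cos (a - pi *+ 2) by rewrite -[in LHS](subrK (pi *+ 2) a) cosD2pi.
  by apply: cos_ge0_pihalf; rewrite (mulr2n pi); apply/andP; split; lra.
case: ifPn; rewrite ?inE ?notin_setE /= in_itv/= => aJ //.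
by exfalso; apply: aI; have /andP[a0 a2] := aJ; apply/andP; split; lra.
Qed.

Definition dcircle_bump t s x (a : R) : R :=
  let u := 2 / 3 * (x.1 - t * cos a) + 0 * (x.2 - t * sin a) + - (4 / 3) in
  let v := - (m * slope s) * (x.1 - t * cos a) + m * (x.2 - t * sin a) +
    - (m * tube_icpt R n n s) in
  dbump u * (2 / 3 * (t * sin a)) * bump v +
  bump u * (dbump v * (- (m * slope s) * (t * sin a) - m * (t * cos a))).

Lemma is_derive_circle_bump t s x (a : R) :
  is_derive a 1 (circle_bump t s x) (dcircle_bump t s x a).
Proof.
have d1 : is_derive a 1 (fun a : R => x.1 - t * cos a) (t * sin a).
  have := is_derive_add (is_derive_cst x.1 a 1)
    (is_derive_mul (is_derive_cst (- t) a 1) (is_derive_cos a)).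
  rewrite (_ : (fun y => _) = (fun a => x.1 - t * cos a)); last first.
    by apply/funext => y; rewrite /cst mulNr.
  by move/is_derive_eq; apply; rewrite /cst; ring.
have d2 : is_derive a 1 (fun a : R => x.2 - t * sin a) (- (t * cos a)).
  have := is_derive_add (is_derive_cst x.2 a 1)
    (is_derive_mul (is_derive_cst (- t) a 1) (is_derive_sin a)).
  rewrite (_ : (fun y => _) = (fun a => x.2 - t * sin a)); last first.
    by apply/funext => y; rewrite /cst mulNr.
  by move/is_derive_eq; apply; rewrite /cst; ring.
have lin (A B C : R) : is_derive a 1
    (fun a : R => A * (x.1 - t * cos a) + B * (x.2 - t * sin a) + C)
    (A * (t * sin a) - B * (t * cos a)).
  have := is_derive_add (is_derive_add (is_derive_mul (is_derive_cst A a 1) d1)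
    (is_derive_mul (is_derive_cst B a 1) d2)) (is_derive_cst C a 1).
  by move/is_derive_eq; apply; rewrite /cst; ring.
have := is_derive_mul (is_derive_comp (is_derive_bump _) (lin (2 / 3) 0 (- (4 / 3))))
  (is_derive_comp (is_derive_bump _) (lin (- (m * slope s)) m (- (m * tube_icpt R n n s)))).
by move/is_derive_eq; apply; rewrite /dcircle_bump /= (mul0r (t * cos a)) subr0.
Qed.

Lemma dcircle_bump_continuous t s x : continuous (dcircle_bump t s x).
Proof.
have c1 : continuous (fun a : R => x.1 - t * cos a).
  move=> a; apply: cvgB; first exact: cvg_cst.
  by apply: cvgM; [exact: cvg_cst|exact: continuous_cos].
have c2 : continuous (fun a : R => x.2 - t * sin a).
  move=> a; apply: cvgB; first exact: cvg_cst.
  by apply: cvgM; [exact: cvg_cst|exact: continuous_sin].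
have lin (A B C : R) : continuous (fun a : R => A * (x.1 - t * cos a) + B * (x.2 - t * sin a) + C).
  move=> a; apply: cvgD; last exact: cvg_cst.
  by apply: cvgD; apply: cvgM; [exact: cvg_cst|exact: c1|exact: cvg_cst|exact: c2].
have ts : continuous (fun a : R => t * sin a).
  by move=> a; apply: cvgM; [exact: cvg_cst|exact: continuous_sin].
have tc : continuous (fun a : R => t * cos a).
  by move=> a; apply: cvgM; [exact: cvg_cst|exact: continuous_cos].
have cb (f : R -> R) A B C : continuous f ->
    continuous (fun a : R => f (A * (x.1 - t * cos a) + B * (x.2 - t * sin a) + C)).
  move=> cf a.
  exact: (@continuous_comp R R R (fun a => A * (x.1 - t * cos a) + B * (x.2 - t * sin a) + C)
    f a (lin A B C a) (cf _)).
move=> a; apply: cvgD; apply: cvgM.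
- apply: cvgM; first exact: (cb _ _ _ _ (@dbump_continuous R)).
  by apply: cvgM; [exact: cvg_cst|exact: ts].
- exact: (cb _ _ _ _ (@bump_continuous R)).
- exact: (cb _ _ _ _ (@bump_continuous R)).
- apply: cvgM; first exact: (cb _ _ _ _ (@dbump_continuous R)).
  by apply: cvgB; apply: cvgM; [exact: cvg_cst|exact: ts|exact: cvg_cst|exact: tc].
Qed.

(** The bound depends on n through m but not on lam, and it is uniform in the tube, the point and
    the radius; this is the hypothesis under which [stationary_phase] yields one threshold for all
    of them. *)
Lemma circle_bump_C1_bound : exists2 L : R, 0 <= L & forall t s x a,
  1 <= t -> t <= 2 -> s \in tubes ->
  `|circle_bump t s x a| <= L /\ `|dcircle_bump t s x a| <= L.
Proof.
have [C C0 HC] := dbump_bounded R.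
exists (1 + C * (4 / 3) + C * (4 * m)).
  by rewrite !addr_ge0// mulr_ge0//; move: m0; lra.
move=> t s x a t1 t2 st; split.
  rewrite ger0_norm ?tube_bump_ge0// (le_trans (tube_bump_le1 _ _))// -addrA lerDl.
  by rewrite addr_ge0// mulr_ge0//; move: m0; lra.
have /andP[s0 s1] := tube_slope_bounds R n0 n (tube_wordP st).
have tn (y : R) : `|y| <= 1 -> `|t * y| <= 2.
  move=> y1; rewrite normrM (ger0_norm (le_trans ler01 t1)).
  by rewrite -[2]mulr1 ler_pM// (le_trans ler01 t1).
have sn := tn _ (sin_max a); have cn := tn _ (cos_max a).
rewrite -addrA [leRHS]addrC -[leLHS]addr0 lerD//.
rewrite (le_trans (ler_normD _ _))// lerD//.
  rewrite normrM -[leRHS]mulr1 ler_pM//; last by rewrite ger0_norm ?bump_ge0 ?bump_le1.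
  rewrite normrM ler_pM// normrM (@ger0_norm _ (2 / 3)) ?divr_ge0//.
  by move: sn; lra.
rewrite normrM -[leRHS]mul1r ler_pM//; first by rewrite ger0_norm ?bump_ge0 ?bump_le1.
rewrite normrM ler_pM// (le_trans (ler_normB _ _))// !normrM normrN (normrM m) (gtr0_norm m0).
have -> : 4 * m = m * 2 + m * 2 by ring.
rewrite -normrM -[`|t| * `|cos a|]normrM lerD//.
  rewrite -mulrA ler_wpM2l ?(ltW m0)// -[leRHS]mul1r ler_pM//.
  by rewrite ger0_norm.
have -> : `|8| * `|n%:R ^+ n| = m :> R by rewrite -normrM; exact: gtr0_norm m0.
by rewrite ler_wpM2l ?(ltW m0).
Qed.

Definition tube_profile s x : R := bump (m * (x.2 - center s x.1)).
Definition tube_cutoff s t x : R := bump (2 / 3 * (x.1 + t * cos (tube_angle s) - 2)).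
Definition tube_amp s t x : R := Num.sqrt (2 / t) * (tube_cutoff s t x * tube_profile s x).

Lemma cos_tube_angle_gt0 s : 0 < cos (tube_angle s).
Proof. by rewrite cos_atan invr_gt0 sqrtr_gt0 ltr_wpDr// sqr_ge0. Qed.

Lemma sin_tube_angle s : sin (tube_angle s) = slope s * cos (tube_angle s).
Proof.
have c0 := cos_tube_angle_gt0 s.
by rewrite -[slope s]atanK -/(tube_angle s) /tan mulfVK ?gt_eqF.
Qed.

(* The tube has slope [tan (tube_angle s)], so moving along it does not change
   the transversal profile. *)
Lemma circle_bump_stationary t s x :
  circle_bump t s x (tube_angle s + pi) = tube_cutoff s t x * tube_profile s x.
Proof.
rewrite /circle_bump tube_bump_centerE /= cosDpi sinDpi sin_tube_angle !mulrN !opprK.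
by congr (bump _ * bump _); rewrite /tube_center; ring.
Qed.

Lemma tube_angle_bounds s : s \in tubes -> 0 <= tube_angle s <= pi / 4.
Proof.
move=> st; have /andP[s0 s1] := tube_slope_bounds R n0 n (tube_wordP st).
by rewrite -(atan0 R) -(atan1 R) /tube_angle !le_atan.
Qed.

Lemma circ_avg_asymptotics (eps : R) : 0 < eps ->
  exists2 Lam : R, 1 <= Lam & forall lam, Lam <= lam ->
  exists C S : R, [/\ 1 / 4 <= C, `|C| <= 4, `|S| <= 4 &
    forall s x t, s \in tubes -> x.1 <= 1 / 4 -> 1 <= t -> t <= 2 ->
    `|2 * pi * Num.sqrt lam * circ_avg t (tube_wave lam s) x - tube_amp s t x *
      (cos (tube_phase lam s x + lam * t) * C + sin (tube_phase lam s x + lam * t) * S)|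
    <= eps].
Proof.
move=> eps0; have [L L0 HL] := circle_bump_C1_bound.
have [Lam Lam1 HLam] := stationary_phase L0 eps0.
exists Lam => // lam Lamlam; have [C [S [C4 Cn Sn H]]] := HLam lam Lamlam.
exists C, S; split=> // s x t st x1 t1 t2.
have lam0 : 0 < lam by lra. have t0 : 0 < t by lra.
have /andP[b0 b4] := tube_angle_bounds st.
have pi0 := pi_gt0 R.
have z1 : circle_bump t s x (pi / 2) = 0.
  by apply: circle_bump_eq0; rewrite ?cos_pihalf//; lra.
have z2 : circle_bump t s x (3 * (pi / 2)) = 0.
  apply: circle_bump_eq0 => //; first exact: ltW.
  have -> : 3 * (pi / 2) = pi / 2 + pi :> R by field.
  by rewrite cosDpi cos_pihalf oppr0.
have := H (tube_angle s) t (tube_phase lam s x) _ _ b0 b4 t1 t2 (is_derive_circle_bump t s x)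
  (@dcircle_bump_continuous t s x) (fun a => (HL t s x a t1 t2 st).1)
  (fun a => (HL t s x a t1 t2 st).2) z1 z2.
rewrite circle_bump_stationary circ_avg_tube_wave// ?(ltW t0)//.
set I := Rintegral _ _ _; set T := _ * C + _ * S.
have l0 : 0 < Num.sqrt lam by rewrite sqrtr_gt0.
rewrite ler_pdivlMr// -[X in _ * X <= _](gtr0_norm l0) -normrM.
suff -> : 2 * pi * Num.sqrt lam * ((2 * pi)^-1 * I) - tube_amp s t x * T =
  (I - Num.sqrt (2 / (lam * t)) * (tube_cutoff s t x * tube_profile s x * T)) * Num.sqrt lam by [].
have E : Num.sqrt (2 / t) = Num.sqrt (2 / (lam * t)) * Num.sqrt lam.
  rewrite -sqrtrM ?divr_ge0 ?mulr_ge0 ?(ltW lam0) ?(ltW t0)//.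
  by congr Num.sqrt; field; rewrite !gt_eqF.
have P2 : 2 * pi * (2 * pi)^-1 = 1 :> R by rewrite divff// gt_eqF// mulr_gt0.
rewrite /tube_amp E; transitivity (2 * pi * (2 * pi)^-1 * I * Num.sqrt lam -
  Num.sqrt (2 / (lam * t)) * Num.sqrt lam * (tube_cutoff s t x * tube_profile s x) * T); first by ring.
by rewrite P2; ring.
Qed.

(** The amplitudes vary slowly in t, at a rate independent of lam, so they are nearly constant over
    one half-period of the oscillation. *)
Lemma tube_amp_lipschitz : exists2 L : R, 0 <= L & forall s x t t',
  1 <= t -> t <= 2 -> 1 <= t' -> t' <= 2 ->
  `|tube_amp s t x - tube_amp s t' x| <= L * `|t - t'|.
Proof.
have [C C0 HC] := bump_lipschitz R.
exists (1 + 2 * C) => [|s x t t' t1 t2 t1' t2']; first by lra.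
have sq_bounds (u : R) : 1 <= u -> u <= 2 -> 1 <= Num.sqrt (2 / u) <= 2.
  move=> u1 u2; have u0 : 0 < u by lra.
  rewrite -{1}(sqrtr1 R) ler_wsqrtr ?ler_pdivlMr ?mul1r//=.
  rewrite -[leRHS](@ger0_norm _ 2)// -sqrtr_sqr ler_wsqrtr// ler_pdivrMr//.
  by rewrite expr2; lra.
have /andP[a1 a2] := sq_bounds t t1 t2; have /andP[b1 b2] := sq_bounds t' t1' t2'.
set a := Num.sqrt (2 / t) in a1 a2 *; set b := Num.sqrt (2 / t') in b1 b2 *.
have t0 : 0 < t by lra. have t0' : 0 < t' by lra.
have ab : `|a - b| <= `|t - t'|.
  have : `|a - b| * (a + b) = 2 * `|t - t'| / (t * t').
    rewrite -[X in _ * X](@ger0_norm _ (a + b)); last by lra.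
    rewrite -normrM (_ : (a - b) * (a + b) = a ^+ 2 - b ^+ 2); last by ring.
    rewrite !sqr_sqrtr ?divr_ge0 ?(ltW t0) ?(ltW t0')//.
    have -> : 2 / t - 2 / t' = 2 * (t' - t) / (t * t') by field; rewrite !gt_eqF.
    rewrite !normrM normfV normrM (distrC t') (gtr0_norm t0) (gtr0_norm t0').
    by rewrite (@ger0_norm _ 2).
  move=> E; have h : 2 * `|t - t'| / (t * t') <= 2 * `|t - t'|.
    rewrite ler_pdivrMr ?mulr_gt0// ler_peMr ?mulr_ge0//.
    by rewrite -[1]mulr1 ler_pM.
  have : `|a - b| * 2 <= `|a - b| * (a + b) by rewrite ler_wpM2l//; lra.
  by rewrite E => h'; have := le_trans h' h; lra.
have gg : `|tube_cutoff s t x - tube_cutoff s t' x| <= C * `|t - t'|.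
  rewrite (le_trans (HC _ _))// ler_wpM2l//.
  have -> : 2 / 3 * (x.1 + t * cos (tube_angle s) - 2) -
      2 / 3 * (x.1 + t' * cos (tube_angle s) - 2) =
      2 / 3 * cos (tube_angle s) * (t - t') by ring.
  rewrite normrM ler_piMl// normrM (@ger0_norm _ (2 / 3)) ?divr_ge0//.
  by have := cos_max (tube_angle s); lra.
have p0 : `|tube_profile s x| <= 1 by rewrite ger0_norm ?bump_ge0 ?bump_le1.
have g0 : `|tube_cutoff s t x| <= 1 by rewrite ger0_norm ?bump_ge0 ?bump_le1.
rewrite /tube_amp -/a -/b.
have -> : a * (tube_cutoff s t x * tube_profile s x) - b * (tube_cutoff s t' x * tube_profile s x)
  = ((a - b) * tube_cutoff s t x + b * (tube_cutoff s t x - tube_cutoff s t' x)) * tube_profile s x.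
  by ring.
rewrite normrM -[leRHS]mulr1; apply: ler_pM => //.
apply: (le_trans (ler_normD _ _)); rewrite [leRHS]mulrDl mul1r; apply: lerD.
  by rewrite normrM -[leRHS]mulr1 ler_pM.
rewrite normrM -mulrA ler_pM// ger0_norm//; lra.
Qed.

End tube_waves.

(** * Variation of a wave along two interlaced partitions *)

Section wave_variation.
Variable R : realType.

Lemma V2I_ge_seq (f : R * R -> R) (x : R * R) (u : nat -> R) (N : nat) :
  (forall k, (k < N)%N -> u k < u k.+1) -> (forall k, (k <= N)%N -> 1 <= u k <= 2) ->
  ((Num.sqrt (\sum_(k < N) (circ_avg (u k.+1) f x - circ_avg (u k) f x) ^+ 2))%:E
   <= V2I f x)%E.
Proof.
move=> ulr u12; apply: ereal_sup_ubound; exists (mkseq u N.+1); split.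
- apply/(sortedP 0) => i; rewrite size_mkseq => iN.
  by rewrite !nth_mkseq ?(ltnW iN)// ulr.
- by apply/(all_nthP 0) => i; rewrite size_mkseq ltnS => iN; rewrite nth_mkseq// u12.
- rewrite size_mkseq; congr (Num.sqrt _)%:E; apply: eq_bigr => i _.
  by rewrite !nth_mkseq ?ltnS ?(ltn_ord i) ?(ltnW (ltn_ord i)).
Qed.

(** With e the error, 4 Q^2 = (e - D)^2 <= 2 e^2 + 2 D^2. *)
Lemma sqr_ge_perturbed (D Q sg : R) : sg ^+ 2 = 1 -> `|D - (-2 * sg) * Q| <= 1 ->
  2 * Q ^+ 2 - 1 <= D ^+ 2.
Proof.
move=> sg2; set e := D - _ => e1.
have e2 : e ^+ 2 <= 1 by rewrite -[e ^+ 2]real_normK ?num_real// expr_le1.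
have E : 4 * Q ^+ 2 = (e - D) ^+ 2.
  by rewrite (_ : e - D = 2 * sg * Q); [rewrite !exprMn sg2; ring|rewrite /e; ring].
have := sqr_ge0 (e + D); nra.
Qed.

(** Consecutive samples are half a period apart and have opposite signs, so their difference doubles
    the amplitude instead of cancelling it. [G] is the reference amplitude to which both are
    compared. *)
Lemma perturbed_increment (eps c1 c2 p p' A A' G Z sk : R) : `|sk| = 1 -> `|Z| <= 8 ->
  `|p - A * (sk * Z)| <= eps -> `|p' - A' * (- sk * Z)| <= eps ->
  `|A - G| <= c1 -> `|A' - G| <= c2 ->
  `|(p' - p) - (-2 * sk) * (G * Z)| <= 2 * eps + (c2 * 8 + c1 * 8).
Proof.
move=> sk1 Z8 h1 h2 h3 h4.
have -> : (p' - p) - (-2 * sk) * (G * Z) = (p' - A' * (- sk * Z)) - (p - A * (sk * Z))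
  - (A' - G) * (sk * Z) - (A - G) * (sk * Z) by ring.
have W8 : `|sk * Z| <= 8 by rewrite normrM sk1 mul1r.
have t1 : `|(A' - G) * (sk * Z)| <= c2 * 8 by rewrite normrM ler_pM.
have t2 : `|(A - G) * (sk * Z)| <= c1 * 8 by rewrite normrM ler_pM.
move: h1 h2 t1 t2; set e1 := p - _; set e2 := p' - _.
set e3 := (A' - G) * _; set e4 := (A - G) * _; clear; rewrite !ler_norml.
by move=> /andP[? ?] /andP[? ?] /andP[? ?] /andP[? ?]; apply/andP; split; lra.
Qed.

Lemma cos_sin_shift (a : R) (j : nat) :
  (cos (a + j%:R * pi) = (-1) ^+ j * cos a) * (sin (a + j%:R * pi) = (-1) ^+ j * sin a).
Proof.
rewrite mulr_natl; split; first exact: (alternatingn (@cosDpi R)).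
exact: (alternatingn (@sinDpi R)).
Qed.

(** Origin: the squared normalisation (2 pi sqrt lam)^2 equals 16 pi^3 N when lam = 4 pi N. *)
Definition variation_const : R := (16 * pi ^+ 3)^-1.

Lemma variation_const_gt0 : 0 < variation_const.
Proof. by rewrite invr_gt0 mulr_gt0// exprn_gt0// pi_gt0. Qed.

Definition wave_time (N k : nat) : R := 3 / 2 + k%:R / (4 * N%:R).

Lemma wave_time_bounds (N k : nat) : (0 < N)%N -> (k <= N)%N ->
  3 / 2 <= wave_time N k <= 7 / 4.
Proof.
move=> N0 kN; have NR : 0 < N%:R :> R by rewrite ltr0n.
have : k%:R / (4 * N%:R) <= 1 / 4 :> R.
  rewrite ler_pdivrMr ?mulr_gt0//; have : k%:R <= N%:R :> R by rewrite ler_nat.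
  lra.
have : 0 <= k%:R / (4 * N%:R) :> R by rewrite divr_ge0 ?mulr_ge0.
by move=> h1 h2; rewrite /wave_time; apply/andP; split; lra.
Qed.

(** [wave_cos] is the leading oscillation at a multiple of a full period, and [wave_sin] the same a
    quarter of a period later. Up to sign they are the real and imaginary parts of e^(i ph) (C - i
    S), hence their squares have a constant sum. *)
Definition wave_cos (C S ph : R) : R := cos ph * C + sin ph * S.
Definition wave_sin (C S ph : R) : R := - sin ph * C + cos ph * S.

Lemma wave_cos_sin_sqr (C S ph : R) :
  wave_cos C S ph ^+ 2 + wave_sin C S ph ^+ 2 = C ^+ 2 + S ^+ 2.
Proof.
have -> : wave_cos C S ph ^+ 2 + wave_sin C S ph ^+ 2 =
  (cos ph ^+ 2 + sin ph ^+ 2) * (C ^+ 2 + S ^+ 2) by rewrite /wave_cos /wave_sin; ring.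
by rewrite cos2Dsin2 mul1r.
Qed.

Lemma ler_norm_mix (a b C S : R) : `|a| <= 1 -> `|b| <= 1 -> `|C| <= 4 -> `|S| <= 4 ->
  `|a * C + b * S| <= 8.
Proof.
move=> a1 b1 C4 S4; rewrite (le_trans (ler_normD _ _))// !normrM.
have : `|a| * `|C| <= 1 * 4 by rewrite ler_pM.
have : `|b| * `|S| <= 1 * 4 by rewrite ler_pM.
lra.
Qed.

Variable n : nat.
Hypothesis n0 : (0 < n)%N.
Local Notation tubes := (words n n).

Definition wave_re (N : nat) (lam C S : R) (b : seq bool) (k : nat) (x : R * R) : R :=
  signed_sum b tubes (fun s => tube_amp n s (wave_time N k) x *
    wave_cos C S (tube_phase n lam s x)).

Definition wave_im (N : nat) (lam C S : R) (b : seq bool) (k : nat) (x : R * R) : R :=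
  signed_sum b tubes (fun s => tube_amp n s (wave_time N k) x *
    wave_sin C S (tube_phase n lam s x)).

Definition wave_energy (N : nat) (lam C S : R) (b : seq bool) (x : R * R) : R :=
  N%:R^-1 * \sum_(k < N) (wave_re N lam C S b k x ^+ 2 + wave_im N lam C S b k x ^+ 2).

Lemma circ_avg_wave t lam b x : circ_avg t (@wave R n lam b) x =
  signed_sum b tubes (fun s => circ_avg t (tube_wave n lam s) x).
Proof.
rewrite /wave /signed_sum circ_avg_sum; last first.
  by move=> i; apply: smooth2_mul; [exact: smooth2_cst|exact: smooth2_tube_wave].
by apply: eq_bigr => i _; rewrite circ_avgZ//; exact: smooth2_tube_wave.
Qed.

Lemma ler_norm_signed_sum_size b (F : seq nat -> R) (e : R) :
  (forall s, s \in tubes -> `|F s| <= e) -> `|signed_sum b tubes F| <= (size tubes)%:R * e.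
Proof.
move=> Fe; apply: (le_trans (ler_norm_signed_sum _ _ _)).
rewrite big_seq (le_trans (ler_sum _ Fe))// -big_seq big_const_seq count_predT.
by rewrite iter_addr addr0 mulr_natl.
Qed.

(** After scaling by 2 pi sqrt lam, each increment is, up to sign, twice the real or imaginary
    amplitude, with an error of at most 1. Half of this error is allotted to stationary phase,
    summed over all tubes, and half to the drift of the amplitudes within a step; it becomes the 1
    subtracted from the energy. *)
Theorem wave_variation : exists (N : nat) (lam C S : R), [/\ (0 < N)%N, 1 / 4 <= C &
  forall b x, x.1 <= 1 / 4 ->
  ((Num.sqrt (variation_const * (wave_energy N lam C S b x - 1)))%:E <= V2I (@wave R n lam b) x)%E].
Proof.
pose M : R := (size tubes)%:R.
have M0 : 0 <= M by rewrite ler0n.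
pose eps := (4 * (M + 1))^-1.
have eps0 : 0 < eps by rewrite invr_gt0 mulr_gt0//; lra.
have epsM : M * (2 * eps) <= 1 / 2.
  have : eps * (4 * (M + 1)) = 1 by rewrite mulVf// gt_eqF// mulr_gt0//; lra.
  nra.
have [LG LG0 HLG] := tube_amp_lipschitz R n.
have [Lam Lam1 HLam] := circ_avg_asymptotics n0 eps0.
(* One choice serves two purposes: the drift summed over the tubes is at most 1/2, and lam = 4 pi N
   exceeds the threshold [Lam]. *)
pose N := (Num.truncn (8 * LG * M + Lam)).+1.
have NB : 8 * LG * M + Lam < N%:R by exact: truncnS_gt.
have N0 : (0 < N)%N by [].
have NR : 0 < N%:R :> R by rewrite ltr0n.
have LM0 : 0 <= 8 * LG * M by rewrite !mulr_ge0.
have NVM : M * (4 * LG / N%:R) <= 1 / 2.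
  rewrite mulrA ler_pdivrMr//; lra.
have pi2 := pi_ge2 R.
have pi0 := pi_gt0 R.
pose lam : R := 4 * pi * N%:R.
have lamLam : Lam <= lam by rewrite /lam; nra.
have lam0 : 0 < lam by lra.
have [C [S [C4 Cn Sn HA]]] := HLam lam lamLam.
exists N, lam, C, S; split=> // b x x1.
pose c := 2 * pi * Num.sqrt lam.
have c0 : 0 < c by rewrite mulr_gt0 ?sqrtr_gt0// mulr_gt0.
have c2 : (c ^+ 2)^-1 = variation_const / N%:R.
  rewrite /c exprMn sqr_sqrtr ?(ltW lam0)// /lam /variation_const -invfM; congr (_^-1).
  by ring.
pose a s t := c * circ_avg t (tube_wave n lam s) x.
pose ph s := tube_phase n lam s x.
(* With lam = 4 pi N the times 3/2 + k/(4N) give lam t = (6N + k) pi exactly, hence a pure sign. *)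
pose sg k : R := (-1) ^+ (6 * N + k).
have sg2 k : sg k ^+ 2 = 1 by rewrite /sg sqrr_sign.
have sgn k : `|sg k| = 1 by rewrite /sg normrX normrN1 expr1n.
have sgS k : sg k.+1 = - sg k by rewrite /sg addnS exprS mulN1r.
pose X s := wave_cos C S (ph s).
pose Y s := wave_sin C S (ph s).
have X8 s : `|X s| <= 8 by apply: ler_norm_mix => //; rewrite ?cos_max ?sin_max.
have Y8 s : `|Y s| <= 8 by apply: ler_norm_mix => //; rewrite ?normrN ?cos_max ?sin_max.
pose u k := wave_time N k.
(* A shift by a quarter of a period: lam / (8N) = pi/2. The times stay below 7/4 + 1/8 < 2. *)
pose v k := u k + (8 * N%:R)^-1.
have dN : 0 < (8 * N%:R)^-1 :> R by rewrite invr_gt0 mulr_gt0.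
have dN8 : (8 * N%:R)^-1 <= 1 / 8 :> R.
  by rewrite mul1r lef_pV2 ?posrE ?mulr_gt0// ler_peMr// ler1n.
have uS k : u k.+1 = u k + 2 * (8 * N%:R)^-1.
  by rewrite /u /wave_time -(natr1 k); field; rewrite gt_eqF.
have u12 k : (k <= N)%N -> 1 <= u k /\ u k <= 2.
  by move=> /(wave_time_bounds N0) /andP[h1 h2]; rewrite /u; clear - h1 h2; split; lra.
have v12 k : (k <= N)%N -> 1 <= v k /\ v k <= 2.
  by move=> /(wave_time_bounds N0) /andP[h1 h2]; rewrite /v /u; clear - h1 h2 dN dN8; split; lra.
have phu s k : ph s + lam * u k = ph s + (6 * N + k)%:R * pi.
  congr (_ + _); rewrite /lam /u /wave_time natrD natrM.
  by rewrite -[pi]/(pi : R); move: (pi : R) => P; field; rewrite gt_eqF.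
have phv s k : ph s + lam * v k = (ph s + (6 * N + k)%:R * pi) + pi / 2.
  rewrite -phu /v mulrDr addrA; congr (_ + _); rewrite /lam.
  by move: (pi : R) => P; field; rewrite gt_eqF.
have approx_u s k : s \in tubes -> (k <= N)%N ->
    `|a s (u k) - tube_amp n s (u k) x * (sg k * X s)| <= eps.
  move=> st kN; have [h1 h2] := u12 k kN.
  have := HA s x (u k) st x1 h1 h2; rewrite -/(ph s) phu !cos_sin_shift.
  by have -> : (-1) ^+ (6 * N + k)%N * cos (ph s) * C + (-1) ^+ (6 * N + k)%N * sin (ph s) * S
    = sg k * X s by rewrite /sg /X /wave_cos; ring.
have approx_v s k : s \in tubes -> (k <= N)%N ->
    `|a s (v k) - tube_amp n s (v k) x * (sg k * Y s)| <= eps.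
  move=> st kN; have [h1 h2] := v12 k kN.
  have := HA s x (v k) st x1 h1 h2; rewrite -/(ph s) phv cosDpihalf sinDpihalf !cos_sin_shift.
  by have -> : - ((-1) ^+ (6 * N + k)%N * sin (ph s)) * C + (-1) ^+ (6 * N + k)%N * cos (ph s) * S
    = sg k * Y s by rewrite /sg /Y /wave_sin; ring.
(* Both partitions are compared with the amplitude at [u k], so that real and imaginary parts refer
   to the same time. From there [v k] and [v k.+1] are one and three shifts away, which also covers
   the unshifted partition. *)
have E : 4 * LG / N%:R = LG * (3 * (8 * N%:R)^-1) * 8 + LG * (8 * N%:R)^-1 * 8.
  by field; rewrite gt_eqF.
have inc_u s k : s \in tubes -> (k < N)%N ->
    `|(a s (u k.+1) - a s (u k)) - (-2 * sg k) * (tube_amp n s (u k) x * X s)|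
    <= 2 * eps + 4 * LG / N%:R.
  move=> st kN; rewrite E; have [h1 h2] := u12 k (ltnW kN); have [h3 h4] := u12 k.+1 kN.
  apply: (@perturbed_increment _ _ _ _ _ _ (tube_amp n s (u k.+1) x) _ _ (sg k) (sgn k) (X8 s)
    (approx_u s k st (ltnW kN))).
  - by rewrite -sgS; exact: approx_u.
  - by rewrite subrr normr0 mulr_ge0// ltW.
  - rewrite (le_trans (HLG _ _ _ _ h3 h4 h1 h2))// ler_wpM2l// uS addrC addKr.
    by clear - dN; rewrite ger0_norm; lra.
have inc_v s k : s \in tubes -> (k < N)%N ->
    `|(a s (v k.+1) - a s (v k)) - (-2 * sg k) * (tube_amp n s (u k) x * Y s)|
    <= 2 * eps + 4 * LG / N%:R.
  move=> st kN; rewrite E; have [h1 h2] := u12 k (ltnW kN).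
  have [h3 h4] := v12 k.+1 kN; have [h5 h6] := v12 k (ltnW kN).
  apply: (@perturbed_increment _ _ _ _ _ _ (tube_amp n s (v k.+1) x) _ _ (sg k) (sgn k) (Y8 s)
    (approx_v s k st (ltnW kN))).
  - by rewrite -sgS; exact: approx_v.
  - rewrite (le_trans (HLG _ _ _ _ h5 h6 h1 h2))// ler_wpM2l// /v addrC addKr.
    by clear - dN; rewrite ger0_norm; lra.
  - rewrite (le_trans (HLG _ _ _ _ h3 h4 h1 h2))// ler_wpM2l// /v uS.
    have -> : u k + 2 * (8 * N%:R)^-1 + (8 * N%:R)^-1 - u k = 3 * (8 * N%:R)^-1 by ring.
    by clear - dN; rewrite ger0_norm; lra.
have MN : M * (2 * eps + 4 * LG / N%:R) <= 1 by clear - epsM NVM; rewrite mulrDr; lra.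
have aW t : c * circ_avg t (@wave R n lam b) x = signed_sum b tubes (fun s => a s t).
  by rewrite circ_avg_wave signed_sumZ.
have sq (w : nat -> R) (Z : seq nat -> R) k :
    (forall s, s \in tubes -> `|(a s (w k.+1) - a s (w k)) - (-2 * sg k) *
      (tube_amp n s (u k) x * Z s)| <= 2 * eps + 4 * LG / N%:R) ->
    (2 * signed_sum b tubes (fun s => tube_amp n s (u k) x * Z s) ^+ 2 - 1) * (variation_const / N%:R)
    <= (circ_avg (w k.+1) (@wave R n lam b) x - circ_avg (w k) (@wave R n lam b) x) ^+ 2.
  move=> H; rewrite -c2 ler_pdivrMr ?exprn_gt0// -exprMn (mulrC (_ - _) c) mulrBr !aW.
  apply: (sqr_ge_perturbed (sg2 k)).
  by rewrite signed_sumB signed_sumZ signed_sumB (le_trans (ler_norm_signed_sum_size _ H)).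
pose S1 := \sum_(k < N) (circ_avg (u k.+1) (@wave R n lam b) x - circ_avg (u k) (@wave R n lam b) x) ^+ 2.
pose S2 := \sum_(k < N) (circ_avg (v k.+1) (@wave R n lam b) x - circ_avg (v k) (@wave R n lam b) x) ^+ 2.
have V1 : ((Num.sqrt S1)%:E <= V2I (@wave R n lam b) x)%E.
  apply: V2I_ge_seq => [k _|k /u12[-> ->]]//; rewrite uS; clear - dN; lra.
have V2 : ((Num.sqrt S2)%:E <= V2I (@wave R n lam b) x)%E.
  apply: V2I_ge_seq => [k _|k /v12[-> ->]]//; rewrite /v uS; clear - dN; lra.
have S12 : variation_const * (wave_energy N lam C S b x - 1) <= (S1 + S2) / 2.
  rewrite -big_split /= mulr_suml.
  have -> : variation_const * (wave_energy N lam C S b x - 1) =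
      \sum_(k < N) ((wave_re N lam C S b k x ^+ 2 + wave_im N lam C S b k x ^+ 2 - 1) *
        (variation_const / N%:R)).
    rewrite -mulr_suml sumrB big_const_ord iter_addr addr0 /wave_energy.
    by field; rewrite gt_eqF.
  apply: ler_sum => k _.
  have q1 : (2 * wave_re N lam C S b k x ^+ 2 - 1) * (variation_const / N%:R) <= _ :=
    sq u X k (fun s st => inc_u s k st (ltn_ord k)).
  have q2 : (2 * wave_im N lam C S b k x ^+ 2 - 1) * (variation_const / N%:R) <= _ :=
    sq v Y k (fun s st => inc_v s k st (ltn_ord k)).
  rewrite ler_pdivlMr//; apply: le_trans (lerD q1 q2).
  by rewrite le_eqVlt; apply/orP; left; apply/eqP; ring.
(* The variation dominates both partitions, and the larger of the two sums is at least their
   mean. *)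
have [le12|/ltW le12] := leP S1 S2.
  by apply: le_trans V2; rewrite lee_fin ler_wsqrtr//; clear - S12 le12; lra.
by apply: le_trans V1; rewrite lee_fin ler_wsqrtr//; clear - S12 le12; lra.
Qed.

End wave_variation.

(** * Exponents larger than 2 *)

Section large_exponents.
Variable R : realType.

(** Here 3/64 is the total area, counted with multiplicity, of the n^n tube cores, 1/16 the lower
    bound of C^2 + S^2, and [bump_lb ^+ 4] that of the squared amplitude. *)
Definition energy_lb : R := 3 / 64 / 16 * bump_lb R ^+ 4.

Lemma energy_lb_gt0 : 0 < energy_lb.
Proof. by apply: mulr_gt0; [lra|apply: exprn_gt0; exact: bump_lb_gt0]. Qed.

Lemma le_sum_cst (I : eqType) (r : seq I) (v : I -> \bar R) (c : R) :
  (forall i, i \in r -> (v i <= c%:E)%E) ->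
  (\sum_(i <- r) v i <= ((size r)%:R * c)%:E)%E.
Proof.
elim: r => [|i r IH] vc; first by rewrite big_nil mul0r.
rewrite big_cons /= -natr1 mulrDl mul1r addrC EFinD leeD//.
  by apply: IH => j jr; apply: vc; rewrite in_cons jr orbT.
by apply: vc; rewrite mem_head.
Qed.

Variable n : nat.
Hypothesis n0 : (0 < n)%N.
Local Notation tubes := (words n n).
Local Notation m := (tube_scale R n).

Let qn0 : 0 < (n%:R : R) ^+ n. Proof. by rewrite exprn_gt0// ltr0n. Qed.
Let m0 : 0 < m. Proof. by rewrite mulr_gt0. Qed.

Definition tube_core (s : seq nat) : set (R * R) :=
  strip 0 (1 / 4) (tube_slope R n n s) (tube_icpt R n n s) (3 / 4 / m).

(** A slope in [0, 1] gives cos >= 7/10, so moving from the slab by t in [3/2, 7/4] along the tube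
    lands at an abscissa in [1.05, 2], where the cut-off is at least [bump_lb]. *)
Lemma tube_amp_ge (s : seq nat) (t : R) x : s \in tubes -> 3 / 2 <= t -> t <= 7 / 4 ->
  tube_core s x -> bump_lb R ^+ 2 <= tube_amp n s t x.
Proof.
move=> st t1 t2; rewrite /tube_core /strip /= => -[/andP[x1 x2] xs].
have t0 : 0 < t by lra.
have lb0 := bump_lb_gt0 R.
have b1 : 1 <= Num.sqrt (2 / t).
  by rewrite -[leLHS](sqrtr1 R) ler_wsqrtr// ler_pdivlMr//; lra.
have b2 : bump_lb R <= tube_profile n s x.
  apply: bump_ge; rewrite normrM (gtr0_norm m0) mulrC -ler_pdivlMr//.
have b3 : bump_lb R <= tube_cutoff n s t x.
  have c1 := cos_le1 (tube_angle R n s); have c0 := cos_tube_angle_gt0 R n s.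
  have c7 : 7 / 10 <= cos (tube_angle R n s).
    have E := cos2Dsin2 (tube_angle R n s); rewrite sin_tube_angle in E.
    have sl := tube_slope_bounds R n0 n (tube_wordP st); have /andP[s0 s1] := sl.
    have : tube_slope R n n s * cos (tube_angle R n s) <= cos (tube_angle R n s).
      by rewrite ler_piMl// ltW.
    have : 0 <= tube_slope R n n s * cos (tube_angle R n s) by rewrite mulr_ge0// ltW.
    move: E; set y := tube_slope R n n s * _; set z := cos _ in c0 c1 * => E y0 yz.
    rewrite leNgt; apply/negP => z7; nra.
  have tc1 : t * cos (tube_angle R n s) <= t by rewrite ler_piMr// ltW.
  have tc2 : t * (7 / 10) <= t * cos (tube_angle R n s) by rewrite ler_wpM2l// ltW.
  by apply: bump_ge; rewrite ler_norml; apply/andP; split; lra.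
rewrite /tube_amp expr2 -[leLHS]mul1r ler_pM ?mulr_ge0 ?(ltW lb0)//.
by rewrite ler_pM ?(ltW lb0).
Qed.

Lemma measure_tube_core s : leb2 (tube_core s) = (3 / 64 * ((n%:R : R) ^+ n)^-1)%:E.
Proof.
have V0 : 0 < 3 / 4 / m by rewrite divr_gt0.
rewrite measure_strip ?(ltW V0)//; congr (_%:E).
by rewrite /tube_scale; field; rewrite gt_eqF.
Qed.

Definition slab : set (R * R) := [set x | 0 <= x.1 <= 1 / 4].

Lemma measurable_slab : measurable slab.
Proof.
have -> : slab = setT `&` fst @^-1` `[0, 1 / 4].
  by rewrite setTI; apply/seteqP; split=> z; rewrite /slab /= in_itv.
by apply: measurable_fst => //; exact: measurable_itv.
Qed.

Section fixed_wave.
Variables (N : nat) (lam C S : R).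
Hypotheses (N0 : (0 < N)%N) (C4 : 1 / 4 <= C).
Local Notation GG := (wave_energy n N lam C S).

Lemma wave_energy_ge0 b x : 0 <= GG b x.
Proof.
rewrite mulr_ge0 ?invr_ge0 ?ler0n// sumr_ge0// => k _.
by rewrite addr_ge0 ?sqr_ge0.
Qed.

Lemma smooth2_tube_amp s t : smooth2 (tube_amp n s t : R * R -> R).
Proof.
apply: smooth2_mul; first exact: smooth2_cst.
apply: smooth2_mul.
  have -> : tube_cutoff n s t = (fun x : R * R => bump (2 / 3 * x.1 + 0 * x.2 +
      2 / 3 * (t * cos (tube_angle R n s) - 2))).
    by apply/funext => x; rewrite /tube_cutoff; congr bump; ring.
  exact: smooth2_bump.
have -> : tube_profile n s = (fun x : R * R => bump (- (m * tube_slope R n n s) * x.1 +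
    m * x.2 + - (m * tube_icpt R n n s))).
  by apply/funext => x; rewrite /tube_profile /tube_center; congr bump; ring.
exact: smooth2_bump.
Qed.

Lemma smooth2_phase (A B : R) s : smooth2 (fun x : R * R =>
  cos (tube_phase n lam s x) * A + sin (tube_phase n lam s x) * B).
Proof.
have c : smooth2 (fun x : R * R => cos (tube_phase n lam s x)).
  have -> : (fun x : R * R => cos (tube_phase n lam s x)) = (fun x : R * R =>
      cos (lam * cos (tube_angle R n s) * x.1 + lam * sin (tube_angle R n s) * x.2 + 0)).
    by apply/funext => x; rewrite /tube_phase; congr cos; ring.
  by apply: smooth2_affine; exact: smooth1_cos.
have d : smooth2 (fun x : R * R => sin (tube_phase n lam s x)).
  have -> : (fun x : R * R => sin (tube_phase n lam s x)) = (fun x : R * R =>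
      cos (lam * cos (tube_angle R n s) * x.1 + lam * sin (tube_angle R n s) * x.2 +
        - (pi / 2))).
    by apply/funext => x; rewrite cosBpihalf /tube_phase; congr sin; ring.
  by apply: smooth2_affine; exact: smooth1_cos.
by apply: smooth2_add; apply: smooth2_mul => //; exact: smooth2_cst.
Qed.

Lemma smooth2_wave_energy b : smooth2 (GG b).
Proof.
have P k : smooth2 (wave_re n N lam C S b k).
  rewrite /wave_re /signed_sum; apply: smooth2_sum => z.
  apply: smooth2_mul; first exact: smooth2_cst.
  by apply: smooth2_mul; [exact: smooth2_tube_amp|exact: smooth2_phase].
have Q k : smooth2 (wave_im n N lam C S b k).
  rewrite /wave_im /signed_sum; apply: smooth2_sum => z.
  apply: smooth2_mul; first exact: smooth2_cst.
  apply: smooth2_mul; first exact: smooth2_tube_amp.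
  have -> : (fun x : R * R => wave_sin C S (tube_phase n lam z.2 x)) =
      (fun x => cos (tube_phase n lam z.2 x) * S + sin (tube_phase n lam z.2 x) * - C).
    by apply/funext => x; rewrite /wave_sin; ring.
  exact: smooth2_phase.
apply: smooth2_mul; first exact: smooth2_cst.
by apply: smooth2_sum => k; apply: smooth2_add; apply: smooth2_mul.
Qed.

(** Summing over the signs leaves only the diagonal terms, and the real and imaginary parts combine
    into C^2 + S^2. The tubes may overlap arbitrarily here: multiplicities are counted in full. *)
Lemma sum_wave_energy_ge x : 0 <= x.1 <= 1 / 4 ->
  2 ^+ size tubes * \sum_(s <- tubes) (bump_lb R ^+ 4 / 16) * \1_(tube_core s) x <=
  \sum_(b <- signs (size tubes)) GG b x.
Proof.
move=> x14; have NR : 0 < N%:R :> R by rewrite ltr0n.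
rewrite /wave_energy -[leRHS]mulr_sumr [X in _ <= _ * X]exchange_big /=.
have bk (k : 'I_N) : 2 ^+ size tubes * \sum_(s <- tubes) (bump_lb R ^+ 4 / 16) * \1_(tube_core s) x
   <= \sum_(b <- signs (size tubes)) (wave_re n N lam C S b k x ^+ 2 + wave_im n N lam C S b k x ^+ 2).
  rewrite big_split /= !sum_signed_sum_sqr -mulrDr -big_split /= ler_wpM2l ?exprn_ge0//.
  rewrite big_seq [leRHS]big_seq; apply: ler_sum => s st.
  have E (a u v : R) : (a * u) ^+ 2 + (a * v) ^+ 2 = a ^+ 2 * (u ^+ 2 + v ^+ 2) by ring.
  rewrite E wave_cos_sin_sqr indicE.
  have [|_] := boolP (x \in _); last by rewrite mulr0 mulr_ge0 ?addr_ge0 ?sqr_ge0.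
  rewrite inE mulr1 => xs.
  have /andP[h1 h2] := @wave_time_bounds R N k N0 (ltnW (ltn_ord k)).
  have h := tube_amp_ge st h1 h2 xs.
  apply: ler_pM; rewrite ?exprn_ge0 ?(ltW (bump_lb_gt0 R))//.
    rewrite (_ : bump_lb R ^+ 4 = (bump_lb R ^+ 2) ^+ 2); last by rewrite -exprM.
    have l0 : 0 <= bump_lb R ^+ 2 by rewrite sqr_ge0.
    by rewrite lerXn2r ?nnegrE// (le_trans l0).
  have c2 : 1 / 4 * (1 / 4) <= C * C by rewrite ler_pM.
  have := sqr_ge0 S; rewrite (expr2 C); lra.
apply: (@le_trans _ _ (N%:R^-1 * \sum_(k < N) (2 ^+ size tubes *
    \sum_(s <- tubes) (bump_lb R ^+ 4 / 16) * \1_(tube_core s) x))).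
  rewrite big_const_ord iter_addr addr0 -[X in _ <= _ * X]mulr_natl mulKf// gt_eqF//.
by rewrite ler_wpM2l ?invr_ge0 ?ler0n// ler_sum.
Qed.

(** Some choice of signs does at least as well as half the average; the factor 1/2 turns the
    non-strict bounds into a contradiction. *)
Lemma exists_signs : exists b,
  ((energy_lb / 2)%:E <= \int[@leb2 R]_x (\1_slab x * GG b x)%:E)%E.
Proof.
apply: contrapT => H.
have mI b : measurable_fun setT (fun x => (\1_slab x * GG b x)%:E : \bar R).
  apply/measurable_EFinP; apply: measurable_funM.
    by apply: measurable_indic; exact: measurable_slab.
  by apply: smooth2_measurable; exact: smooth2_wave_energy.
have I0 b x : 0 <= \1_slab x * GG b x by rewrite mulr_ge0 ?wave_energy_ge0// indicE ler0n.
have up : (\sum_(b <- signs (size tubes)) \int[@leb2 R]_x (\1_slab x * GG b x)%:E <=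
    ((size (signs (size tubes)))%:R * (energy_lb / 2))%:E)%E.
  apply: le_sum_cst => b _; rewrite leNgt; apply/negP => h; apply: H; exists b.
  exact: ltW.
have M0 : 0 < 2 ^+ size tubes :> R by rewrite exprn_gt0.
have lo : ((2 ^+ size tubes * energy_lb)%:E <=
    \sum_(b <- signs (size tubes)) \int[@leb2 R]_x (\1_slab x * GG b x)%:E)%E.
  rewrite -ge0_integral_sum//; last by move=> b x _; rewrite lee_fin.
  pose c (s : seq nat) : R := 2 ^+ size tubes * (bump_lb R ^+ 4 / 16).
  have E := @integral_sum_indic R _ tubes c (fun=> 3 / 64 * ((n%:R : R) ^+ n)^-1) tube_core.
  have -> : (2 ^+ size tubes * energy_lb)%:E =
      (\int[@leb2 R]_x (\sum_(s <- tubes) c s * \1_(tube_core s) x)%:E)%E.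
    rewrite E; first last.
    - by move=> s; exact: measure_tube_core.
    - by move=> s; exact: measurable_strip.
    - by move=> s; rewrite mulr_ge0 ?divr_ge0 ?exprn_ge0// ltW// bump_lb_gt0.
    congr (_%:E); rewrite /c big_const_seq count_predT iter_addr addr0 -[RHS]mulr_natr size_words natrX.
    by rewrite /energy_lb; field; rewrite gt_eqF.
  apply: ge0_le_lower_integral => x.
    rewrite lee_fin sumr_ge0// => s _; rewrite mulr_ge0 ?indicE ?ler0n//.
    by rewrite mulr_ge0 ?divr_ge0 ?exprn_ge0// ltW// bump_lb_gt0.
  rewrite sumEFin lee_fin -[leRHS]mulr_sumr.
  have [xD|xD] := boolP (x \in slab).
    rewrite [X in _ <= X * _]indicE xD mul1r.
    rewrite /c; under eq_bigr do rewrite -mulrA.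
    by rewrite -mulr_sumr sum_wave_energy_ge//; move: xD; rewrite inE.
  rewrite big1 ?mulr_ge0 ?sumr_ge0//.
  - by move=> b _; exact: wave_energy_ge0.
  move=> s _; rewrite indicE [_ \in _](_ : _ = false) ?mulr0//.
  apply/negbTE; apply: contra xD; rewrite !inE /tube_core /strip /slab /=.
  by case.
have := le_trans lo up; rewrite lee_fin size_signs natrX => h.
have := energy_lb_gt0; nra.
Qed.

End fixed_wave.

(** Stands in for the indicator of the Kakeya set: at least 1 on that set, with integral equal to
    the sum of the strip areas. *)
Definition cover_count (x : R * R) : R := \sum_(ks <- cover n) 1 * \1_(@cover_strip R n ks) x.

Lemma integral_cover_count :
  (\int[@leb2 R]_x (cover_count x)%:E <= (n%:R^-1)%:E)%E.
Proof.
rewrite /cover_count (@integral_sum_indic R _ (cover n) (fun=> 1) (@cover_measure R n) (@cover_strip R n)).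
- rewrite lee_fin; under eq_bigr do rewrite mul1r.
  exact: sum_cover_measure.
- by [].
- by move=> ks; exact: measurable_cover_strip.
- by move=> ks; exact: measure_cover_strip.
Qed.

Lemma cover_count_ge0 x : 0 <= cover_count x.
Proof. by apply: sumr_ge0 => ks _; rewrite mul1r indicE ler0n. Qed.

Lemma cover_count_ge1 s x : s \in tubes -> 0 <= x.1 <= 1 / 4 ->
  tube_profile n s x != 0 -> 1 <= cover_count x.
Proof.
move=> st x14 sx.
have xs : `|x.2 - tube_center n n s x.1| <= ((n%:R : R) ^+ n)^-1 / 8.
  have : `|m * (x.2 - tube_center n n s x.1)| < 1.
    by rewrite ltNge; apply: contra sx => /bump_eq0; rewrite /tube_profile => ->.
  rewrite normrM (gtr0_norm m0) -ltr_pdivlMl// mulr1 => /ltW /le_trans; apply.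
  by rewrite /tube_scale invfM mulrC.
have [ks kc kx] := cover_tube n0 st x14 xs.
rewrite /cover_count (big_rem ks)//= mul1r indicE mem_set; last by case: (x) kx.
by rewrite lerDl sumr_ge0// => j _; rewrite mul1r indicE ler0n.
Qed.

Lemma wave_energy_eq0 (N : nat) (lam C S : R) (b : seq bool) (x : R * R) :
  (forall s, s \in tubes -> tube_profile n s x = 0) -> wave_energy n N lam C S b x = 0.
Proof.
move=> H; have z (F : seq nat -> R) k : signed_sum b tubes
    (fun s => tube_amp n s (wave_time R N k) x * F s) = 0.
  apply/normr0_eq0/le_anti; rewrite normr_ge0 andbT.
  apply: (le_trans (ler_norm_signed_sum _ _ _)); rewrite big1_seq// => s /andP[_ st].
  by rewrite /tube_amp H// !mulr0 mul0r normr0.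
by rewrite /wave_energy big1 ?mulr0// => k _; rewrite /wave_re /wave_im !z expr0n addr0.
Qed.

End large_exponents.

(** The key is a pointwise inequality that is linear in the energy: on the Kakeya set, A^(p-2) (kap
    G - kap - A^2) <= V^p. If kap (G - 1) <= A^2 the left side is nonpositive; otherwise y =
    sqrt(kap (G - 1)) >= A and A^(p-2) y^2 <= y^p <= V^p. Integrating, the energy gives at least kap
    c and the constant loses at most D/n. *)
Theorem Lnorm_V2I_unbounded_large (R : realType) (p : R) : 2 < p ->
  ereal_sup [set Lnorm (@leb2 R) p%:E (V2I f) | f in
     [set f : R * R -> R | schwartz f /\ (Lnorm (@leb2 R) p%:E (EFin \o f) <= 1)%E]]
  = +oo%E.
Proof.
move=> p2; have p0 : 0 < p by lra.
(* All waves are bounded by 1 and supported in the square [-5, 5]^2, of area 100. *)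
apply: (@Lnorm_V2I_unbounded R p 100 5) => [||K K0]; [lra|by []|].
have [kap kap0 kapE] : exists2 kap, 0 < kap & kap = variation_const R.
  by exists (variation_const R) => //; exact: variation_const_gt0.
have [c c0 cE] : exists2 c, 0 < c & c = energy_lb R / 2.
  by exists (energy_lb R / 2) => //; have := energy_lb_gt0 R; lra.
(* Once A^(p-2) >= B, half of A^(p-2) kap c already reaches K. Such an A exists because p > 2. *)
pose B := 2 * K / (kap * c).
have B0 : 0 < B by rewrite divr_gt0 ?mulr_gt0.
pose A := Num.max 1 (B `^ (p - 2)^-1).
have A1 : 1 <= A by rewrite le_max lexx.
have A0 : 0 < A by lra.
pose Ap := A `^ (p - 2).
have Ap0 : 0 < Ap by exact: powR_gt0.
have BAp : B <= Ap.
  have -> : B = (B `^ (p - 2)^-1) `^ (p - 2).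
    by rewrite -powRrM mulVf ?powRr1 ?(ltW B0)// gt_eqF// subr_gt0.
  apply: ge0_ler_powR; rewrite ?nnegrE ?powR_ge0 ?(ltW A0)//; first lra.
  by rewrite le_max lexx orbT.
pose D := kap + A ^+ 2.
have D0 : 0 < D by rewrite addr_gt0// exprn_gt0.
(* Makes the loss D/n at most half of the gain kap c. *)
pose n := (Num.truncn (2 * D / (kap * c))).+1.
have n0 : (0 < n)%N by [].
have nR : 0 < n%:R :> R by rewrite ltr0n.
have Dn : D / n%:R <= kap * c / 2.
  have h0 : 2 * D / (kap * c) < n%:R by exact: truncnS_gt.
  have kc0 : 0 < kap * c by exact: mulr_gt0.
  rewrite (ltr_pdivrMr _ _ kc0) in h0.
  rewrite (ler_pdivrMr _ _ nR); lra.
have [N [lam [C [S [N0 C4 HV]]]]] := wave_variation R n0.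
have [b Hb] := exists_signs n0 lam S N0 C4; rewrite -cE in Hb.
pose GG := wave_energy n N lam C S b.
pose Y (x : R * R) := Ap * (kap * (\1_(@slab R) x * GG x) - D * cover_count n x).
pose H (x : R * R) := (Num.max 0 (Y x)) `^ p^-1.
have mc : measurable_fun setT (cover_count n : R * R -> R).
  apply: measurable_sum => ks; apply: measurable_funM => //.
  by apply: measurable_indic; exact: measurable_cover_strip.
have mG : measurable_fun setT (fun x => \1_(@slab R) x * GG x).
  apply: measurable_funM; first by apply: measurable_indic; exact: measurable_slab.
  by apply: smooth2_measurable; exact: smooth2_wave_energy.
have mY : measurable_fun setT (fun x => Num.max 0 (Y x)).
  apply: measurable_maxr => //; apply: measurable_funM => //.
  by apply: measurable_funB; apply: measurable_funM.
have V0 x : (0 <= V2I (wave n lam b) x)%E.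
  apply: le_trans (V2I_ge_diff _ _ (lexx 1) (_ : 1 < 2) (lexx 2)).
    by rewrite lee_fin.
  by rewrite ltr1n.
exists (wave n lam b), H; split.
- exact: smooth2_wave.
- exact: wave_supp.
- apply: (@le_trans _ _ (\int[@leb2 R]_x
      (\sum_(i <- [:: 0%N]) 1 * \1_(strip (-5) 5 0 0 5) x)%:E)%E).
    apply: ge0_le_lower_integral => x; first by rewrite lee_fin powR_ge0.
    rewrite lee_fin big_seq1 mul1r indicE.
    have w1 := wave_le1 n0 lam b x.
    have [_|] := boolP (x \in _).
      have [->|w0] := eqVneq (wave n lam b x) 0; first by rewrite normr0 powR0 ?gt_eqF.
      rewrite (le_trans (ge1r_powR _ _))//; last lra.
      by rewrite normr_gt0 w0.
    rewrite notin_setE /strip /= => h; rewrite wave_supp ?normr0 ?powR0 ?gt_eqF//.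
    apply: contrapT => h'; apply: h; rewrite mul0r addr0 subr0 -ler_norml.
    by split; rewrite leNgt; apply/negP => h''; apply: h'; [left|right].
  rewrite (@integral_sum_indic R nat _ (fun=> 1) (fun=> 100)).
  - by rewrite big_seq1 mul1r.
  - by [].
  - by move=> _; exact: measurable_strip.
  - by move=> _; rewrite measure_strip; [congr (_%:E); ring|lra|lra].
split.
- exact: (measurableT_comp (measurable_powR p^-1) mY).
- by move=> x; exact: powR_ge0.
- move=> x.
  have neg : Y x <= 0 -> ((H x)%:E <= V2I (wave n lam b) x)%E.
    move=> Yx; rewrite /H max_l// powR0 ?invr_eq0 ?gt_eqF//.
  have cov0 := @cover_count_ge0 R n x.
  have [xD|xD] := boolP (x \in @slab R); last first.
    apply: neg; rewrite /Y indicE (negbTE xD) mul0r mulr0 sub0r mulrN oppr_le0.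
    by rewrite mulr_ge0 ?mulr_ge0 ?(ltW Ap0) ?(ltW D0).
  have x14 : 0 <= x.1 <= 1 / 4 by move: xD; rewrite inE.
  have [[s st sx]|none] := pselect (exists2 s, s \in words n n & tube_profile n s x != 0); last first.
    apply: neg; rewrite /Y {1}/GG wave_energy_eq0; last first.
      by move=> s st; apply: contrapT => /eqP h; apply: none; exists s.
    by rewrite !mulr0 sub0r mulrN oppr_le0 mulr_ge0 ?mulr_ge0 ?(ltW Ap0) ?(ltW D0).
  have cov1 := cover_count_ge1 n0 st x14 sx.
  have YE : Y x <= Ap * (kap * (GG x - 1) - A ^+ 2).
    rewrite /Y indicE xD mul1r ler_wpM2l ?(ltW Ap0)//.
    have : D <= D * cover_count n x by rewrite ler_peMr// ltW.
    by rewrite /D; lra.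
  have [small|big] := leP (kap * (GG x - 1)) (A ^+ 2).
    apply: neg; apply: (le_trans YE); rewrite mulr_ge0_le0 ?(ltW Ap0)//.
    by rewrite subr_le0.
  pose y := Num.sqrt (kap * (GG x - 1)).
  have y2 : y ^+ 2 = kap * (GG x - 1) by rewrite sqr_sqrtr// (le_trans (sqr_ge0 A))// ltW.
  have yA : A <= y by rewrite -[A]ger0_norm ?(ltW A0)// -sqrtr_sqr ler_wsqrtr// ltW.
  have y0 : 0 < y by exact: lt_le_trans yA.
  have Yy : Y x <= y `^ p.
    apply: (le_trans YE); rewrite -y2.
    apply: (@le_trans _ _ (y `^ (p - 2) * y ^+ 2)).
      apply: ler_pM; rewrite ?(ltW Ap0) ?subr_ge0//.
      - by rewrite lerXn2r ?nnegrE ?(ltW A0) ?(ltW y0).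
      - by apply: ge0_ler_powR; rewrite ?nnegrE ?(ltW A0) ?(ltW y0)//; lra.
      - by rewrite gerBl sqr_ge0.
    by rewrite -powR_mulrn ?(ltW y0)// -powRD ?subrK// gt_eqF ?implybT.
  apply: le_trans (HV b x _); last by have /andP[] := x14.
  rewrite lee_fin -/GG -kapE -/y /H.
  have -> : y = (y `^ p) `^ p^-1 by rewrite -powRrM divff ?gt_eqF// powRr1// ltW.
  apply: ge0_ler_powR; rewrite ?nnegrE ?powR_ge0 ?invr_ge0 ?(ltW p0)//.
    by rewrite le_max lexx.
  by rewrite ge_max powR_ge0.
have -> : (fun x => (H x `^ p)%:E) = (fun x => (Num.max 0 (Y x))%:E : \bar R).
  by apply/funext => x; rewrite /H -powRrM mulVf ?gt_eqF// powRr1// le_max lexx.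
pose J := (\int[@leb2 R]_x (Num.max 0 (Y x))%:E)%E.
(* The inequality max(0, Y) + Ap D count >= Ap kap 1_slab G is integrated in this additive form, so
   that all integrands are nonnegative. *)
have key : ((Ap * kap * c)%:E <= J + (Ap * D / n%:R)%:E)%E.
  apply: (@le_trans _ _ ((Ap * kap)%:E * \int[@leb2 R]_x (\1_(@slab R) x * GG x)%:E)%E).
    by rewrite EFinM lee_pmul2l ?lte_fin ?mulr_gt0.
  apply: (@le_trans _ _ (J + (Ap * D)%:E * \int[@leb2 R]_x (cover_count n x)%:E)%E); last first.
    rewrite leeD2l// [(Ap * D / _)%:E]EFinM lee_pmul2l ?lte_fin ?mulr_gt0//.
    exact: integral_cover_count.
  rewrite -ge0_integralZl_EFin//; first last.
  - by rewrite mulr_ge0 ?(ltW Ap0) ?(ltW kap0).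
  - exact/measurable_EFinP.
  - by move=> x _; rewrite lee_fin mulr_ge0 ?wave_energy_ge0// indicE ler0n.
  rewrite -ge0_integralZl_EFin//; first last.
  - by rewrite mulr_ge0 ?(ltW Ap0) ?(ltW D0).
  - exact/measurable_EFinP.
  - by move=> x _; rewrite lee_fin cover_count_ge0.
  rewrite /J -ge0_integralD//; first last.
  - by apply/measurable_EFinP; exact: measurable_funM.
  - by move=> x _; rewrite -EFinM lee_fin mulr_ge0 ?cover_count_ge0// mulr_ge0 ?(ltW Ap0) ?(ltW D0).
  - exact/measurable_EFinP.
  - by move=> x _; rewrite lee_fin le_max lexx.
  apply: ge0_le_lower_integral => x; rewrite -!EFinM ?lee_fin.
    by rewrite mulr_ge0 ?(mulr_ge0 (ltW Ap0) (ltW kap0))// mulr_ge0 ?wave_energy_ge0// indicE ler0n.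
  rewrite -lerBlDr le_max; apply/orP; right.
  by rewrite /Y mulrBr !mulrA.
apply: (@le_trans _ _ ((Ap * kap * c)%:E - (Ap * D / n%:R)%:E)%E); last by rewrite leeBlDr.
rewrite -EFinB lee_fin.
have h1 : Ap * D / n%:R <= Ap * (kap * c / 2) by rewrite -mulrA ler_wpM2l// ltW.
have h2 : B * (kap * c) <= Ap * (kap * c) by rewrite ler_wpM2r// mulr_ge0// ltW.
have h3 : B * (kap * c) = 2 * K by rewrite /B mulfVK// mulf_neq0 ?gt_eqF.
lra.
Qed.

Theorem theorem1p1 (R : realType) (p : R) (hp : 1 <= p) :
  ereal_sup [set Lnorm (@leb2 R) p%:E (V2I f) | f in
     [set f : R * R -> R | schwartz f /\ (Lnorm (@leb2 R) p%:E (EFin \o f) <= 1)%E]]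
  = +oo%E.
Proof.
have [p2|p2] := leP p 2; last exact: Lnorm_V2I_unbounded_large.
by apply: Lnorm_V2I_unbounded_small; rewrite hp.
Qed.
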